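(* Let $\chi$ be a primitive Dirichlet character modulo $q\geq 2$ with Dirichlet $L$-function $L(s,\chi)$. There exist constants $b_1,b_2$ with $0.95<b_1<0.951$ and $0.97<b_2<0.971$ such that the following holds. Let $s=\sigma+\mathrm{i}t$ with $\sigma>1/2$ and $$|t|\geq 10450+10^3\log\log q,$$ and assume that $L(z,\chi)\neq 0$ for all $z\in\mathscr{R}(10^3,q,t)$. Then: (a) For $\sigma\in\mathscr{S}(0.5,0.5,q,t)$, $$|\log L(s,\chi)|\leq 5.44\left(b_1\log(q|t|)\right)^{2(1-\sigma)}\log\log(q|t|).$$ (b) For $\sigma\in\mathscr{S}(1.0051,0.3349,q,t)$, $$\left|\frac{L'}{L}(s,\chi)\right|\leq 33.281\left(b_2\log(q|t|)\right)^{2(1-\sigma)}\left(\log\log(q|t|)\right)^2.$$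
   Context: For $C_3>0$, $c\ge1$, $|t|\ge e$: $$\mathscr{R}(C_3,c,t)=\left\{w\in\mathbb{C}:\Re\{w\}>\tfrac12,\ |\Im\{w\}-t|\le C_3\log\log(c(|t|+1))+3\right\},$$ $$\mathscr{S}(A,B,c,t)=\left[\frac12+\frac{A}{\log\log(c|t|)},\ 1+\frac{B}{\log\log(c|t|)}\right].$$ $L(s,\chi)=\sum_{n\ge1}\chi(n)n^{-s}=\prod_p(1-\chi(p)p^{-s})^{-1}$ for $\sigma>1$, continued analytically. $\log L(s,\chi)$ denotes the branch which for $\sigma>1$ equals $\sum_p\sum_{k\ge1}\frac{\chi(p)^k}{kp^{ks}}$, continued holomorphically into the zero-free region under consideration. *)

(* Defs.v *)
From Stdlib Require Export Reals ZArith Znumtheory.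
From Coquelicot Require Export Coquelicot.

Open Scope R_scope.

(* Characters are functions on the integers, extended by 0 to the integers
   not coprime to the modulus. *)
Definition is_dirichlet_character (q : Z) (chi : Z -> C) : Prop :=
  (forall n : Z, chi (n + q)%Z = chi n) /\
  (forall m n : Z, chi (m * n)%Z = (chi m * chi n)%C) /\
  (forall n : Z, chi n <> 0%C <-> rel_prime n q).

Definition is_induced_from (q d : Z) (chi : Z -> C) : Prop :=
  exists psi : Z -> C,
    is_dirichlet_character d psi /\
    forall n : Z, rel_prime n q -> chi n = psi n.

Definition is_primitive_character (q : Z) (chi : Z -> C) : Prop :=
  is_dirichlet_character q chi /\
  forall d : Z, (1 <= d < q)%Z -> (d | q)%Z -> ~ is_induced_from q d chi.

(* x ^ s = exp (s * ln x), meaningful for x > 0. *)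
Definition rcpow (x : R) (s : C) : C :=
  (Rpower x (Re s) * (cos (Im s * ln x), sin (Im s * ln x)))%C.

(* [ex_derive] is inferred over [C_AbsRing], i.e. it is complex
   differentiability; D need not be open. *)
Definition holomorphic_on (D : C -> Prop) (f : C -> C) : Prop :=
  forall z : C, D z -> locally z (fun w : C => ex_derive f w).

(* The series indices are shifted by one, so that they start at n = 1.
   For a primitive character modulo q >= 2 the L-function is entire, and these
   two conditions determine it on the whole plane. *)
Definition is_dirichlet_L (chi : Z -> C) (L : C -> C) : Prop :=
  holomorphic_on (fun _ : C => True) L /\
  forall s : C, 1 < Re s ->
    is_series
      (fun n : nat => (chi (Z.of_nat (S n)) * rcpow (INR (S n)) (- s))%C)
      (L s).

(* l is the sum over primes p of the sums over k >= 1 of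
   chi(p)^k / (k p^(k s)); f p is the inner sum, set to 0 off the primes. *)
Definition is_prime_power_sum (chi : Z -> C) (s l : C) : Prop :=
  exists f : nat -> C,
    (forall p : nat, prime (Z.of_nat p) ->
       is_series
         (fun k : nat =>
            (chi (Z.of_nat p) ^ S k
             / (INR (S k) * rcpow (INR p) (INR (S k) * s)))%C)
         (f p)) /\
    (forall p : nat, ~ prime (Z.of_nat p) -> f p = 0%C) /\
    is_series f l.

(* The branch of log L(., chi) that is the prime power sum for Re s > 1,
   continued holomorphically into D.  The values of logL outside D and the
   half-plane Re s > 1 are irrelevant. *)
Definition is_log_L (chi : Z -> C) (D : C -> Prop) (logL : C -> C) : Prop :=
  holomorphic_on D logL /\
  forall s : C, 1 < Re s -> is_prime_power_sum chi s (logL s).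

Definition regionR (C3 c t : R) (w : C) : Prop :=
  1 / 2 < Re w /\
  Rabs (Im w - t) <= C3 * ln (ln (c * (Rabs t + 1))) + 3.

Definition intervalS (A B c t : R) (sigma : R) : Prop :=
  1 / 2 + A / ln (ln (c * Rabs t)) <= sigma <= 1 + B / ln (ln (c * Rabs t)).

(* Main.v *)
Require Import Defs.
From Stdlib Require Import Lra Lia Psatz Classical ClassicalEpsilon List Permutation.

(** Let T = ln(q|t|) and l = ln T.  Partial summation bounds |L| by a constant
    times sqrt(q|t|) on Re s > 1/2, so Re log L <= T/2 + O(1) there, while the
    Euler product gives |log L(s)| <= ln(1 + 1/(Re s - 1)) for Re s > 1.
    Borel-Caratheodory on discs centred at abscissa 1.1 turns the first bound into
    |log L| <= 1.8 T l on Re s >= 1/2 + 0.5/l.  The target of (a) is log-linear in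
    Re s, so the three lines theorem between the abscissas 1/2 + 0.5/l and
    1 + 0.5/l gives (a); the zero-free region is tall enough for the horizontal
    sides to be negligible.  Cauchy's estimate for log L on a circle of radius
    0.5/l then gives (b).

    Holomorphy here does not include continuity of the derivative, whence
    Goursat's theorem. *)

(** * Complex differentiability *)

(** The function (b T)^(2 (1 - sigma)) is about T at sigma = 1/2 and 1 at sigma = 1, so (a) allows T
    l on the left side and l on the right. On the right the Euler product at distance 0.5 / l from 1
    gives ln (1 + 2 l), well below the allowance. On the left the factor l is the price of
    Borel-Caratheodory at distance about 0.5 / l from the boundary circle. Its constant is governed
    by the exponent 1/2 of q|t| in the bound for L, which partial summation yields from character
    sums of size at most q. After levelling, the left side contributes about 1.8 e / 0.95, and the
    rest of 5.44 is room for rounding and for the damping factor.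

    In (a) a branch of the logarithm is given, in (b) only L is, so a logarithm has to be
    constructed from L'/L. One abstract function serves both: it is differentiable in a strip around
    height t and equals the prime sum to the right of 1.

    The numbers b1 = 0.9505 and b2 = 0.9705 do not depend on chi. The second bound is first proved
    with b1; passing to b2 costs little even for sigma > 1, where a larger base makes the right side
    smaller, because sigma - 1 is at most 0.3349 / l. *)

Lemma geom_eventually_lt (K x e : R) :
  0 <= K -> 0 <= x < 1 -> 0 < e -> exists N, forall n, (N <= n)%nat -> K * x ^ n < e.
Proof.
  intros HK Hx He.
  destruct (pow_lt_1_zero x ltac:(rewrite Rabs_pos_eq; lra) (e / (K + 1))
    ltac:(apply Rdiv_lt_0_compat; lra)) as (N & HN).
  exists N. intros n Hn. specialize (HN n Hn).
  assert (P : 0 <= x ^ n) by (apply pow_le; lra). rewrite Rabs_pos_eq in HN by auto.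
  apply Rle_lt_trans with ((K + 1) * x ^ n). nra.
  replace e with ((K + 1) * (e / (K + 1))) by (field; lra). apply Rmult_lt_compat_l; lra.
Qed.

Lemma exists_pos_le_four (a b c d : R) :
  0 < a -> 0 < b -> 0 < c -> 0 < d -> exists m, 0 < m /\ m <= a /\ m <= b /\ m <= c /\ m <= d.
Proof.
  intros. exists (Rmin (Rmin a b) (Rmin c d)).
  generalize (Rmin_l (Rmin a b) (Rmin c d)) (Rmin_r (Rmin a b) (Rmin c d))
    (Rmin_l a b) (Rmin_r a b) (Rmin_l c d) (Rmin_r c d).
  split; [repeat apply Rmin_pos; auto|lra].
Qed.

Lemma Cball_Cmod (z w : C) (e : R) : Cmod (w - z) < e -> ball (M := C_UniformSpace) z e w.
Proof. exact (C_NormedModule_mixin_compat1 z w e). Qed.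

(** A ball of [C] is a square in the product uniform structure, so the modulus can exceed the radius
    by a factor sqrt 2, rounded here to 2. *)
Lemma Cmod_Cball (z w : C) (e : posreal) :
  ball (M := C_UniformSpace) z e w -> Cmod (w - z) < 2 * e.
Proof.
  intros H. apply Rlt_trans with (sqrt 2 * e).
  exact (C_NormedModule_mixin_compat2 z w e H).
  apply Rmult_lt_compat_r. apply cond_pos.
  rewrite <- (sqrt_square 2) at 2 by lra. apply sqrt_lt_1; lra.
Qed.

Lemma Clocally_eps (z : C) (P : C -> Prop) :
  locally (T := C_UniformSpace) z P <->
  exists d, 0 < d /\ forall w, Cmod (w - z) < d -> P w.
Proof.
  split.
  - intros [d Hd]. exists d. split. apply cond_pos.
    intros w Hw. apply Hd, Cball_Cmod, Hw.
  - intros (d & Hd & H). assert (Hd2 : 0 < d / 2) by lra.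
    exists (mkposreal _ Hd2). intros w Hw. apply H.
    generalize (Cmod_Cball _ _ _ Hw). simpl. lra.
Qed.

Lemma Ccontinuous_eps (f : C -> C) (z : C) :
  continuous f z <->
  forall eps, 0 < eps -> exists d, 0 < d /\
    forall w, Cmod (w - z) < d -> Cmod (f w - f z) < eps.
Proof.
  split.
  - intros H eps He. assert (He2 : 0 < eps / 2) by lra.
    apply (proj1 (filterlim_locally f (f z))) with (eps := mkposreal _ He2) in H.
    apply Clocally_eps in H. destruct H as (d & Hd & H). exists d; split; auto.
    intros w Hw. apply H, Cmod_Cball in Hw. simpl in Hw. lra.
  - intros H. apply (filterlim_locally f (f z)). intros eps.
    apply Clocally_eps. destruct (H eps (cond_pos eps)) as (d & Hd & H').
    exists d; split; auto. intros w Hw. apply Cball_Cmod, H', Hw.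
Qed.

Lemma C_is_derive_eps (f : C -> C) (z l : C) :
  is_derive f z l <->
  forall eps, 0 < eps -> exists d, 0 < d /\
    forall w, Cmod (w - z) < d ->
      Cmod (f w - f z - (w - z) * l) <= eps * Cmod (w - z).
Proof.
  split.
  - intros [_ H] eps He.
    assert (H1 := H z (fun P HP => HP) (mkposreal eps He)).
    apply (proj2 (locally_C z _)), Clocally_eps in H1.
    destruct H1 as (d & Hd & H1). exists d; split; auto.
  - intros H. split. apply is_linear_scal_l.
    intros x Hx.
    assert (x = z).
    { symmetry. exact (is_filter_lim_locally_unique (V := AbsRing_NormedModule C_AbsRing) z x Hx). }
    subst x. intros eps. apply (proj1 (locally_C z _)), Clocally_eps.
    destruct (H eps (cond_pos eps)) as (d & Hd & H'). exists d; split; auto.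
Qed.

(** The product and chain rules are stated for [C] as an absolute ring, the other rules for
    [C_NormedModule]; the conditions unfold to the same statements. *)
Lemma is_derive_C_AbsRing (f : C -> C) (z l : C) :
  is_derive (V := C_NormedModule) f z l <-> is_derive (V := AbsRing_NormedModule C_AbsRing) f z l.
Proof. split; intros [[H1 H2 H3] H]; (split; [split; [exact H1|exact H2|exact H3]|exact H]). Qed.

Lemma C_ex_derive_continuous (f : C -> C) (z : C) : ex_derive f z -> continuous f z.
Proof.
  intros H. apply (ex_derive_continuous (K := C_AbsRing) (V := C_NormedModule)) in H.
  intros P HP. apply (proj2 (locally_C z _)). exact (H P HP).
Qed.

Lemma C_is_derive_ext_loc (f g : C -> C) (z l : C) :
  locally z (fun w => f w = g w) -> is_derive f z l -> is_derive g z l.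
Proof.
  intros H. apply (is_derive_ext_loc (K := C_AbsRing) (V := C_NormedModule)).
  apply (proj1 (locally_C z _)), H.
Qed.

Lemma C_ex_derive_ext_loc (f g : C -> C) (z : C) :
  locally z (fun w => f w = g w) -> ex_derive f z -> ex_derive g z.
Proof. intros H [l Hl]. exists l. eapply C_is_derive_ext_loc; eauto. Qed.

Lemma C_is_derive_ext (f g : C -> C) (z l : C) :
  (forall w, f w = g w) -> is_derive f z l -> is_derive g z l.
Proof. exact (is_derive_ext (K := C_AbsRing) (V := C_NormedModule) f g z l). Qed.

Lemma C_ex_derive_ext (f g : C -> C) (z : C) :
  (forall w, f w = g w) -> ex_derive f z -> ex_derive g z.
Proof. exact (ex_derive_ext (K := C_AbsRing) (V := C_NormedModule) f g z). Qed.

Lemma C_is_derive_const (c z : C) : is_derive (fun _ => c) z (RtoC 0).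
Proof. exact (is_derive_const (K := C_AbsRing) (V := C_NormedModule) c z). Qed.

Lemma C_is_derive_id (z : C) : is_derive (fun w : C => w) z (RtoC 1).
Proof. apply is_derive_C_AbsRing. exact (is_derive_id (K := C_AbsRing) z). Qed.

Lemma C_is_derive_plus (f g : C -> C) (z a b : C) :
  is_derive f z a -> is_derive g z b -> is_derive (fun w => f w + g w)%C z (a + b)%C.
Proof. exact (is_derive_plus (K := C_AbsRing) (V := C_NormedModule) f g z a b). Qed.

Lemma C_is_derive_minus (f g : C -> C) (z a b : C) :
  is_derive f z a -> is_derive g z b -> is_derive (fun w => f w - g w)%C z (a - b)%C.
Proof. exact (is_derive_minus (K := C_AbsRing) (V := C_NormedModule) f g z a b). Qed.

Lemma C_is_derive_opp (f : C -> C) (z a : C) :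
  is_derive f z a -> is_derive (fun w => - f w)%C z (- a)%C.
Proof. exact (is_derive_opp (K := C_AbsRing) (V := C_NormedModule) f z a). Qed.

Lemma C_is_derive_comp (f g : C -> C) (z a b : C) :
  is_derive f (g z) a -> is_derive g z b -> is_derive (fun w => f (g w)) z (b * a)%C.
Proof.
  intros Hf Hg. apply (is_derive_comp (K := C_AbsRing) (V := C_NormedModule) f g z a b Hf).
  apply is_derive_C_AbsRing, Hg.
Qed.

Lemma C_is_derive_mult (f g : C -> C) (z a b : C) :
  is_derive f z a -> is_derive g z b ->
  is_derive (fun w => f w * g w)%C z (a * g z + f z * b)%C.
Proof.
  rewrite !is_derive_C_AbsRing. intros Hf Hg.
  exact (is_derive_mult (K := C_AbsRing) f g z a b Hf Hg Cmult_comm).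
Qed.

Lemma C_is_derive_mul_const (c z : C) : is_derive (fun w : C => w * c)%C z c.
Proof.
  apply C_is_derive_eps. intros eps He. exists 1; split; [lra|].
  intros w _. replace (w * c - z * c - (w - z) * c)%C with (RtoC 0) by ring.
  rewrite Cmod_0. apply Rmult_le_pos; [lra|apply Cmod_ge_0].
Qed.

Lemma C_is_derive_scal (c : C) (f : C -> C) (z l : C) :
  is_derive f z l -> is_derive (fun w => c * f w)%C z (c * l)%C.
Proof.
  intros H. replace (c * l)%C with (0 * f z + c * l)%C by ring.
  apply (C_is_derive_mult (fun _ => c) f); auto. apply C_is_derive_const.
Qed.

Lemma C_is_derive_const_mul (c z : C) : is_derive (fun w : C => c * w)%C z c.
Proof.
  generalize (C_is_derive_scal c (fun w => w) z _ (C_is_derive_id z)).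
  rewrite Cmult_1_r. auto.
Qed.

Lemma C_is_derive_inv (z : C) :
  z <> 0%C -> is_derive (fun w : C => / w)%C z (- / (z * z))%C.
Proof.
  intros Hz. apply C_is_derive_eps. intros eps He.
  assert (Mz : 0 < Cmod z) by (apply Cmod_gt_0, Hz).
  set (m := Cmod z) in *.
  (* The bound m / 2 gives |w| > m / 2; the other one then makes |w - z| / (m^2 |w|) at most eps. *)
  assert (Hd : 0 < Rmin (m / 2) (eps * m * m * m / 2)).
  { apply Rmin_pos; [lra|]. repeat apply Rmult_lt_0_compat; lra. }
  exists (Rmin (m / 2) (eps * m * m * m / 2)). split; auto.
  intros w Hw.
  assert (W1 := Rlt_le_trans _ _ _ Hw (Rmin_l _ _)).
  assert (W2 := Rlt_le_trans _ _ _ Hw (Rmin_r _ _)).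
  assert (Mw : m / 2 < Cmod w).
  { assert (m <= Cmod w + Cmod (w - z)).
    { unfold m. replace z with (w - (w - z))%C at 1 by ring.
      eapply Rle_trans; [apply Cmod_triangle|]. rewrite Cmod_opp. lra. }
    lra. }
  assert (Hw0 : w <> 0%C) by (apply Cmod_gt_0; lra).
  replace (/ w - / z - (w - z) * - / (z * z))%C with ((w - z) * (w - z) / (z * z * w))%C
    by (field; auto).
  rewrite Cmod_div by (repeat apply Cmult_neq_0; auto).
  rewrite !Cmod_mult. fold m. set (h := Cmod (w - z)) in *.
  assert (Hh : 0 <= h) by apply Cmod_ge_0.
  assert (HD : 0 < m * m * Cmod w) by (repeat apply Rmult_lt_0_compat; lra).
  apply Rmult_le_reg_r with (m * m * Cmod w); auto.
  unfold Rdiv. rewrite Rmult_assoc, Rinv_l by lra. rewrite Rmult_1_r.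
  replace (eps * h * (m * m * Cmod w)) with (h * (eps * (m * m * Cmod w))) by ring.
  apply Rmult_le_compat_l; auto.
  apply Rle_trans with (eps * (m * m * (m / 2))); [lra|].
  apply Rmult_le_compat_l; [lra|]. apply Rmult_le_compat_l; [nra|lra].
Qed.

Lemma C_ex_derive_const (c z : C) : ex_derive (fun _ : C => c) z.
Proof. eexists; apply C_is_derive_const. Qed.
Lemma C_ex_derive_id (z : C) : ex_derive (fun w : C => w) z.
Proof. eexists; apply C_is_derive_id. Qed.
Lemma C_ex_derive_plus (f g : C -> C) (z : C) :
  ex_derive f z -> ex_derive g z -> ex_derive (fun w => f w + g w)%C z.
Proof. intros [a Ha] [b Hb]; eexists; apply C_is_derive_plus; eauto. Qed.
Lemma C_ex_derive_minus (f g : C -> C) (z : C) :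
  ex_derive f z -> ex_derive g z -> ex_derive (fun w => f w - g w)%C z.
Proof. intros [a Ha] [b Hb]; eexists; apply C_is_derive_minus; eauto. Qed.
Lemma C_ex_derive_mult (f g : C -> C) (z : C) :
  ex_derive f z -> ex_derive g z -> ex_derive (fun w => f w * g w)%C z.
Proof. intros [a Ha] [b Hb]; eexists; apply C_is_derive_mult; eauto. Qed.
Lemma C_ex_derive_comp (f g : C -> C) (z : C) :
  ex_derive f (g z) -> ex_derive g z -> ex_derive (fun w => f (g w)) z.
Proof. intros [a Ha] [b Hb]; eexists; apply C_is_derive_comp; eauto. Qed.
Lemma C_ex_derive_div (f g : C -> C) (z : C) :
  ex_derive f z -> ex_derive g z -> g z <> 0%C -> ex_derive (fun w => f w / g w)%C z.
Proof.
  intros Hf Hg H. apply C_ex_derive_mult; auto.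
  apply (C_ex_derive_comp (fun w => / w)%C); auto.
  eexists; apply C_is_derive_inv, H.
Qed.
Lemma C_ex_derive_pow (f : C -> C) (n : nat) (z : C) :
  ex_derive f z -> ex_derive (fun w => f w ^ n)%C z.
Proof.
  intros H. induction n; simpl. apply C_ex_derive_const. apply C_ex_derive_mult; auto.
Qed.

Lemma Cmod_le_Re_Im (z : C) : Cmod z <= Rabs (Re z) + Rabs (Im z).
Proof.
  replace z with (RtoC (Re z) + Ci * RtoC (Im z))%C at 1.
  - eapply Rle_trans; [apply Cmod_triangle|]. rewrite Cmod_mult, Cmod_Ci, !Cmod_R. lra.
  - destruct z. unfold Cplus, Cmult, Ci, RtoC, Re, Im; simpl. f_equal; ring.
Qed.

Lemma Im_le_Cmod (z : C) : Rabs (Im z) <= Cmod z.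
Proof. eapply Rle_trans; [|apply Rmax_Cmod]. apply Rmax_r. Qed.

Lemma Re_le_Cmod (z : C) : Re z <= Cmod z.
Proof. eapply Rle_trans; [apply Rle_abs|apply re_le_Cmod]. Qed.

Lemma Re_minus (a b : C) : Re (a - b) = Re a - Re b.
Proof. reflexivity. Qed.
Lemma Im_minus (a b : C) : Im (a - b) = Im a - Im b.
Proof. reflexivity. Qed.

Lemma Re_Im_near (u z : C) (r : R) :
  Cmod (u - z) <= r -> - r <= Re u - Re z <= r /\ - r <= Im u - Im z <= r.
Proof.
  intros H. rewrite <- Re_minus, <- Im_minus.
  split; apply Rabs_le_between; eapply Rle_trans; eauto using re_le_Cmod, Im_le_Cmod.
Qed.

Lemma Cmod_minus_sym (a b : C) : Cmod (a - b) = Cmod (b - a).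
Proof. rewrite <- Cmod_opp. f_equal. ring. Qed.

Lemma Cmod_triangle_minus (a b : C) : Cmod (a - b) <= Cmod a + Cmod b.
Proof. unfold Cminus. eapply Rle_trans; [apply Cmod_triangle|]. rewrite Cmod_opp. lra. Qed.

Lemma Cmod_triangle_inv (a b : C) : Cmod a - Cmod b <= Cmod (a - b).
Proof.
  assert (Cmod a <= Cmod (a - b) + Cmod b); [|lra].
  replace a with (a - b + b)%C at 1 by ring. apply Cmod_triangle.
Qed.

(** * The exponential and Goursat's theorem *)

Definition Cexp (z : C) : C := (exp (Re z) * cos (Im z), exp (Re z) * sin (Im z)).

Lemma Cexp_plus (z w : C) : Cexp (z + w) = (Cexp z * Cexp w)%C.
Proof.
  unfold Cexp, Cmult, Cplus, Re, Im; simpl.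
  rewrite exp_plus, cos_plus, sin_plus. f_equal; ring.
Qed.

Lemma Cexp_0 : Cexp 0 = 1%C.
Proof. unfold Cexp, RtoC, Re, Im; simpl. rewrite exp_0, cos_0, sin_0. f_equal; ring. Qed.

Lemma Cmod_Cexp (z : C) : Cmod (Cexp z) = exp (Re z).
Proof.
  unfold Cmod, Cexp. simpl fst; simpl snd.
  replace ((exp (Re z) * cos (Im z)) ^ 2 + (exp (Re z) * sin (Im z)) ^ 2)
    with (exp (Re z) * exp (Re z)).
  - apply sqrt_square. left; apply exp_pos.
  - generalize (sin2_cos2 (Im z)). unfold Rsqr. nra.
Qed.

Lemma Cexp_neq_0 (z : C) : Cexp z <> 0%C.
Proof. apply Cmod_gt_0. rewrite Cmod_Cexp. apply exp_pos. Qed.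

Lemma Cexp_opp (z : C) : Cexp (- z) = (/ Cexp z)%C.
Proof.
  assert (H : (Cexp z * Cexp (- z) = 1)%C).
  { rewrite <- Cexp_plus, <- Cexp_0. f_equal. ring. }
  rewrite <- (Cmult_1_r (/ Cexp z)), <- H. field. apply Cexp_neq_0.
Qed.

Lemma Cexp_RtoC (x : R) : Cexp x = RtoC (exp x).
Proof. unfold Cexp, RtoC, Re, Im; simpl. rewrite cos_0, sin_0. f_equal; ring. Qed.

Lemma derivable_pt_lim_increment (f : R -> R) (l eps : R) :
  derivable_pt_lim f 0 l -> 0 < eps ->
  exists d, 0 < d /\ forall h, Rabs h < d -> Rabs (f h - f 0 - h * l) <= eps * Rabs h.
Proof.
  intros H He. destruct (H eps He) as (d & Hd). exists d. split. apply cond_pos.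
  intros h Hh. destruct (Req_dec h 0) as [->|N].
  - replace (f 0 - f 0 - 0 * l) with 0 by ring. rewrite Rabs_R0. lra.
  - specialize (Hd h N Hh). rewrite Rplus_0_l in Hd.
    replace (f h - f 0 - h * l) with (((f h - f 0) / h - l) * h) by (field; auto).
    rewrite Rabs_mult. apply Rmult_le_compat_r. apply Rabs_pos. lra.
Qed.

(** The addition formula moves the point to 0, where the real derivatives of exp, cos and sin
    suffice. *)
Lemma C_is_derive_Cexp (z : C) : is_derive Cexp z (Cexp z).
Proof.
  apply C_is_derive_eps. intros eps He.
  set (M := Cmod (Cexp z)).
  assert (HM : 0 < M) by (unfold M; rewrite Cmod_Cexp; apply exp_pos).
  (* With relative error [e] in each real increment, the complex error stays below 8 e |h|; the
     factor M = |exp z| then leaves eps |h|. *)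
  set (e := Rmin (1 / 4) (eps / (8 * M))).
  assert (He0 : 0 < e) by (apply Rmin_pos; [lra|apply Rdiv_lt_0_compat; lra]).
  assert (He1 : e <= 1 / 4) by apply Rmin_l.
  assert (HeM : 8 * e * M <= eps).
  { apply Rle_trans with (8 * (eps / (8 * M)) * M); [|right; field; lra].
    apply Rmult_le_compat_r, Rmult_le_compat_l, Rmin_r; lra. }
  destruct (derivable_pt_lim_increment exp _ e (derivable_pt_lim_exp 0) He0) as (d1 & Hd1 & H1).
  destruct (derivable_pt_lim_increment cos _ e (derivable_pt_lim_cos 0) He0) as (d2 & Hd2 & H2).
  destruct (derivable_pt_lim_increment sin _ e (derivable_pt_lim_sin 0) He0) as (d3 & Hd3 & H3).
  destruct (exists_pos_le_four d1 d2 d3 e) as (d & Hd & L1 & L2 & L3 & L4); auto.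
  exists d. split; auto. intros w Hw.
  replace (Cexp w) with (Cexp z * Cexp (w - z))%C by (rewrite <- Cexp_plus; f_equal; ring).
  set (h := (w - z)%C) in *.
  replace (Cexp z * Cexp h - Cexp z - h * Cexp z)%C with (Cexp z * (Cexp h - 1 - h))%C by ring.
  rewrite Cmod_mult. fold M. set (r := Cmod h) in *.
  assert (X := re_le_Cmod h). assert (Y := Im_le_Cmod h). fold r in X, Y.
  assert (B : Cmod (Cexp h - 1 - h) <= 8 * e * r).
  { eapply Rle_trans; [apply Cmod_le_Re_Im|].
    destruct h as [x y]. unfold Re, Im in *; simpl in *.
    specialize (H1 x ltac:(lra)). specialize (H2 y ltac:(lra)). specialize (H3 y ltac:(lra)).
    rewrite exp_0 in H1. rewrite cos_0, sin_0 in *.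
    replace (exp x * cos y + - (1) + - x)
      with ((exp x - 1 - x * 1) + exp x * (cos y - 1 - y * - 0)) by ring.
    replace (exp x * sin y + - 0 + - y)
      with (exp x * (sin y - 0 - y * 1) + ((exp x - 1 - x * 1) + x) * y) by ring.
    assert (e * Rabs x <= e * r) by (apply Rmult_le_compat_l; lra).
    assert (e * Rabs y <= e * r) by (apply Rmult_le_compat_l; lra).
    assert (Ex : Rabs (exp x) <= 2).
    { replace (exp x) with ((exp x - 1 - x * 1) + x + 1) by ring.
      eapply Rle_trans; [apply Rabs_triang|]. rewrite Rabs_R1.
      generalize (Rabs_triang (exp x - 1 - x * 1) x). nra. }
    assert (Rabs ((exp x - 1 - x * 1) + x) <= 2 * e).
    { generalize (Rabs_triang (exp x - 1 - x * 1) x). nra. }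
    assert (Ry := Rabs_pos y). assert (0 <= e * Rabs y) by (apply Rmult_le_pos; lra).
    eapply Rle_trans; [apply Rplus_le_compat; apply Rabs_triang|].
    rewrite !Rabs_mult.
    assert (P1 : Rabs (exp x) * Rabs (cos y - 1 - y * - 0) <= 2 * (e * r))
      by (apply Rmult_le_compat; try apply Rabs_pos; lra).
    assert (P2 : Rabs (exp x) * Rabs (sin y - 0 - y * 1) <= 2 * (e * r))
      by (apply Rmult_le_compat; try apply Rabs_pos; lra).
    assert (P3 : Rabs (exp x - 1 - x * 1 + x) * Rabs y <= 2 * e * r)
      by (apply Rmult_le_compat; try apply Rabs_pos; lra).
    lra. }
  assert (0 <= r) by apply Cmod_ge_0.
  apply Rle_trans with (M * (8 * e * r)). apply Rmult_le_compat_l; lra.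
  replace (M * (8 * e * r)) with (8 * e * M * r) by ring. apply Rmult_le_compat_r; auto.
Qed.

Lemma C_ex_derive_Cexp (f : C -> C) (z : C) :
  ex_derive f z -> ex_derive (fun w => Cexp (f w)) z.
Proof. intros H. apply (C_ex_derive_comp Cexp f); auto. eexists; apply C_is_derive_Cexp. Qed.

#[local] Hint Resolve C_ex_derive_const C_ex_derive_id C_ex_derive_plus C_ex_derive_minus
  C_ex_derive_mult C_ex_derive_div C_ex_derive_pow C_ex_derive_Cexp : cder.

Local Notation CR := C_R_CompleteNormedModule.

Lemma CR_norm (z : C) : norm (K := R_AbsRing) (V := C_R_NormedModule) z = Cmod z.
Proof.
  unfold norm; simpl. unfold prod_norm, Cmod, norm; simpl. unfold abs; simpl.
  destruct z as [x y]; simpl. f_equal.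
  rewrite !Rmult_1_r, <- !Rabs_mult, !Rabs_pos_eq by nra. reflexivity.
Qed.

Lemma continuous_path (f : C -> C) (g : R -> C) (t : R) (k : R) :
  (forall u, Cmod (g u - g t) <= k * Rabs (u - t)) ->
  continuous f (g t) -> continuous (U := C_UniformSpace) (fun u => f (g u)) t.
Proof.
  intros Hg Hf.
  apply (continuous_comp (V := C_UniformSpace) (W := C_UniformSpace) g f); auto.
  apply (filterlim_locally g (g t)). intros eps.
  assert (Hk : 0 < Rabs k + 1) by (generalize (Rabs_pos k); lra).
  assert (Hd : 0 < eps / (Rabs k + 1)) by (apply Rdiv_lt_0_compat; auto; apply cond_pos).
  exists (mkposreal _ Hd). intros u Hu. apply Cball_Cmod.
  change (Rabs (u - t) < eps / (Rabs k + 1)) in Hu.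
  eapply Rle_lt_trans; [apply Hg|].
  apply Rle_lt_trans with ((Rabs k + 1) * Rabs (u - t)).
  - apply Rmult_le_compat_r; [apply Rabs_pos|]. generalize (Rle_abs k); lra.
  - apply Rlt_le_trans with ((Rabs k + 1) * (eps / (Rabs k + 1))).
    apply Rmult_lt_compat_l; auto. right; field; lra.
Qed.

Lemma Cmod_horizontal (x y u : R) : Cmod ((u, y) - (x, y)) = Rabs (u - x).
Proof. rewrite <- Cmod_R. f_equal. unfold Cminus, Cplus, Copp, RtoC; simpl. f_equal; ring. Qed.

Lemma Cmod_vertical (x y u : R) : Cmod ((x, u) - (x, y)) = Rabs (u - y).
Proof.
  replace ((x, u) - (x, y))%C with (Ci * RtoC (u - y))%C.
  rewrite Cmod_mult, Cmod_Ci, Cmod_R. ring.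
  unfold Cminus, Cplus, Copp, Cmult, Ci, RtoC; simpl. f_equal; ring.
Qed.

Lemma continuous_horizontal (f : C -> C) (x y : R) :
  continuous f (x, y) -> continuous (U := C_UniformSpace) (fun u => f (u, y)) x.
Proof.
  intros H. apply (continuous_path f (fun u => (u, y)) x 1); auto.
  intros u. rewrite Cmod_horizontal. lra.
Qed.

Lemma continuous_vertical (f : C -> C) (x y : R) :
  continuous f (x, y) -> continuous (U := C_UniformSpace) (fun u => f (x, u)) y.
Proof.
  intros H. apply (continuous_path f (fun u => (x, u)) y 1); auto.
  intros u. rewrite Cmod_vertical. lra.
Qed.

(** Bridge from complex derivatives to functions of a real variable, for which the integral and the
    fundamental theorem of calculus are stated. *)
Lemma is_derive_along_line (F : C -> C) (z v l : C) (t : R) :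
  is_derive F (z + t * v)%C l ->
  is_derive (K := R_AbsRing) (V := C_R_NormedModule) (fun u : R => F (z + u * v)%C) t (v * l)%C.
Proof.
  intros H. split. apply is_linear_scal_l.
  intros x Hx.
  assert (x = t).
  { symmetry. exact (is_filter_lim_locally_unique (V := AbsRing_NormedModule R_AbsRing) t x Hx). }
  subst x. intros eps.
  set (k := Cmod v + 1).
  assert (Hk : 1 <= k) by (unfold k; generalize (Cmod_ge_0 v); lra).
  assert (He : 0 < eps / k) by (apply Rdiv_lt_0_compat; [apply cond_pos|lra]).
  destruct (proj1 (C_is_derive_eps F _ l) H _ He) as (d & Hd & HH).
  assert (Hd2 : 0 < d / k) by (apply Rdiv_lt_0_compat; lra).
  exists (mkposreal _ Hd2). intros u Hu.
  change (Rabs (u - t) < d / k) in Hu.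
  assert (E : (z + u * v - (z + t * v) = RtoC (u - t) * v)%C) by (rewrite RtoC_minus; ring).
  assert (M : Cmod (z + u * v - (z + t * v)) <= k * Rabs (u - t)).
  { rewrite E, Cmod_mult, Cmod_R, Rmult_comm.
    apply Rmult_le_compat_r; [apply Rabs_pos|]. unfold k; lra. }
  assert (HH' := HH (z + u * v)%C). 
  rewrite CR_norm.
  change (norm (minus u t)) with (Rabs (u - t)).
  change (scal (minus u t) (v * l)%C) with (@scal R_Ring C_R_ModuleSpace (u - t) (v * l)%C).
  rewrite scal_R_Cmult.
  change (minus (minus (F (z + u * v)%C) (F (z + t * v)%C)) (RtoC (u - t) * (v * l))%C)
    with (F (z + u * v) - F (z + t * v) - RtoC (u - t) * (v * l))%C.
  replace (RtoC (u - t) * (v * l))%C with ((z + u * v - (z + t * v)) * l)%C by (rewrite E; ring).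
  eapply Rle_trans. apply HH'.
  - eapply Rle_lt_trans; [apply M|].
    apply Rlt_le_trans with (k * (d / k)). apply Rmult_lt_compat_l; lra. right; field; lra.
  - apply Rle_trans with (eps / k * (k * Rabs (u - t))).
    apply Rmult_le_compat_l; [lra|apply M]. right; field; lra.
Qed.

(** * Integrals over the sides and boundaries of rectangles *)

Definition hor_int (f : C -> C) (y a b : R) : C := RInt (V := CR) (fun x => f (x, y)) a b.
(** Integrates in dy; the factor i of dz is supplied in [rect_int], which runs counterclockwise. *)
Definition ver_int (f : C -> C) (x c d : R) : C := RInt (V := CR) (fun y => f (x, y)) c d.
Definition rect_int (f : C -> C) (a b c d : R) : C :=
  (hor_int f c a b + Ci * ver_int f b c d - hor_int f d a b - Ci * ver_int f a c d)%C.

Lemma hor_int_primitive (F f : C -> C) (y a b : R) :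
  a <= b -> (forall x, a <= x <= b -> is_derive F (x, y) (f (x, y)) /\ continuous f (x, y)) ->
  hor_int f y a b = (F (b, y) - F (a, y))%C.
Proof.
  intros Hab H. unfold hor_int. apply (is_RInt_unique (V := CR)).
  apply (is_RInt_derive (V := CR) (fun x => F (x, y)) (fun x => f (x, y))).
  - intros x Hx. rewrite Rmin_left, Rmax_right in Hx by auto.
    assert (D := is_derive_along_line F (0, y) 1%C (f (x, y)) x).
    replace (1 * f (x, y))%C with (f (x, y)) in D by ring.
    eapply is_derive_ext; [|apply D].
    + intros u. simpl. f_equal. unfold Cplus, Cmult, RtoC; simpl. f_equal; ring.
    + replace ((0, y) + x * 1)%C with (x, y). apply H, Hx.
      unfold Cplus, Cmult, RtoC; simpl. f_equal; ring.
  - intros x Hx. rewrite Rmin_left, Rmax_right in Hx by auto.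
    apply continuous_horizontal, H, Hx.
Qed.

Lemma ver_int_primitive (F f : C -> C) (x c d : R) :
  c <= d -> (forall y, c <= y <= d -> is_derive F (x, y) (f (x, y)) /\ continuous f (x, y)) ->
  (Ci * ver_int f x c d = F (x, d) - F (x, c))%C.
Proof.
  intros Hab H. unfold ver_int.
  replace (RInt (V := CR) (fun y => f (x, y)) c d)
    with ((- Ci * F (x, d)) - (- Ci * F (x, c)))%C.
  { replace (Ci * (- Ci * F (x, d) - - Ci * F (x, c)))%C
      with (- (Ci * Ci) * (F (x, d) - F (x, c)))%C by ring.
    replace (Ci * Ci)%C with (- (1))%C. ring.
    unfold Cmult, Ci, Copp, RtoC; simpl; f_equal; ring. }
  symmetry. apply (is_RInt_unique (V := CR)).
  apply (is_RInt_derive (V := CR) (fun y => (- Ci * F (x, y))%C) (fun y => f (x, y))).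
  - intros y Hy. rewrite Rmin_left, Rmax_right in Hy by auto.
    assert (DF : is_derive (fun z : C => (- Ci * F z)%C) (x, y) (- Ci * f (x, y))%C).
    { replace (- Ci * f (x, y))%C with (0 * F (x, y) + - Ci * f (x, y))%C by ring.
      apply (C_is_derive_mult (fun _ => - Ci)%C F); [apply C_is_derive_const|apply H, Hy]. }
    assert (D := is_derive_along_line (fun z => (- Ci * F z)%C) (x, 0) Ci (- Ci * f (x, y))%C y).
    replace (Ci * (- Ci * f (x, y)))%C with (f (x, y)) in D.
    2: { replace (Ci * (- Ci * f (x, y)))%C with (- (Ci * Ci) * f (x, y))%C by ring.
         replace (Ci * Ci)%C with (- (1))%C. ring.
         unfold Cmult, Ci, Copp, RtoC; simpl; f_equal; ring. }
    eapply is_derive_ext; [|apply D].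
    + intros u. simpl. f_equal. f_equal. unfold Cplus, Cmult, RtoC, Ci; simpl. f_equal; ring.
    + replace ((x, 0) + y * Ci)%C with (x, y). apply DF.
      unfold Cplus, Cmult, RtoC, Ci; simpl. f_equal; ring.
  - intros y Hy. rewrite Rmin_left, Rmax_right in Hy by auto.
    apply continuous_vertical, H, Hy.
Qed.

Lemma ex_hor_int (f : C -> C) (y a b : R) :
  a <= b -> (forall x, a <= x <= b -> continuous f (x, y)) ->
  ex_RInt (V := CR) (fun x => f (x, y)) a b.
Proof.
  intros Hab H. apply (ex_RInt_continuous (V := CR)). intros x Hx.
  rewrite Rmin_left, Rmax_right in Hx by auto. apply continuous_horizontal, H, Hx.
Qed.

Lemma ex_ver_int (f : C -> C) (x c d : R) :
  c <= d -> (forall y, c <= y <= d -> continuous f (x, y)) ->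
  ex_RInt (V := CR) (fun y => f (x, y)) c d.
Proof.
  intros Hab H. apply (ex_RInt_continuous (V := CR)). intros y Hy.
  rewrite Rmin_left, Rmax_right in Hy by auto. apply continuous_vertical, H, Hy.
Qed.

Lemma Cmod_hor_int_le (f : C -> C) (y a b M : R) :
  a <= b -> (forall x, a <= x <= b -> continuous f (x, y) /\ Cmod (f (x, y)) <= M) ->
  Cmod (hor_int f y a b) <= (b - a) * M.
Proof.
  intros Hab H. rewrite <- CR_norm.
  eapply (norm_RInt_le_const (V := C_R_NormedModule)); [exact Hab| |].
  - intros x Hx. rewrite CR_norm. apply H, Hx.
  - apply (RInt_correct (V := CR)), ex_hor_int; auto. intros; apply H; auto.
Qed.

Lemma Cmod_ver_int_le (f : C -> C) (x c d M : R) :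
  c <= d -> (forall y, c <= y <= d -> continuous f (x, y) /\ Cmod (f (x, y)) <= M) ->
  Cmod (ver_int f x c d) <= (d - c) * M.
Proof.
  intros Hab H. rewrite <- CR_norm.
  eapply (norm_RInt_le_const (V := C_R_NormedModule)); [exact Hab| |].
  - intros y Hx. rewrite CR_norm. apply H, Hx.
  - apply (RInt_correct (V := CR)), ex_ver_int; auto. intros; apply H; auto.
Qed.

Definition continuous_rect (f : C -> C) (a b c d : R) : Prop :=
  forall x y, a <= x <= b -> c <= y <= d -> continuous f (x, y).

Lemma rect_int_split_h (f : C -> C) (a m b c d : R) :
  a <= m <= b -> c <= d -> continuous_rect f a b c d ->
  (rect_int f a b c d = rect_int f a m c d + rect_int f m b c d)%C.
Proof.
  intros Hm Hcd Hf.
  assert (E : forall y, c <= y <= d -> (hor_int f y a m + hor_int f y m b = hor_int f y a b)%C).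
  { intros y Hy. apply (RInt_Chasles (V := CR)); apply ex_hor_int; try lra;
      intros; apply Hf; lra. }
  unfold rect_int. rewrite <- !E by lra. ring.
Qed.

Lemma rect_int_split_v (f : C -> C) (a b c m d : R) :
  a <= b -> c <= m <= d -> continuous_rect f a b c d ->
  (rect_int f a b c d = rect_int f a b c m + rect_int f a b m d)%C.
Proof.
  intros Hm Hcd Hf.
  assert (E : forall x, a <= x <= b -> (ver_int f x c m + ver_int f x m d = ver_int f x c d)%C).
  { intros y Hy. apply (RInt_Chasles (V := CR)); apply ex_ver_int; try lra;
      intros; apply Hf; lra. }
  unfold rect_int. rewrite <- !E by lra. ring.
Qed.

Lemma hor_int_minus (f g : C -> C) (y a b : R) :
  a <= b -> (forall x, a <= x <= b -> continuous f (x, y) /\ continuous g (x, y)) ->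
  hor_int (fun z => f z - g z)%C y a b = (hor_int f y a b - hor_int g y a b)%C.
Proof.
  intros Hab H. apply (RInt_minus (V := CR) (fun x => f (x, y)) (fun x => g (x, y)));
    (apply ex_hor_int; [exact Hab|intros x Hx; apply (H x Hx)]).
Qed.

Lemma ver_int_minus (f g : C -> C) (x c d : R) :
  c <= d -> (forall y, c <= y <= d -> continuous f (x, y) /\ continuous g (x, y)) ->
  ver_int (fun z => f z - g z)%C x c d = (ver_int f x c d - ver_int g x c d)%C.
Proof.
  intros Hab H. apply (RInt_minus (V := CR) (fun y => f (x, y)) (fun y => g (x, y)));
    (apply ex_ver_int; [exact Hab|intros y Hy; apply (H y Hy)]).
Qed.

Lemma rect_int_minus (f g : C -> C) (a b c d : R) :
  a <= b -> c <= d -> continuous_rect f a b c d -> continuous_rect g a b c d ->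
  rect_int (fun z => f z - g z)%C a b c d = (rect_int f a b c d - rect_int g a b c d)%C.
Proof.
  intros Hab Hcd Hf Hg. unfold rect_int.
  rewrite (hor_int_minus f g c), (hor_int_minus f g d), (ver_int_minus f g a), (ver_int_minus f g b);
    auto; [ring|..]; intros u Hu; (split; [apply (Hf _ _)|apply (Hg _ _)]; lra).
Qed.

Lemma Cmod_rect_int_le (f : C -> C) (a b c d M : R) :
  a <= b -> c <= d ->
  (forall x y, a <= x <= b -> c <= y <= d -> continuous f (x, y) /\ Cmod (f (x, y)) <= M) ->
  Cmod (rect_int f a b c d) <= 2 * (b - a + (d - c)) * M.
Proof.
  intros Hab Hcd H. unfold rect_int.
  eapply Rle_trans; [apply Cmod_triangle_minus|].
  eapply Rle_trans; [apply Rplus_le_compat_r, Cmod_triangle_minus|].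
  eapply Rle_trans; [apply Rplus_le_compat_r, Rplus_le_compat_r, Cmod_triangle|].
  rewrite !Cmod_mult, Cmod_Ci.
  assert (Cmod (hor_int f c a b) <= (b - a) * M) by (apply Cmod_hor_int_le; auto; intros; apply H; lra).
  assert (Cmod (hor_int f d a b) <= (b - a) * M) by (apply Cmod_hor_int_le; auto; intros; apply H; lra).
  assert (Cmod (ver_int f a c d) <= (d - c) * M) by (apply Cmod_ver_int_le; auto; intros; apply H; lra).
  assert (Cmod (ver_int f b c d) <= (d - c) * M) by (apply Cmod_ver_int_le; auto; intros; apply H; lra).
  lra.
Qed.

Lemma rect_int_primitive (F f : C -> C) (a b c d : R) :
  a <= b -> c <= d ->
  (forall x y, a <= x <= b -> c <= y <= d ->
     is_derive F (x, y) (f (x, y)) /\ continuous f (x, y)) ->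
  rect_int f a b c d = 0%C.
Proof.
  intros Hab Hcd H. unfold rect_int.
  rewrite !(hor_int_primitive F f), !(ver_int_primitive F f); auto; try ring;
    intros; apply H; lra.
Qed.

(** The primitive is an explicit quadratic. In Goursat's argument this disposes of the first-order
    part of f. *)
Lemma rect_int_affine (p q z0 : C) (a b c d : R) :
  a <= b -> c <= d -> rect_int (fun z => p + (z - z0) * q)%C a b c d = 0%C.
Proof.
  intros Hab Hcd.
  apply rect_int_primitive with (fun z => z * p + (z - z0) * (z - z0) * (q / 2))%C; auto.
  intros x y _ _. set (z := (x, y)). split.
  - apply C_is_derive_eps. intros eps He.
    assert (Hq : 0 < Cmod q + 1) by (generalize (Cmod_ge_0 q); lra).
    exists (eps / (Cmod q + 1)). split. apply Rdiv_lt_0_compat; auto.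
    intros w Hw.
    replace (w * p + (w - z0) * (w - z0) * (q / 2) - (z * p + (z - z0) * (z - z0) * (q / 2))
             - (w - z) * (p + (z - z0) * q))%C with ((w - z) * ((w - z) * (q / 2)))%C by field.
    rewrite Cmod_mult, Rmult_comm. apply Rmult_le_compat_r. apply Cmod_ge_0.
    unfold Cdiv. rewrite !Cmod_mult, <- RtoC_inv, Cmod_R, Rabs_pos_eq by lra.
    apply Rle_trans with (eps / (Cmod q + 1) * (Cmod q + 1)); [|right; field; lra].
    generalize (Cmod_ge_0 q) (Cmod_ge_0 (w - z)). intros.
    apply Rmult_le_compat; lra.
  - apply C_ex_derive_continuous. auto 10 with cder.
Qed.

Lemma nested_intervals (a b : nat -> R) :
  (forall n, a n <= a (S n) /\ b (S n) <= b n /\ a n <= b n) ->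
  exists x, forall n, a n <= x <= b n.
Proof.
  intros H.
  assert (Ha : forall n k, a n <= a (n + k)%nat).
  { intros n k; induction k. rewrite Nat.add_0_r; lra.
    rewrite Nat.add_succ_r. destruct (H (n + k)%nat); lra. }
  assert (Hb : forall n k, b (n + k)%nat <= b n).
  { intros n k; induction k. rewrite Nat.add_0_r; lra.
    rewrite Nat.add_succ_r. destruct (H (n + k)%nat) as (_ & ? & _); lra. }
  assert (Hab : forall n m, a n <= b m).
  { intros n m. apply Rle_trans with (a (n + m)%nat); auto.
    apply Rle_trans with (b (n + m)%nat). apply H.
    rewrite Nat.add_comm; auto. }
  destruct (completeness (fun x => exists n, x = a n)) as (l & H1 & H2).
  - exists (b O). intros x (n & ->). auto.
  - exists (a O). eauto.
  - exists l. intros n. split. apply H1; eauto. apply H2. intros x (m & ->); auto.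
Qed.

(* Quartering divides the square of the half-perimeter by 4, so a rectangle on
   which the bound fails has a quarter on which it fails. *)
Section Goursat.
Variables (f : C -> C) (eps : R).

Definition bad_rect (Q : R * R * (R * R)) : Prop :=
  let '(a, b, (c, d)) := Q in
  eps * (b - a + (d - c)) ^ 2 < Cmod (rect_int f a b c d).

Definition quarter (Q : R * R * (R * R)) : R * R * (R * R) :=
  let '(a, b, (c, d)) := Q in
  let m := (a + b) / 2 in let k := (c + d) / 2 in
  if excluded_middle_informative (bad_rect (a, m, (c, k))) then (a, m, (c, k)) else
  if excluded_middle_informative (bad_rect (m, b, (c, k))) then (m, b, (c, k)) else
  if excluded_middle_informative (bad_rect (a, m, (k, d))) then (a, m, (k, d)) else
  (m, b, (k, d)).

Lemma bad_rect_quarter (a b c d : R) :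
  a <= b -> c <= d -> continuous_rect f a b c d ->
  bad_rect (a, b, (c, d)) -> bad_rect (quarter (a, b, (c, d))).
Proof.
  intros Hab Hcd Hf HB. unfold quarter.
  set (m := (a + b) / 2). set (k := (c + d) / 2).
  destruct (excluded_middle_informative _) as [|N1]; auto.
  destruct (excluded_middle_informative _) as [|N2]; auto.
  destruct (excluded_middle_informative _) as [|N3]; auto.
  apply NNPP. intros N4. unfold bad_rect in *.
  assert (E : rect_int f a b c d =
    (rect_int f a m c k + rect_int f m b c k + (rect_int f a m k d + rect_int f m b k d))%C).
  { rewrite (rect_int_split_v f a b c k d), (rect_int_split_h f a m b c k),
      (rect_int_split_h f a m b k d); try (unfold m, k; lra); auto;
    intros x y Hx Hy; apply Hf; unfold m, k in *; lra. }
  rewrite E in HB.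
  apply Rnot_lt_le in N1, N2, N3, N4.
  replace (m - a) with ((b - a) / 2) in * by (unfold m; field).
  replace (b - m) with ((b - a) / 2) in * by (unfold m; field).
  replace (k - c) with ((d - c) / 2) in * by (unfold k; field).
  replace (d - k) with ((d - c) / 2) in * by (unfold k; field).
  apply (Rlt_not_le _ _ HB).
  eapply Rle_trans; [apply Cmod_triangle|].
  eapply Rle_trans; [apply Rplus_le_compat; apply Cmod_triangle|].
  nra.
Qed.

Fixpoint bisect (Q : R * R * (R * R)) (n : nat) : R * R * (R * R) :=
  match n with O => Q | S n => quarter (bisect Q n) end.

Lemma quarter_sub (a b c d : R) :
  a <= b -> c <= d ->
  let '(a', b', (c', d')) := quarter (a, b, (c, d)) in
  a <= a' /\ b' <= b /\ c <= c' /\ d' <= d /\ b' - a' = (b - a) / 2 /\ d' - c' = (d - c) / 2.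
Proof.
  intros Hab Hcd. unfold quarter.
  repeat destruct (excluded_middle_informative _); repeat split; lra.
Qed.

Lemma rect_int_le_eps (a b c d : R) :
  0 < eps -> a <= b -> c <= d ->
  (forall x y, a <= x <= b -> c <= y <= d -> ex_derive f ((x, y) : C)) ->
  Cmod (rect_int f a b c d) <= eps * (b - a + (d - c)) ^ 2.
Proof.
  intros He Hab Hcd Hf. apply Rnot_lt_le. intros HB.
  set (Q := (a, b, (c, d))).
  set (A n := fst (fst (bisect Q n))). set (B n := snd (fst (bisect Q n))).
  set (C' n := fst (snd (bisect Q n))). set (D n := snd (snd (bisect Q n))).
  assert (EQ : forall n, bisect Q n = (A n, B n, (C' n, D n))).
  { intros n. unfold A, B, C', D. destruct (bisect Q n) as [[? ?] [? ?]]; auto. }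
  assert (Hc : continuous_rect f a b c d).
  { intros x y Hx Hy. apply C_ex_derive_continuous, Hf; auto. }
  assert (I : forall n, a <= A n /\ A n <= B n /\ B n <= b /\ c <= C' n /\ C' n <= D n /\ D n <= d
     /\ B n - A n = (b - a) / 2 ^ n /\ D n - C' n = (d - c) / 2 ^ n /\ bad_rect (A n, B n, (C' n, D n))).
  { induction n.
    - unfold A, B, C', D; simpl. repeat split; try lra; auto.
    - destruct IHn as (I1 & I2 & I3 & I4 & I5 & I6 & I7 & I8 & I9).
      assert (QS := quarter_sub (A n) (B n) (C' n) (D n) I2 I5).
      assert (BQ := bad_rect_quarter (A n) (B n) (C' n) (D n) I2 I5
        ltac:(intros x y Hx Hy; apply Hc; lra) I9).
      rewrite <- EQ in QS, BQ. change (quarter (bisect Q n)) with (bisect Q (S n)) in QS, BQ.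
      rewrite EQ in QS, BQ. destruct QS as (S1 & S2 & S3 & S4 & S5 & S6).
      assert (P2 : 0 < 2 ^ n) by (apply pow_lt; lra).
      assert (0 <= (b - a) / 2 ^ n) by (apply Rdiv_le_0_compat; lra).
      assert (0 <= (d - c) / 2 ^ n) by (apply Rdiv_le_0_compat; lra).
      repeat split; auto; try lra; simpl; [rewrite S5, I7|rewrite S6, I8]; field; lra. }
  assert (STEP : forall n, A n <= A (S n) /\ B (S n) <= B n /\ C' n <= C' (S n) /\ D (S n) <= D n).
  { intros n. destruct (I n) as (I1 & I2 & I3 & I4 & I5 & I6 & I7 & I8 & I9).
    assert (QS := quarter_sub (A n) (B n) (C' n) (D n) I2 I5).
    rewrite <- EQ in QS. change (quarter (bisect Q n)) with (bisect Q (S n)) in QS.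
    rewrite EQ in QS. tauto. }
  destruct (nested_intervals A B) as (x & Hx).
  { intros n. destruct (I n) as (I1 & I2 & _), (STEP n) as (S1 & S2 & _). auto. }
  destruct (nested_intervals C' D) as (y & Hy).
  { intros n. destruct (I n) as (_ & _ & _ & I1 & I2 & _), (STEP n) as (_ & _ & S1 & S2). auto. }
  destruct (Hf x y) as [l Hl]. { apply (Hx O). } { apply (Hy O). }
  (* The perimeter 2 pn times an error of at most (eps / 4) pn is half of the eps pn^2 exceeded by a
     bad rectangle. *)
  assert (He4 : 0 < eps / 4) by lra.
  destruct (proj1 (C_is_derive_eps f _ l) Hl _ He4) as (dl & Hdl & HH).
  set (p := b - a + (d - c)).
  (* From this n on, the half-perimeter p / 2^n is below the radius in which the linear
     approximation at (x, y) is valid. *)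
  destruct (geom_eventually_lt p (1 / 2) dl ltac:(unfold p; lra) ltac:(lra) Hdl) as (n & Hn).
  specialize (Hn n (le_n n)).
  destruct (I n) as (I1 & I2 & I3 & I4 & I5 & I6 & I7 & I8 & I9).
  set (pn := B n - A n + (D n - C' n)).
  assert (Hpn : pn = p * (1 / 2) ^ n).
  { unfold pn. rewrite I7, I8. unfold p. unfold Rdiv. rewrite Rmult_1_l, pow_inv. ring. }
  assert (Hsmall : pn < dl) by (rewrite Hpn; auto).
  unfold bad_rect in I9. fold pn in I9.
  set (g := fun z : C => (f (x, y) + (z - (x, y)) * l)%C).
  assert (Hg : forall z, continuous g z).
  { intros z. apply C_ex_derive_continuous. unfold g. auto 10 with cder. }
  assert (HS : Cmod (rect_int (fun z => f z - g z)%C (A n) (B n) (C' n) (D n)) <= 2 * pn * (eps / 4 * pn)).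
  { apply Cmod_rect_int_le; auto. intros u v Hu Hv. split.
    - apply (continuous_minus (V := C_R_NormedModule)); auto. apply Hc; lra.
    - assert (Hd : Cmod ((u, v) - (x, y)) <= pn).
      { eapply Rle_trans; [apply Cmod_le_Re_Im|]. simpl.
        specialize (Hx n). specialize (Hy n).
        unfold pn. apply Rplus_le_compat; apply Rabs_le; lra. }
      unfold g. replace (f (u, v) - (f (x, y) + ((u, v) - (x, y)) * l))%C
        with (f (u, v) - f (x, y) - ((u, v) - (x, y)) * l)%C by ring.
      eapply Rle_trans; [apply HH; lra|].
      apply Rmult_le_compat_l; lra. }
  rewrite rect_int_minus in HS; auto; [|intros u v Hu Hv; apply Hc; lra|intros u v Hu Hv; apply Hg].
  unfold g in HS. rewrite rect_int_affine in HS by auto.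
  replace (rect_int f (A n) (B n) (C' n) (D n) - 0)%C with (rect_int f (A n) (B n) (C' n) (D n)) in HS by ring.
  assert (0 <= pn) by (unfold pn; lra). nra.
Qed.
End Goursat.

Lemma goursat_rect (f : C -> C) (a b c d : R) :
  a <= b -> c <= d ->
  (forall x y, a <= x <= b -> c <= y <= d -> ex_derive f ((x, y) : C)) ->
  rect_int f a b c d = 0%C.
Proof.
  intros Hab Hcd Hf. apply Cmod_eq_0. apply Rle_antisym; [|apply Cmod_ge_0].
  apply Rnot_lt_le. intros H.
  set (p := (b - a + (d - c)) ^ 2).
  assert (Hp : 0 <= p) by apply pow2_ge_0.
  set (M := Cmod (rect_int f a b c d)) in *.
  assert (B := rect_int_le_eps f (M / (2 * (p + 1))) a b c d
    ltac:(apply Rdiv_lt_0_compat; lra) Hab Hcd Hf).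
  fold M p in B.
  assert (M / (2 * (p + 1)) * p <= M / 2).
  { replace (M / 2) with (M / (2 * (p + 1)) * (p + 1)) by (field; lra).
    apply Rmult_le_compat_l; [|lra]. left. apply Rdiv_lt_0_compat; lra. }
  lra.
Qed.

(** * The maximum principle *)

Lemma is_derive_Re (g : R -> C) (t : R) (l : C) :
  is_derive (K := R_AbsRing) (V := C_R_NormedModule) g t l ->
  is_derive (fun u => Re (g u)) t (Re l).
Proof.
  intros H.
  assert (L : is_linear (K := R_AbsRing) (U := C_R_NormedModule) (V := R_NormedModule) Re)
    by exact (is_linear_fst (K := R_AbsRing) (U := R_NormedModule) (V := R_NormedModule)).
  exact (filterdiff_comp' (K := R_AbsRing) (U := AbsRing_NormedModule R_AbsRing)
    (V := C_R_NormedModule) (W := R_NormedModule) g Re t _ _ H (filterdiff_linear _ L)).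
Qed.

Lemma Re_ver_int_le (f : C -> C) (x c d M : R) :
  c <= d -> (forall y, c <= y <= d -> continuous f (x, y) /\ Re (f (x, y)) <= M) ->
  Re (ver_int f x c d) <= (d - c) * M.
Proof.
  intros Hcd H.
  assert (I := RInt_correct (V := CR) _ _ _ (ex_ver_int f x c d Hcd (fun y Hy => proj1 (H y Hy)))).
  apply (is_RInt_fct_extend_fst (U := R_NormedModule) (V := R_NormedModule)) in I.
  apply (is_RInt_le _ (fun _ => M) c d _ _ Hcd I).
  - exact (is_RInt_const (V := R_NormedModule) c d M).
  - intros y Hy. apply (H y); lra.
Qed.

Lemma Re_ver_int_ge (f : C -> C) (x c d M : R) :
  c <= d -> (forall y, c <= y <= d -> continuous f (x, y) /\ M <= Re (f (x, y))) ->
  (d - c) * M <= Re (ver_int f x c d).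
Proof.
  intros Hcd H.
  assert (I := RInt_correct (V := CR) _ _ _ (ex_ver_int f x c d Hcd (fun y Hy => proj1 (H y Hy)))).
  apply (is_RInt_fct_extend_fst (U := R_NormedModule) (V := R_NormedModule)) in I.
  refine (is_RInt_le (fun _ => M) _ c d _ _ Hcd _ I _).
  - exact (is_RInt_const (V := R_NormedModule) c d M).
  - intros y Hy. apply (H y); lra.
Qed.

(* In the coordinate w with z = z0 + exp w the punctured disc becomes a half
   plane and the function is 2 pi i periodic, so Cauchy's theorem on rectangles
   says that the mean over a circle does not depend on the radius. *)
Lemma mean_le (f : C -> C) (z0 : C) (r B : R) :
  0 < r -> continuous f z0 ->
  (forall z, 0 < Cmod (z - z0) <= r -> ex_derive f z) ->
  (forall z, Cmod (z - z0) = r -> Re (f z) <= B) ->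
  Re (f z0) <= B.
Proof.
  intros Hr Hc Hd HB. apply Rnot_lt_le. intros HC.
  set (e := (Re (f z0) - B) / 2).
  assert (He : 0 < e) by (unfold e; lra).
  destruct (proj1 (Ccontinuous_eps f z0) Hc e He) as (d & Hdp & Hcd).
  set (g := fun w => f (z0 + Cexp w)%C).
  assert (Cm : forall x y, Cmod (z0 + Cexp (x, y) - z0) = exp x).
  { intros x y. replace (z0 + Cexp (x, y) - z0)%C with (Cexp (x, y)) by ring.
    apply Cmod_Cexp. }
  assert (Hg : forall x y, x <= ln r -> ex_derive g ((x, y) : C)).
  { intros x y Hx. unfold g. apply (C_ex_derive_comp f (fun w => z0 + Cexp w)%C).
    - apply Hd. rewrite Cm. split. apply exp_pos.
      rewrite <- (exp_ln r) by auto. destruct Hx as [Hx| ->]; [left; apply exp_increasing, Hx|lra].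
    - auto with cder. }
  set (s := Rmin d r / 2).
  (* The radius [s] is so small that f differs from f z0 by less than e on its circle. *)
  assert (Hs : 0 < s) by (unfold s; generalize (Rmin_pos d r Hdp Hr); lra).
  assert (Hsd : s < d) by (unfold s; generalize (Rmin_l d r) (Rmin_pos d r Hdp Hr); lra).
  assert (Hsr : ln s <= ln r).
  { left; apply ln_increasing; auto. unfold s; generalize (Rmin_r d r) (Rmin_pos d r Hdp Hr); lra. }
  assert (P := PI_RGT_0).
  assert (G := goursat_rect g (ln s) (ln r) 0 (2 * PI) Hsr ltac:(lra)
    ltac:(intros; apply Hg; lra)).
  assert (Per : hor_int g 0 (ln s) (ln r) = hor_int g (2 * PI) (ln s) (ln r)).
  { unfold hor_int. apply (RInt_ext (V := CR)). intros x _. unfold g. f_equal. f_equal.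
    unfold Cexp; simpl. rewrite cos_0, sin_0, cos_2PI, sin_2PI. reflexivity. }
  assert (E : ver_int g (ln r) 0 (2 * PI) = ver_int g (ln s) 0 (2 * PI)).
  { unfold rect_int in G. rewrite Per in G.
    assert (G' : (Ci * (ver_int g (ln r) 0 (2 * PI) - ver_int g (ln s) 0 (2 * PI)) = 0)%C)
      by (rewrite <- G; ring).
    apply Ceq_minus.
    replace (ver_int g (ln r) 0 (2 * PI) - ver_int g (ln s) 0 (2 * PI))%C
      with (/ Ci * (Ci * (ver_int g (ln r) 0 (2 * PI) - ver_int g (ln s) 0 (2 * PI))))%C
      by (field; apply Ci_nz).
    rewrite G'. ring. }
  assert (L : Re (ver_int g (ln r) 0 (2 * PI)) <= (2 * PI - 0) * B).
  { apply Re_ver_int_le; [lra|]. intros y Hy. split.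
    - apply C_ex_derive_continuous, Hg; lra.
    - apply HB. rewrite Cm. apply exp_ln, Hr. }
  assert (U : (2 * PI - 0) * (Re (f z0) - e) <= Re (ver_int g (ln s) 0 (2 * PI))).
  { apply Re_ver_int_ge; [lra|]. intros y Hy. split.
    - apply C_ex_derive_continuous, Hg; lra.
    - unfold g. assert (H1 : Cmod (f (z0 + Cexp (ln s, y))%C - f z0) < e).
      { apply Hcd. rewrite Cm, exp_ln; auto. }
      assert (H2 := re_le_Cmod (f (z0 + Cexp (ln s, y))%C - f z0)).
      rewrite Re_minus in H2. apply Rabs_le_between in H2; lra. }
  rewrite <- E in U.
  assert (Re (f z0) - e <= B).
  { apply Rmult_le_reg_l with (2 * PI - 0); lra. }
  unfold e in *; lra.
Qed.

(** A Lebesgue number argument. Local radii are halved because compactness controls the two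
    coordinates separately, and monotonicity in e passes from the local radius to the uniform
    one. *)
Lemma compact_uniform (a b c d : R) (Q : R -> C -> Prop) :
  (forall e e' z, 0 < e' <= e -> Q e z -> Q e' z) ->
  (forall p : C, exists e, 0 < e /\ forall z, Cmod (z - p) < e -> Q e z) ->
  exists e, 0 < e /\ forall x y, a <= x <= b -> c <= y <= d -> Q e (x, y).
Proof.
  intros Hm HQ.
  set (del := fun p => proj1_sig (constructive_indefinite_description _ (HQ p))).
  assert (Hdel : forall p, 0 < del p /\ forall z, Cmod (z - p) < del p -> Q (del p) z).
  { intros p. unfold del. destruct (constructive_indefinite_description _ _); auto. }
  assert (Hd2 : forall u v, 0 < del (u, v) / 2).
  { intros u v. destruct (Hdel (u, v)). lra. }
  destruct (compactness_value_2d a b c d (fun u v => mkposreal _ (Hd2 u v))) as (e & He).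
  exists e. split. apply cond_pos. intros x y Hx Hy.
  apply NNPP. intros HN. apply (He x y Hx Hy). intros (u & v & _ & _ & H1 & H2 & H3).
  apply HN. simpl in *. apply (Hm (del (u, v))).
  - split. apply cond_pos. specialize (Hd2 u v). lra.
  - apply Hdel. eapply Rle_lt_trans; [apply Cmod_le_Re_Im|]. simpl.
    change (x + - u) with (x - u). change (y + - v) with (y - v). lra.
Qed.

(** Compactness enters twice: applied to w <= 1 / e it bounds w above, and applied to w <= S - e it
    refutes a supremum S that is not attained. *)
Lemma usc_attains_max (D : C -> Prop) (w : C -> R) (K : R) :
  (forall z, ~ D z -> exists e, 0 < e /\ forall u, Cmod (u - z) < e -> ~ D u) ->
  (forall z, D z -> Cmod z <= K) ->
  (forall z, D z -> forall e, 0 < e -> exists d, 0 < d /\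
     forall u, Cmod (u - z) < d -> w u < w z + e) ->
  (exists z, D z) ->
  exists z0, D z0 /\ forall z, D z -> w z <= w z0.
Proof.
  intros Hcl Hbd Husc Hne.
  assert (Hbox : forall z, D z -> - K <= Re z <= K /\ - K <= Im z <= K).
  { intros z Hz. specialize (Hbd z Hz).
    split; apply Rabs_le_between; eapply Rle_trans; [apply re_le_Cmod|auto|apply Im_le_Cmod|auto]. }
  (* Off the closed set D the property is vacuous near each point, so local radii are needed only at
     points of D. *)
  assert (Hany : forall Q : R -> C -> Prop,
    (forall e e' z, 0 < e' <= e -> Q e z -> Q e' z) ->
    (forall p, D p -> exists e, 0 < e /\ forall z, Cmod (z - p) < e -> Q e z) ->
    exists e, 0 < e /\ forall z, D z -> Q e z).
  { intros Q Hm HQ.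
    destruct (compact_uniform (- K) K (- K) K (fun e z => D z -> Q e z)) as (e & He & H).
    - intros e e' z Hee Hz Dz. eapply Hm; eauto.
    - intros p. destruct (classic (D p)) as [Dp|Np].
      + destruct (HQ p Dp) as (e & He & H). exists e. auto.
      + destruct (Hcl p Np) as (e & He & H). exists e; split; auto.
        intros z Hz Dz. exfalso. exact (H z Hz Dz).
    - exists e; split; auto. intros [x y] Dz. destruct (Hbox _ Dz). apply H; auto. }
  destruct (Hany (fun e z => w z <= / e)) as (e & He & Hb).
  { intros e e' z [H1 H2] H. eapply Rle_trans; [apply H|]. apply Rinv_le_contravar; auto. }
  { intros p Dp. destruct (Husc p Dp 1 Rlt_0_1) as (d & Hd & H).
    exists (Rmin d (/ (Rabs (w p) + 1))). generalize (Rabs_pos (w p)). intros Hp. split.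
    - apply Rmin_pos; auto. apply Rinv_0_lt_compat; lra.
    - intros z Hz. specialize (H z (Rlt_le_trans _ _ _ Hz (Rmin_l _ _))).
      apply Rle_trans with (Rabs (w p) + 1). generalize (Rle_abs (w p)); lra.
      rewrite <- (Rinv_inv (Rabs (w p) + 1)) at 1. apply Rinv_le_contravar; [|apply Rmin_r].
      apply Rmin_pos; auto. apply Rinv_0_lt_compat; lra. }
  destruct (completeness (fun x => exists z, D z /\ x = w z)) as (S & HS1 & HS2).
  { exists (/ e). intros x (z & Dz & ->). auto. }
  { destruct Hne as (z & Dz). eauto. }
  apply NNPP. intros HN.
  destruct (Hany (fun e z => w z <= S - e)) as (e2 & He2 & Hb2).
  { intros e1 e' z [H1 H2] H. lra. }
  { intros p Dp.
    assert (Hp : w p < S).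
    { apply Rnot_le_lt. intros HSp. apply HN. exists p; split; auto.
      intros z Dz. apply Rle_trans with S; auto. apply HS1; eauto. }
    destruct (Husc p Dp ((S - w p) / 2) ltac:(lra)) as (d & Hd & H).
    exists (Rmin d ((S - w p) / 2)). split. apply Rmin_pos; lra.
    intros z Hz. specialize (H z (Rlt_le_trans _ _ _ Hz (Rmin_l _ _))).
    generalize (Rmin_r d ((S - w p) / 2)). lra. }
  assert (S <= S - e2); [|lra].
  apply HS2. intros x (z & Dz & ->). auto.
Qed.

(** Turns a modulus into a real part, to which mean values and real calculus apply. *)
Lemma rotate_to_modulus (z : C) : exists c : C, Cmod c = 1 /\ (c * z = RtoC (Cmod z))%C.
Proof.
  destruct (Ceq_dec z 0) as [->|Hz].
  - exists 1%C. rewrite Cmod_1, Cmod_0. split; auto. ring.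
  - assert (H := proj1 (Cmod_gt_0 z) Hz).
    assert (H' : RtoC (Cmod z) <> 0%C) by (intros E; apply RtoC_inj in E; lra).
    exists (RtoC (Cmod z) / z)%C. split.
    + rewrite Cmod_div, Cmod_R, Rabs_pos_eq; auto using Cmod_ge_0. field; lra.
    + field; auto.
Qed.

Lemma Cmod_sqr (z : C) : Cmod z ^ 2 = Re z * Re z + Im z * Im z.
Proof. rewrite Cmod2_alt. ring. Qed.

(* If |f| exceeded M somewhere, |f| + eps |z|^2 would attain its maximum at an
   interior point z0, where the strict subharmonicity of |z|^2 contradicts the
   mean value inequality. *)
Lemma max_modulus (D : C -> Prop) (f : C -> C) (K M : R) :
  (forall z, ~ D z -> exists e, 0 < e /\ forall u, Cmod (u - z) < e -> ~ D u) ->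
  (forall z, D z -> Cmod z <= K) ->
  (forall z, D z -> continuous f z) ->
  (forall z, D z -> Cmod (f z) <= M \/
     exists r, 0 < r /\ (forall u, Cmod (u - z) <= r -> D u) /\
       (forall u, 0 < Cmod (u - z) <= r -> ex_derive f u)) ->
  forall z, D z -> Cmod (f z) <= M.
Proof.
  intros Hcl Hbd Hc Hd z1 Dz1. apply Rnot_lt_le. intros HM.
  (* Now e K^2 is less than half the excess of |f z1| over M, so a maximum point of |f| + e |z|^2
     still has |f| > M. *)
  set (e := (Cmod (f z1) - M) / (2 * (K * K + 1))).
  assert (HK : 0 <= K * K) by apply Rle_0_sqr.
  assert (He : 0 < e) by (apply Rdiv_lt_0_compat; lra).
  destruct (usc_attains_max D (fun z => Cmod (f z) + e * Cmod z ^ 2) K) as (z0 & Dz0 & Hmax); auto.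
  { intros z Dz eps Heps.
    assert (C1 := proj1 (Ccontinuous_eps f z) (Hc z Dz) (eps / 2) ltac:(lra)).
    destruct C1 as (d1 & Hd1 & H1).
    set (k := e * (2 * Cmod z + 1)).
    assert (Hk : 0 < k) by (apply Rmult_lt_0_compat; auto; generalize (Cmod_ge_0 z); lra).
    exists (Rmin d1 (Rmin 1 (eps / (2 * k)))). split.
    { repeat apply Rmin_pos; try lra. apply Rdiv_lt_0_compat; lra. }
    intros u Hu.
    assert (U1 := Rlt_le_trans _ _ _ Hu (Rmin_l _ _)).
    assert (U2 := Rlt_le_trans _ _ _ Hu (Rmin_r _ _)).
    assert (U3 := Rlt_le_trans _ _ _ U2 (Rmin_l _ _)).
    assert (U4 := Rlt_le_trans _ _ _ U2 (Rmin_r _ _)).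
    specialize (H1 u U1).
    assert (T1 := Cmod_triangle_inv (f u) (f z)).
    assert (T2 := Cmod_triangle_inv u z).
    set (h := Cmod (u - z)) in *. assert (0 <= h) by apply Cmod_ge_0.
    assert (Hsq : e * Cmod u ^ 2 <= e * Cmod z ^ 2 + k * h).
    { unfold k. replace (e * Cmod z ^ 2 + e * (2 * Cmod z + 1) * h)
        with (e * (Cmod z ^ 2 + (2 * Cmod z + 1) * h)) by ring.
      apply Rmult_le_compat_l; [lra|].
      generalize (Cmod_ge_0 u) (Cmod_ge_0 z). nra. }
    assert (k * h < eps / 2).
    { apply Rlt_le_trans with (k * (eps / (2 * k))). apply Rmult_lt_compat_l; auto.
      right; field; lra. }
    lra. }
  { eauto. }
  assert (Hw : Cmod (f z1) <= Cmod (f z0) + e * Cmod z0 ^ 2).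
  { eapply Rle_trans; [|apply (Hmax z1 Dz1)]. generalize (pow2_ge_0 (Cmod z1)). nra. }
  assert (HeK : e * (K * K + 1) = (Cmod (f z1) - M) / 2) by (unfold e; field; lra).
  destruct (Hd z0 Dz0) as [Hle|(r & Hr & HDr & Hdr)].
  { assert (Cmod z0 ^ 2 <= K * K).
    { generalize (Hbd z0 Dz0) (Cmod_ge_0 z0). nra. }
    nra. }
  destruct (rotate_to_modulus (f z0)) as (c & Hc1 & Hc2).
  (* The linear term has real part e (|z|^2 + |z0|^2 - |z - z0|^2): on the circle of radius r it
     falls short of e |z|^2 + e |z0|^2 by e r^2, at the centre it does not. *)
  set (phi := fun z => (c * f z + RtoC (2 * e) * Cconj z0 * z)%C).
  assert (Q : forall z, Re (RtoC (2 * e) * Cconj z0 * z) = e * (Cmod z ^ 2 + Cmod z0 ^ 2 - Cmod (z - z0) ^ 2)).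
  { intros z. rewrite !Cmod_sqr. unfold Cconj, Cmult, RtoC, Re, Im; simpl. ring. }
  assert (Hphi : Re (phi z0) <= Cmod (f z0) + 2 * e * Cmod z0 ^ 2 - e * r ^ 2).
  { apply mean_le with r; auto.
    - apply Ccontinuous_eps. intros eps Heps.
      assert (C1 := proj1 (Ccontinuous_eps f z0) (Hc z0 Dz0) (eps / 2) ltac:(lra)).
      destruct C1 as (d1 & Hd1 & H1).
      assert (C2 : continuous (fun z => RtoC (2 * e) * Cconj z0 * z)%C z0)
        by (apply C_ex_derive_continuous; auto with cder).
      apply (proj1 (Ccontinuous_eps _ z0)) with (eps := eps / 2) in C2; [|lra].
      destruct C2 as (d2 & Hd2 & H2).
      exists (Rmin d1 d2). split. apply Rmin_pos; auto. intros w Hw'.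
      specialize (H1 w (Rlt_le_trans _ _ _ Hw' (Rmin_l _ _))).
      specialize (H2 w (Rlt_le_trans _ _ _ Hw' (Rmin_r _ _))).
      unfold phi.
      replace (c * f w + RtoC (2 * e) * Cconj z0 * w - (c * f z0 + RtoC (2 * e) * Cconj z0 * z0))%C
        with (c * (f w - f z0) + (RtoC (2 * e) * Cconj z0 * w - RtoC (2 * e) * Cconj z0 * z0))%C by ring.
      eapply Rle_lt_trans; [apply Cmod_triangle|]. rewrite Cmod_mult, Hc1. lra.
    - intros z Hz. unfold phi. specialize (Hdr z Hz). auto with cder.
    - intros z Hz. unfold phi. rewrite re_plus, Q, Hz.
      assert (Re (c * f z) <= Cmod (f z)).
      { eapply Rle_trans; [apply Re_le_Cmod|]. rewrite Cmod_mult, Hc1. lra. }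
      assert (B := Hmax z (HDr z ltac:(lra))). nra. }
  unfold phi in Hphi. rewrite re_plus, Hc2, re_RtoC, Q in Hphi.
  replace (Cmod (z0 - z0)) with 0 in Hphi
    by (replace (z0 - z0)%C with (RtoC 0) by ring; rewrite Cmod_0; auto).
  assert (0 < e * r ^ 2) by (apply Rmult_lt_0_compat; [auto|apply pow_lt; auto]).
  nra.
Qed.

Lemma Cmod_self (z : C) : Cmod (z - z) = 0.
Proof. replace (z - z)%C with (RtoC 0) by ring. apply Cmod_0. Qed.

Lemma closed_disc_closed (z0 z : C) (R0 : R) :
  ~ Cmod (z - z0) <= R0 -> exists e, 0 < e /\ forall u, Cmod (u - z) < e -> ~ Cmod (u - z0) <= R0.
Proof.
  intros H. apply Rnot_le_lt in H. exists (Cmod (z - z0) - R0). split; [lra|].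
  intros u Hu HN. assert (T := Cmod_triangle (u - z0) (z - u)).
  replace (u - z0 + (z - u))%C with (z - z0)%C in T by ring.
  rewrite (Cmod_minus_sym z u) in T. lra.
Qed.

(** Exempting the centre from differentiability makes this applicable to difference quotients, which
    are only known to be continuous there. *)
Lemma max_modulus_disc (f : C -> C) (z0 : C) (r M : R) :
  (forall z, Cmod (z - z0) <= r -> continuous f z) ->
  (forall z, 0 < Cmod (z - z0) < r -> ex_derive f z) ->
  (forall z, Cmod (z - z0) = r -> Cmod (f z) <= M) ->
  forall z, Cmod (z - z0) <= r -> Cmod (f z) <= M.
Proof.
  intros Hc Hd HM.
  apply (max_modulus (fun z => Cmod (z - z0) <= r) f (Cmod z0 + r) M); auto.
  - intros z. apply closed_disc_closed.
  - intros z Hz. replace z with (z0 + (z - z0))%C by ring.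
    eapply Rle_trans; [apply Cmod_triangle|]. lra.
  - intros z Hz. destruct (Req_dec (Cmod (z - z0)) r) as [E|N]; [left; auto|right].
    set (m := r - Cmod (z - z0)). assert (Hm : 0 < m) by (unfold m; lra).
    destruct (Ceq_dec z z0) as [->|Hzz].
    + exists (m / 2). assert (E0 := Cmod_self z0).
      split; [lra|]. split; intros u Hu; [unfold m in *; lra|]. apply Hd. unfold m in *; lra.
    + assert (Hp : 0 < Cmod (z - z0)).
      { apply Cmod_gt_0. intros E. apply Hzz. apply Ceq_minus, E. }
      exists (Rmin (m / 2) (Cmod (z - z0) / 2)). split. apply Rmin_pos; lra.
      assert (Hu' : forall u, Cmod (u - z) <= Rmin (m / 2) (Cmod (z - z0) / 2) ->
                0 < Cmod (u - z0) < r).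
      { intros u Hu. assert (U1 := Rle_trans _ _ _ Hu (Rmin_l _ _)).
        assert (U2 := Rle_trans _ _ _ Hu (Rmin_r _ _)).
        assert (T := Cmod_triangle (u - z) (z - z0)).
        replace (u - z + (z - z0))%C with (u - z0)%C in T by ring.
        assert (T' := Cmod_triangle (u - z0) (z - u)).
        replace (u - z0 + (z - u))%C with (z - z0)%C in T' by ring.
        rewrite (Cmod_minus_sym z u) in T'. unfold m in *; lra. }
      split; intros u Hu. specialize (Hu' u Hu); lra. apply Hd, Hu'. lra.
Qed.

(** * Difference quotients, Schwarz's lemma and Cauchy's estimate *)

Definition dquot (f : C -> C) (z0 l z : C) : C :=
  if Ceq_dec z z0 then l else ((f z - f z0) / (z - z0))%C.

Lemma dquot_continuous (f : C -> C) (z0 l : C) :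
  is_derive f z0 l -> continuous (dquot f z0 l) z0.
Proof.
  intros H. apply Ccontinuous_eps. intros eps He.
  destruct (proj1 (C_is_derive_eps f z0 l) H (eps / 2) ltac:(lra)) as (d & Hd & H').
  exists d; split; auto. intros w Hw. unfold dquot.
  destruct (Ceq_dec z0 z0) as [_|N]; [|congruence].
  destruct (Ceq_dec w z0) as [->|N].
  - replace (l - l)%C with (RtoC 0) by ring. rewrite Cmod_0; auto.
  - assert (Hn := Cminus_eq_contra _ _ N).
    replace ((f w - f z0) / (w - z0) - l)%C with ((f w - f z0 - (w - z0) * l) / (w - z0))%C
      by (field; auto).
    rewrite Cmod_div by auto. apply Rle_lt_trans with (eps / 2); [|lra].
    assert (P := proj1 (Cmod_gt_0 _) Hn).
    apply Rmult_le_reg_r with (Cmod (w - z0)); auto. unfold Rdiv at 1.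
    rewrite Rmult_assoc, Rinv_l by lra. rewrite Rmult_1_r. apply H', Hw.
Qed.

Lemma dquot_ex_derive (f : C -> C) (z0 l z : C) :
  z <> z0 -> ex_derive f z -> ex_derive (dquot f z0 l) z.
Proof.
  intros Hz Hf.
  assert (Hn := Cminus_eq_contra _ _ Hz).
  apply C_ex_derive_ext_loc with (fun z => (f z - f z0) / (z - z0))%C.
  - apply Clocally_eps. exists (Cmod (z - z0)). split. apply Cmod_gt_0, Hn.
    intros w Hw. unfold dquot. destruct (Ceq_dec w z0) as [->|]; auto.
    rewrite Cmod_minus_sym in Hw. lra.
  - auto 10 with cder.
Qed.

Lemma dquot_bound (f : C -> C) (z0 l : C) (r M : R) :
  0 < r -> is_derive f z0 l ->
  (forall z, Cmod (z - z0) <= r -> ex_derive f z) ->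
  (forall z, Cmod (z - z0) = r -> Cmod (f z - f z0) <= M) ->
  forall z, Cmod (z - z0) <= r -> Cmod (dquot f z0 l z) <= M / r.
Proof.
  intros Hr Hl Hd HM. apply max_modulus_disc.
  - intros z Hz. destruct (Ceq_dec z z0) as [->|N].
    + apply dquot_continuous, Hl.
    + apply C_ex_derive_continuous, dquot_ex_derive; auto.
  - intros z Hz. apply dquot_ex_derive.
    + intros ->. replace (z0 - z0)%C with (RtoC 0) in Hz by ring. rewrite Cmod_0 in Hz. lra.
    + apply Hd; lra.
  - intros z Hz. unfold dquot. destruct (Ceq_dec z z0) as [->|N].
    + replace (z0 - z0)%C with (RtoC 0) in Hz by ring. rewrite Cmod_0 in Hz. lra.
    + rewrite Cmod_div by (apply Cminus_eq_contra, N). rewrite Hz.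
      apply Rmult_le_compat_r. left; apply Rinv_0_lt_compat, Hr. auto.
Qed.

(** The maximum principle bounds the difference quotient by its size M / r on the circle;
    multiplying by |z - z0| gives the claim. *)
Lemma schwarz_bound (f : C -> C) (z0 : C) (r M : R) :
  0 < r ->
  (forall z, Cmod (z - z0) <= r -> ex_derive f z) ->
  (forall z, Cmod (z - z0) = r -> Cmod (f z - f z0) <= M) ->
  forall z, Cmod (z - z0) <= r -> Cmod (f z - f z0) <= M / r * Cmod (z - z0).
Proof.
  intros Hr Hd HM z Hz.
  destruct (Hd z0) as [l Hl].
  { replace (z0 - z0)%C with (RtoC 0) by ring. rewrite Cmod_0; lra. }
  assert (B := dquot_bound f z0 l r M Hr Hl Hd HM z Hz). unfold dquot in B.
  destruct (Ceq_dec z z0) as [->|N].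
  - replace (f z0 - f z0)%C with (RtoC 0) by ring.
    replace (z0 - z0)%C with (RtoC 0) by ring. rewrite Cmod_0. lra.
  - assert (Hn := Cminus_eq_contra _ _ N). rewrite Cmod_div in B by auto.
    assert (P := proj1 (Cmod_gt_0 _) Hn).
    apply Rmult_le_compat_r with (r := Cmod (z - z0)) in B; [|lra].
    unfold Rdiv at 1 in B. rewrite Rmult_assoc, Rinv_l in B by lra. lra.
Qed.

(* Applying the maximum principle to the odd part of f about z0 removes the
   value f z0 and so gives the sharp constant. *)
Lemma cauchy_estimate (f : C -> C) (z0 l : C) (r M : R) :
  0 < r -> is_derive f z0 l ->
  (forall z, Cmod (z - z0) <= r -> ex_derive f z) ->
  (forall z, Cmod (z - z0) = r -> Cmod (f z) <= M) ->
  Cmod l <= M / r.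
Proof.
  intros Hr Hl Hd HM.
  set (h := fun z => ((f z - f (2 * z0 - z)) * / 2)%C).
  assert (Hrefl : forall z, Cmod (2 * z0 - z - z0) = Cmod (z - z0)).
  { intros z. rewrite Cmod_minus_sym. f_equal. ring. }
  assert (H0 : h z0 = 0%C).
  { unfold h. replace (2 * z0 - z0)%C with z0 by ring. ring. }
  assert (Hh : is_derive h z0 l).
  { replace l with ((l - (0 - 1) * l) * / 2 + (f z0 - f (2 * z0 - z0)) * 0)%C by field.
    unfold h. apply (C_is_derive_mult (fun z => f z - f (2 * z0 - z))%C (fun _ => / 2)%C);
      [|apply C_is_derive_const].
    apply C_is_derive_minus; auto.
    apply (C_is_derive_comp f (fun z => 2 * z0 - z)%C).
    - replace (2 * z0 - z0)%C with z0 by ring. auto.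
    - apply C_is_derive_minus. apply C_is_derive_const. apply C_is_derive_id. }
  assert (Z : Cmod (z0 - z0) <= r).
  { replace (z0 - z0)%C with (RtoC 0) by ring. rewrite Cmod_0; lra. }
  assert (B := dquot_bound h z0 l r M Hr Hh).
  assert (B1 : Cmod (dquot h z0 l z0) <= M / r).
  { apply B; auto.
    - intros z Hz. unfold h. apply C_ex_derive_mult; [|apply C_ex_derive_const].
      apply C_ex_derive_minus; auto.
      apply (C_ex_derive_comp f (fun z => 2 * z0 - z)%C); [|auto with cder].
      apply Hd. rewrite Hrefl. auto.
    - intros z Hz. rewrite H0. replace (h z - 0)%C with (h z) by ring.
      unfold h. rewrite Cmod_mult.
      assert (E : Cmod (/ 2) = / 2).
      { rewrite <- RtoC_inv by lra. rewrite Cmod_R. apply Rabs_pos_eq. lra. }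
      rewrite E. assert (T := Cmod_triangle_minus (f z) (f (2 * z0 - z)%C)).
      assert (M1 := HM z Hz). assert (M2 := HM (2 * z0 - z)%C ltac:(rewrite Hrefl; auto)). lra. }
  unfold dquot in B1. destruct (Ceq_dec z0 z0); [auto|congruence].
Qed.

(** * Series of holomorphic functions, identity theorem, Borel-Caratheodory *)

(** The difference u -> f (u + h) - f u is at most (8 M / R0) |h| by Schwarz's lemma, and Cauchy's
    estimate with radius R0 / 4 bounds its derivative, which is l2 - l1 at z. *)
Lemma derivative_lipschitz (f : C -> C) (z0 z w l1 l2 : C) (R0 M : R) :
  0 < R0 ->
  (forall u, Cmod (u - z0) < R0 -> ex_derive f u) ->
  (forall u, Cmod (u - z0) < R0 -> Cmod (f u) <= M) ->
  Cmod (z - z0) < R0 / 4 -> Cmod (w - z) < R0 / 4 ->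
  is_derive f z l1 -> is_derive f w l2 ->
  Cmod (l2 - l1) <= 32 * M / R0 ^ 2 * Cmod (w - z).
Proof.
  intros HR Hd HM Hz Hw H1 H2.
  set (h := (w - z)%C) in *.
  set (d := fun u => (f (u + h)%C - f u)%C).
  assert (Near : forall u, Cmod (u - z) <= R0 / 4 -> Cmod (u - z0) < R0 / 2).
  { intros u Hu. replace (u - z0)%C with ((u - z) + (z - z0))%C by ring.
    eapply Rle_lt_trans; [apply Cmod_triangle|]. lra. }
  assert (Near2 : forall u v, Cmod (u - z) <= R0 / 4 -> Cmod (v - u) <= R0 / 4 -> Cmod (v - z0) < R0).
  { intros u v Hu Hv. replace (v - z0)%C with ((v - u) + (u - z0))%C by ring.
    eapply Rle_lt_trans; [apply Cmod_triangle|]. specialize (Near u Hu). lra. }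
  assert (Hdz : is_derive d z (l2 - l1)%C).
  { replace (l2 - l1)%C with ((1 + 0) * l2 - l1)%C by ring.
    apply (C_is_derive_minus (fun u => f (u + h)%C)%C f); auto.
    apply (C_is_derive_comp f (fun u => u + h)%C).
    - replace (z + h)%C with w by (unfold h; ring). auto.
    - apply C_is_derive_plus. apply C_is_derive_id. apply C_is_derive_const. }
  assert (Eh : forall u, Cmod (u + h - u) = Cmod h) by (intros u; f_equal; ring).
  replace (32 * M / R0 ^ 2 * Cmod h) with (8 * M / R0 * Cmod h / (R0 / 4)) by (field; lra).
  apply (cauchy_estimate d z (l2 - l1)%C (R0 / 4) (8 * M / R0 * Cmod h)); auto; [lra| |].
  - intros u Hu. apply C_ex_derive_minus.
    + apply (C_ex_derive_comp f (fun u => u + h)%C); [|auto with cder].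
      apply Hd, (Near2 u); auto. rewrite Eh. lra.
    + apply Hd. specialize (Near u Hu). lra.
  - intros u Hu. unfold d.
    replace (8 * M / R0 * Cmod h) with (2 * M / (R0 / 4) * Cmod (u + h - u))
      by (rewrite Eh; field; lra).
    apply schwarz_bound; [lra| | |].
    + intros v Hv. apply Hd, (Near2 u); auto. lra.
    + intros v Hv. eapply Rle_trans; [apply Cmod_triangle_minus|].
      assert (Cmod (f v) <= M) by (apply HM, (Near2 u); lra).
      assert (Cmod (f u) <= M) by (apply HM; specialize (Near u ltac:(lra)); lra).
      lra.
    + rewrite Eh. lra.
Qed.

(** A rotation makes the increment real and nonnegative, so the real mean value theorem applies to a
    real part along the segment. *)
Lemma Cmod_le_of_derive_bound (f : C -> C) (f' : C -> C) (z w : C) (B : R) :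
  (forall t, 0 <= t <= 1 -> is_derive f (z + t * (w - z))%C (f' (z + t * (w - z))%C)
      /\ Cmod (f' (z + t * (w - z))%C) <= B) ->
  Cmod (f w - f z) <= B * Cmod (w - z).
Proof.
  intros H.
  destruct (rotate_to_modulus (f w - f z)) as (c & Hc1 & Hc2).
  set (g := fun u => (c * f u)%C).
  assert (Hg : forall t, 0 <= t <= 1 ->
     is_derive (fun t : R => Re (g (z + t * (w - z))%C)) t (Re ((w - z) * (c * f' (z + t * (w - z))%C)))%C).
  { intros t Ht. apply is_derive_Re, (is_derive_along_line g).
    replace (c * f' (z + t * (w - z))%C)%C
      with (0 * f (z + t * (w - z))%C + c * f' (z + t * (w - z))%C)%C by ring.
    apply (C_is_derive_mult (fun _ => c) f); [apply C_is_derive_const|apply H, Ht]. }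
  destruct (MVT_gen (fun t : R => Re (g (z + t * (w - z))%C)) 0 1
    (fun t => Re ((w - z) * (c * f' (z + t * (w - z))%C)))%C) as (t & Ht & E).
  - intros t. rewrite Rmin_left, Rmax_right by lra. intros Ht. apply Hg; lra.
  - intros t. rewrite Rmin_left, Rmax_right by lra. intros Ht.
    apply derivable_continuous_pt. eexists. apply is_derive_Reals, Hg, Ht.
  - rewrite Rmin_left, Rmax_right in Ht by lra.
    assert (E1 : g (z + 1 * (w - z))%C = (c * f w)%C) by (unfold g; f_equal; f_equal; ring).
    assert (E0 : g (z + 0 * (w - z))%C = (c * f z)%C) by (unfold g; f_equal; f_equal; ring).
    rewrite E1, E0, <- Re_minus in E.
    replace (c * f w - c * f z)%C with (c * (f w - f z))%C in E by ring.
    rewrite Hc2, re_RtoC in E. rewrite E, Rminus_0_r, Rmult_1_r.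
    eapply Rle_trans; [apply Re_le_Cmod|]. rewrite !Cmod_mult, Hc1.
    rewrite Rmult_comm, Rmult_1_l. apply Rmult_le_compat_r. apply Cmod_ge_0. apply H, Ht.
Qed.

(** Mean value inequality for u -> f u - u l, whose derivative f' - l is controlled by the Lipschitz
    bound. The constant depends on f through M only, which makes the estimate summable. *)
Lemma taylor_remainder (f : C -> C) (z0 l h : C) (R0 M : R) :
  0 < R0 ->
  (forall u, Cmod (u - z0) < R0 -> ex_derive f u) ->
  (forall u, Cmod (u - z0) < R0 -> Cmod (f u) <= M) ->
  is_derive f z0 l -> Cmod h < R0 / 4 ->
  Cmod (f (z0 + h)%C - f z0 - h * l) <= 32 * M / R0 ^ 2 * Cmod h ^ 2.
Proof.
  intros HR Hd HM Hl Hh.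
  set (f' := fun u => C_derive f u).
  assert (Hf' : forall u, Cmod (u - z0) < R0 -> is_derive f u (f' u)).
  { intros u Hu. apply C_derive_correct; auto. }
  assert (Pt : forall t : R, 0 <= t <= 1 -> Cmod (z0 + t * (z0 + h - z0) - z0) <= Cmod h).
  { intros t Ht. replace (z0 + t * (z0 + h - z0) - z0)%C with (t * h)%C by ring.
    rewrite Cmod_mult, Cmod_R, Rabs_pos_eq by lra. generalize (Cmod_ge_0 h). nra. }
  assert (HM0 : 0 <= M).
  { eapply Rle_trans; [apply Cmod_ge_0|]. apply (HM z0). rewrite Cmod_self; auto. }
  replace (f (z0 + h)%C - f z0 - h * l)%C
    with ((f (z0 + h)%C - (z0 + h) * l) - (f z0 - z0 * l))%C by ring.
  replace (32 * M / R0 ^ 2 * Cmod h ^ 2)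
    with (32 * M / R0 ^ 2 * Cmod h * Cmod (z0 + h - z0)).
  2: { replace (z0 + h - z0)%C with h by ring. ring. }
  apply (Cmod_le_of_derive_bound (fun u => f u - u * l)%C (fun u => f' u - l)%C).
  intros t Ht. specialize (Pt t Ht). set (u := (z0 + t * (z0 + h - z0))%C) in *.
  split.
  - replace (f' u - l)%C with (f' u - (1 * l + u * 0))%C by ring.
    apply (C_is_derive_minus f (fun u => u * l)%C). apply Hf'; lra.
    apply (C_is_derive_mult (fun u => u) (fun _ => l)). apply C_is_derive_id. apply C_is_derive_const.
  - eapply Rle_trans. apply (derivative_lipschitz f z0 z0 u l (f' u) R0 M); auto.
    rewrite Cmod_self; lra. lra. apply Hf'; lra.
    apply Rmult_le_compat_l; auto.
    apply Rmult_le_pos; [lra|]. left; apply Rinv_0_lt_compat, pow_lt, HR.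
Qed.

(** * Series of complex numbers and of holomorphic functions *)

Lemma C_is_series_eps (a : nat -> C) (l : C) :
  is_series a l <->
  forall eps, 0 < eps -> exists N, forall n, (N <= n)%nat -> Cmod (sum_n a n - l) < eps.
Proof.
  split.
  - intros H eps He.
    destruct (proj1 (filterlim_locally (sum_n a) l) H (mkposreal (eps / 2) ltac:(lra))) as (N & HN).
    exists N. intros n Hn. specialize (HN n Hn). apply Cmod_Cball in HN. simpl in HN. lra.
  - intros H. apply (filterlim_locally (U := C_UniformSpace) (sum_n a) l). intros eps.
    destruct (H eps (cond_pos eps)) as (N & HN). exists N. intros n Hn.
    apply Cball_Cmod, HN, Hn.
Qed.

Lemma C_is_series_unique (a : nat -> C) (l1 l2 : C) :
  is_series a l1 -> is_series a l2 -> l1 = l2.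
Proof.
  intros H1 H2. apply Ceq_minus, Cmod_eq_0, Rle_antisym; [|apply Cmod_ge_0].
  apply le_epsilon. intros e He. rewrite Rplus_0_l.
  destruct (proj1 (C_is_series_eps a l1) H1 (e / 2) ltac:(lra)) as (N1 & HN1).
  destruct (proj1 (C_is_series_eps a l2) H2 (e / 2) ltac:(lra)) as (N2 & HN2).
  specialize (HN1 (Nat.max N1 N2) (Nat.le_max_l _ _)).
  specialize (HN2 (Nat.max N1 N2) (Nat.le_max_r _ _)).
  replace (l1 - l2)%C with ((sum_n a (Nat.max N1 N2) - l2) - (sum_n a (Nat.max N1 N2) - l1))%C by ring.
  eapply Rle_trans; [apply Cmod_triangle_minus|]. lra.
Qed.

Lemma C_ex_series_le (a : nat -> C) (b : nat -> R) :
  (forall n, Cmod (a n) <= b n) -> ex_series b ->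
  exists l : C, is_series a l.
Proof. exact (ex_series_le (K := C_AbsRing) (V := C_CompleteNormedModule) a b). Qed.

Lemma Cmod_sum_n_le (a : nat -> C) (b : nat -> R) (n : nat) :
  (forall k, (k <= n)%nat -> Cmod (a k) <= b k) -> Cmod (sum_n a n) <= sum_n b n.
Proof.
  induction n; intros H.
  - rewrite !sum_O. apply H; lia.
  - rewrite !sum_Sn. eapply Rle_trans; [apply Cmod_triangle|].
    apply Rplus_le_compat. apply IHn; auto. apply H; lia.
Qed.

Lemma sum_n_le_series (b : nat -> R) (l : R) (n : nat) :
  (forall k, 0 <= b k) -> is_series b l -> sum_n b n <= l.
Proof.
  intros Hb Hl.
  apply (is_lim_seq_incr_compare (sum_n b) l Hl).
  intros k. rewrite sum_Sn. change (sum_n b k <= sum_n b k + b (S k)). specialize (Hb (S k)). lra.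
Qed.

Lemma Cmod_series_le (a : nat -> C) (b : nat -> R) (l : C) (lb : R) :
  (forall n, Cmod (a n) <= b n) -> is_series a l -> is_series b lb -> Cmod l <= lb.
Proof.
  intros H Ha Hb. apply le_epsilon. intros e He.
  destruct (proj1 (C_is_series_eps a l) Ha e He) as (N & HN).
  specialize (HN N (le_n N)).
  replace l with (sum_n a N - (sum_n a N - l))%C by ring.
  eapply Rle_trans; [apply Cmod_triangle_minus|]. apply Rplus_le_compat; [|lra].
  eapply Rle_trans; [apply (Cmod_sum_n_le a b); auto|].
  apply sum_n_le_series; auto. intros k. eapply Rle_trans; [apply Cmod_ge_0|apply H].
Qed.

Lemma C_is_series_minus (a b : nat -> C) (la lb : C) :
  is_series a la -> is_series b lb -> is_series (fun n => a n - b n)%C (la - lb)%C.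
Proof. exact (is_series_minus (K := C_AbsRing) (V := C_NormedModule) a b la lb). Qed.

Lemma C_is_series_scal (c : C) (a : nat -> C) (la : C) :
  is_series a la -> is_series (fun n => c * a n)%C (c * la)%C.
Proof. exact (is_series_scal (K := C_AbsRing) (V := C_NormedModule) c a la). Qed.

(** The derivatives are summable by Cauchy's estimate, and the quadratic Taylor remainders of the
    terms add up to a quadratic remainder for F. *)
Lemma weierstrass_series (f : nat -> C -> C) (F : C -> C) (l : nat -> C) (M : nat -> R) (z0 : C) (R0 : R) :
  0 < R0 ->
  (forall n u, Cmod (u - z0) < R0 -> ex_derive (f n) u /\ Cmod (f n u) <= M n) ->
  ex_series M ->
  (forall u, Cmod (u - z0) < R0 -> is_series (fun n => f n u) (F u)) ->
  (forall n, is_derive (f n) z0 (l n)) ->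
  exists l', is_series l l' /\ is_derive F z0 l'.
Proof.
  intros HR Hf [SM HM] HF Hl.
  destruct (C_ex_series_le l (fun n => 2 / R0 * M n)) as (l' & Hl').
  - intros n. replace (2 / R0 * M n) with (M n / (R0 / 2)) by (field; lra).
    apply (cauchy_estimate (f n) z0); auto; try lra; intros z Hz; apply Hf; lra.
  - exists (2 / R0 * SM). apply (is_series_scal (2 / R0) M), HM.
  - exists l'. split; auto. apply C_is_derive_eps. intros eps He.
    assert (M0 : forall n, 0 <= M n).
    { intros n. eapply Rle_trans; [apply Cmod_ge_0|]. apply (Hf n z0). rewrite Cmod_self; lra. }
    assert (HSM : 0 <= SM).
    { apply Rle_trans with (sum_n M 0). rewrite sum_O; auto. apply sum_n_le_series; auto. }
    set (K := 32 * SM / R0 ^ 2 + 1).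
    assert (HK0 : 0 <= 32 * SM / R0 ^ 2).
    { apply Rmult_le_pos; [lra|]. left; apply Rinv_0_lt_compat, pow_lt, HR. }
    (* R0 / 4 is the range of the Taylor estimate; eps / K turns the quadratic error into eps
       |h|. *)
    exists (Rmin (R0 / 4) (eps / K)). split.
    { apply Rmin_pos; [lra|]. apply Rdiv_lt_0_compat; unfold K; lra. }
    intros w Hw.
    assert (W1 := Rlt_le_trans _ _ _ Hw (Rmin_l _ _)).
    assert (W2 := Rlt_le_trans _ _ _ Hw (Rmin_r _ _)).
    set (h := (w - z0)%C) in *.
    assert (B : Cmod (F w - F z0 - h * l') <= 32 * SM / R0 ^ 2 * Cmod h ^ 2).
    { apply (Cmod_series_le (fun n => f n w - f n z0 - h * l n)%C
               (fun n => 32 / R0 ^ 2 * Cmod h ^ 2 * M n)).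
      - intros n. replace (32 / R0 ^ 2 * Cmod h ^ 2 * M n) with (32 * M n / R0 ^ 2 * Cmod h ^ 2)
          by (field; lra).
        replace w with (z0 + h)%C by (unfold h; ring).
        apply taylor_remainder; auto; intros u Hu; apply Hf, Hu.
      - apply C_is_series_minus; [|apply C_is_series_scal, Hl'].
        apply C_is_series_minus; apply HF. fold h; lra. rewrite Cmod_self; lra.
      - replace (32 * SM / R0 ^ 2 * Cmod h ^ 2) with (32 / R0 ^ 2 * Cmod h ^ 2 * SM) by (field; lra).
        apply (is_series_scal (32 / R0 ^ 2 * Cmod h ^ 2) M), HM. }
    eapply Rle_trans; [apply B|].
    assert (K * Cmod h <= eps).
    { apply Rle_trans with (K * (eps / K)). apply Rmult_le_compat_l; [unfold K|]; lra.
      right; field; unfold K; lra. }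
    unfold K in *. generalize (Cmod_ge_0 h). nra.
Qed.

Lemma is_series_telescope (u : nat -> C) (l : C) :
  (forall eps, 0 < eps -> exists N, forall n, (N <= n)%nat -> Cmod (u n - l) < eps) ->
  is_series (fun n => u (S n) - u n)%C (l - u O)%C.
Proof.
  intros H. apply C_is_series_eps. intros eps He. destruct (H eps He) as (N & HN).
  exists N. intros n Hn.
  assert (E : forall n, sum_n (fun n => u (S n) - u n)%C n = (u (S n) - u O)%C).
  { intros k; induction k. rewrite sum_O; auto.
    rewrite sum_Sn, IHk. change (u (S k) - u O + (u (S (S k)) - u (S k)) = u (S (S k)) - u O)%C. ring. }
  rewrite E. replace (u (S n) - u O - (l - u O))%C with (u (S n) - l)%C by ring.
  apply HN; lia.
Qed.

Lemma ex_series_half_pow (c : R) : ex_series (fun n => c * (1 / 2) ^ n).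
Proof.
  exists (c * (/ (1 - 1 / 2))). apply (is_series_scal c (fun n => (1 / 2) ^ n)).
  apply is_series_geom. rewrite Rabs_pos_eq; lra.
Qed.

(* The difference quotients with steps r 2^-n converge geometrically to the
   derivative, which is therefore a Weierstrass sum of holomorphic functions. *)
Lemma derive_holomorphic (f : C -> C) (z0 : C) (R0 M : R) :
  0 < R0 ->
  (forall u, Cmod (u - z0) < R0 -> ex_derive f u) ->
  (forall u, Cmod (u - z0) < R0 -> Cmod (f u) <= M) ->
  ex_derive (C_derive f) z0.
Proof.
  intros HR Hd HM.
  (* The Taylor estimate will be used with radius R0 / 2, hence for steps below R0 / 8. *)
  set (h := fun n : nat => RtoC (R0 / 16 * (1 / 2) ^ n)).
  assert (P2 : forall n, 0 < (1 / 2) ^ n <= 1).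
  { intros n. split. apply pow_lt; lra. rewrite <- (pow1 n) at 2. apply pow_incr; lra. }
  assert (Hh : forall n, Cmod (h n) = R0 / 16 * (1 / 2) ^ n).
  { intros n. unfold h. rewrite Cmod_R. apply Rabs_pos_eq. specialize (P2 n). nra. }
  assert (Hhn : forall n, h n <> 0%C).
  { intros n. apply Cmod_gt_0. rewrite Hh. specialize (P2 n). nra. }
  set (q := fun n u => ((f (u + h n)%C - f u) / h n)%C).
  assert (M0 : 0 <= M).
  { eapply Rle_trans; [apply Cmod_ge_0|]. apply (HM z0). rewrite Cmod_self; auto. }
  assert (Near : forall u v, Cmod (u - z0) < R0 / 2 -> Cmod (v - u) < R0 / 2 -> Cmod (v - z0) < R0).
  { intros u v Hu Hv. replace (v - z0)%C with ((v - u) + (u - z0))%C by ring.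
    eapply Rle_lt_trans; [apply Cmod_triangle|]. lra. }
  assert (Eh : forall u n, Cmod (u + h n - u) = Cmod (h n)) by (intros; f_equal; ring).
  set (K := 32 * M / (R0 / 2) ^ 2).
  assert (K0 : 0 <= K).
  { apply Rmult_le_pos; [lra|]. left; apply Rinv_0_lt_compat, pow_lt; lra. }
  assert (Hq : forall u n, Cmod (u - z0) < R0 / 2 ->
     Cmod (q n u - C_derive f u) <= K * (R0 / 16) * (1 / 2) ^ n).
  { intros u n Hu.
    assert (D : is_derive f u (C_derive f u)) by (apply C_derive_correct; auto; apply Hd; lra).
    assert (T := taylor_remainder f u (C_derive f u) (h n) (R0 / 2) M ltac:(lra)
      (fun v Hv => Hd v (Near u v Hu Hv)) (fun v Hv => HM v (Near u v Hu Hv)) D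
      ltac:(rewrite Hh; specialize (P2 n); nra)).
    unfold q. replace ((f (u + h n)%C - f u) / h n - C_derive f u)%C
      with ((f (u + h n)%C - f u - h n * C_derive f u) / h n)%C by (field; auto).
    rewrite Cmod_div by auto. fold K in T.
    assert (Ph := proj1 (Cmod_gt_0 _) (Hhn n)).
    apply Rmult_le_reg_r with (Cmod (h n)); auto. unfold Rdiv at 1.
    rewrite Rmult_assoc, Rinv_l, Rmult_1_r by lra.
    eapply Rle_trans; [apply T|]. right. rewrite Hh. ring. }
  assert (Dq : forall u n, Cmod (u - z0) < R0 / 2 -> ex_derive (q n) u).
  { intros u n Hu. apply C_ex_derive_div; auto with cder.
    apply C_ex_derive_minus; [|apply Hd; lra].
    apply (C_ex_derive_comp f (fun u => u + h n)%C); [|auto with cder].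
    apply Hd, (Near u); auto. rewrite Eh, Hh. specialize (P2 n). nra. }
  destruct (weierstrass_series (fun n u => q (S n) u - q n u)%C
    (fun u => C_derive f u - q O u)%C
    (fun n => C_derive (fun u => q (S n) u - q n u)%C z0)
    (fun n => K * (R0 / 8) * (1 / 2) ^ n) z0 (R0 / 2)) as (l' & _ & Hl').
  - lra.
  - intros n u Hu. split. apply C_ex_derive_minus; auto.
    replace (q (S n) u - q n u)%C with ((q (S n) u - C_derive f u) - (q n u - C_derive f u))%C by ring.
    eapply Rle_trans; [apply Cmod_triangle_minus|].
    assert (H1 := Hq u n Hu). assert (H2 := Hq u (S n) Hu). simpl in H2.
    assert (0 <= K * (R0 / 16) * (1 / 2) ^ n).
    { specialize (P2 n). apply Rmult_le_pos; [apply Rmult_le_pos|]; lra. }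
    lra.
  - apply ex_series_half_pow.
  - intros u Hu. apply (is_series_telescope (fun n => q n u)).
    intros eps He.
    assert (KR : 0 <= K * (R0 / 16)) by (apply Rmult_le_pos; lra).
    destruct (geom_eventually_lt _ (1 / 2) eps KR ltac:(lra) He) as (N & HN).
    exists N. intros n Hn. eapply Rle_lt_trans; [apply Hq, Hu|auto].
  - intros n. apply C_derive_correct; auto.
    assert (Z : Cmod (z0 - z0) < R0 / 2) by (rewrite Cmod_self; lra).
    apply C_ex_derive_minus; auto.
  - assert (Z : Cmod (z0 - z0) < R0 / 2) by (rewrite Cmod_self; lra).
    (* The telescoping series represents f' minus the quotient [q O], which is added back. *)
    apply C_ex_derive_ext with (fun u => (C_derive f u - q O u) + q O u)%C.
    + intros w. ring.
    + apply C_ex_derive_plus; auto. exists l'. auto.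
Qed.

Lemma continuous_locally_bounded (f : C -> C) (z0 : C) :
  continuous f z0 -> exists d, 0 < d /\ forall u, Cmod (u - z0) < d -> Cmod (f u) <= Cmod (f z0) + 1.
Proof.
  intros H. destruct (proj1 (Ccontinuous_eps f z0) H 1 Rlt_0_1) as (d & Hd & H').
  exists d; split; auto. intros u Hu. specialize (H' u Hu).
  assert (T := Cmod_triangle_inv (f u) (f z0)). lra.
Qed.

(** Supplies the differentiability of L'/L that Goursat's theorem asks for when L'/L is
    integrated. *)
Lemma C_derive_ex_derive (f : C -> C) (z0 : C) :
  locally z0 (fun u : C => ex_derive f u) -> ex_derive (C_derive f) z0.
Proof.
  intros H. apply Clocally_eps in H. destruct H as (d & Hd & H).
  destruct (continuous_locally_bounded f z0) as (e & He & Hb).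
  - apply C_ex_derive_continuous, H. rewrite Cmod_self; auto.
  - apply derive_holomorphic with (Rmin d e) (Cmod (f z0) + 1).
    + apply Rmin_pos; auto.
    + intros u Hu. apply H. eapply Rlt_le_trans; [apply Hu|apply Rmin_l].
    + intros u Hu. apply Hb. eapply Rlt_le_trans; [apply Hu|apply Rmin_r].
Qed.

(* h / (z - a)^n extends by 0 through a, so the maximum principle bounds h on
   |z - a| = s by M (s / R0)^n for every n. *)
Lemma identity_disc (h : C -> C) (a z : C) (d R0 M : R) :
  0 < d -> 
  (forall u, Cmod (u - a) <= R0 -> ex_derive h u) ->
  (forall u, Cmod (u - a) < d -> h u = 0%C) ->
  (forall u, Cmod (u - a) = R0 -> Cmod (h u) <= M) ->
  Cmod (z - a) < R0 -> h z = 0%C.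
Proof.
  intros Hd Hh H0 HM Hz.
  destruct (Ceq_dec z a) as [->|Nza]; [apply H0; rewrite Cmod_self; auto|].
  set (s := Cmod (z - a)) in *.
  assert (Hs : 0 < s) by (apply Cmod_gt_0, Cminus_eq_contra, Nza).
  assert (HR : 0 < R0) by lra.
  assert (HM0 : 0 <= M).
  { eapply Rle_trans; [apply Cmod_ge_0|]. apply (HM (a + RtoC R0)%C).
    replace (a + R0 - a)%C with (RtoC R0) by ring. rewrite Cmod_R, Rabs_pos_eq; lra. }
  assert (B : forall n, Cmod (h z) <= M * (s / R0) ^ n).
  { intros n.
    (* Since h vanishes near a, the value 0 at a makes [k] vanish identically there. *)
    set (k := fun u => if Ceq_dec u a then RtoC 0 else (h u / (u - a) ^ n)%C).
    assert (Dk : forall u, Cmod (u - a) <= R0 -> ex_derive k u).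
    { intros u Hu. destruct (Ceq_dec u a) as [->|N].
      - apply C_ex_derive_ext_loc with (fun _ => RtoC 0); [|auto with cder].
        apply Clocally_eps. exists d; split; auto. intros w Hw. unfold k.
        destruct (Ceq_dec w a); auto. rewrite H0 by auto. unfold Cdiv. ring.
      - assert (Hn := Cminus_eq_contra _ _ N).
        apply C_ex_derive_ext_loc with (fun u => h u / (u - a) ^ n)%C.
        + apply Clocally_eps. exists (Cmod (u - a)). split. apply Cmod_gt_0, Hn.
          intros w Hw. unfold k. destruct (Ceq_dec w a) as [->|]; auto.
          rewrite Cmod_minus_sym in Hw. lra.
        + apply C_ex_derive_div; auto with cder. apply Cpow_nz, Hn. }
    assert (Bk : Cmod (k z) <= M / R0 ^ n).
    { apply (max_modulus_disc k a R0).
      - intros u Hu. apply C_ex_derive_continuous, Dk, Hu.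
      - intros u Hu. apply Dk. lra.
      - intros u Hu. unfold k. destruct (Ceq_dec u a) as [->|N].
        rewrite Cmod_self in Hu; lra.
        rewrite Cmod_div by (apply Cpow_nz, Cminus_eq_contra, N).
        rewrite Cmod_pow, Hu. apply Rmult_le_compat_r; auto.
        left; apply Rinv_0_lt_compat, pow_lt, HR.
      - fold s; lra. }
    unfold k in Bk. destruct (Ceq_dec z a); [contradiction|].
    rewrite Cmod_div, Cmod_pow in Bk by (apply Cpow_nz, Cminus_eq_contra; auto).
    fold s in Bk.
    assert (Ps : 0 < s ^ n) by (apply pow_lt, Hs).
    assert (PR : 0 < R0 ^ n) by (apply pow_lt, HR).
    apply Rmult_le_compat_r with (r := s ^ n) in Bk; [|lra].
    unfold Rdiv at 1 in Bk. rewrite Rmult_assoc, Rinv_l, Rmult_1_r in Bk by lra.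
    eapply Rle_trans; [apply Bk|]. right. unfold Rdiv. rewrite Rpow_mult_distr, pow_inv. ring. }
  apply Cmod_eq_0, Rle_antisym; [|apply Cmod_ge_0].
  apply le_epsilon. intros e He. rewrite Rplus_0_l.
  assert (Hsr : 0 < s / R0 < 1).
  { split. apply Rdiv_lt_0_compat; lra. apply Rmult_lt_reg_r with R0; auto.
    unfold Rdiv. rewrite Rmult_assoc, Rinv_l; lra. }
  destruct (geom_eventually_lt M (s / R0) e HM0 ltac:(lra) He) as (N & HN).
  left. eapply Rle_lt_trans; [apply B|apply (HN N), le_n].
Qed.

Lemma continuous_bounded_disc (f : C -> C) (a : C) (R0 : R) :
  0 <= R0 -> (forall u, Cmod (u - a) <= R0 -> continuous f u) ->
  exists M, forall u, Cmod (u - a) <= R0 -> Cmod (f u) <= M.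
Proof.
  intros HR Hc.
  destruct (usc_attains_max (fun u => Cmod (u - a) <= R0) (fun u => Cmod (f u)) (Cmod a + R0))
    as (z0 & _ & H).
  - intros z. apply closed_disc_closed.
  - intros z Hz. replace z with (a + (z - a))%C by ring.
    eapply Rle_trans; [apply Cmod_triangle|]. lra.
  - intros z Hz e He. destruct (proj1 (Ccontinuous_eps f z) (Hc z Hz) e He) as (d & Hd & H).
    exists d; split; auto. intros u Hu. specialize (H u Hu).
    assert (T := Cmod_triangle_inv (f u) (f z)). lra.
  - exists a. rewrite Cmod_self; auto.
  - eauto.
Qed.

Lemma identity_theorem_disc (f g : C -> C) (a z : C) (d R0 : R) :
  0 < d ->
  (forall u, Cmod (u - a) <= R0 -> ex_derive f u /\ ex_derive g u) ->
  (forall u, Cmod (u - a) < d -> f u = g u) ->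
  Cmod (z - a) < R0 -> f z = g z.
Proof.
  intros Hd Hfg E Hz.
  assert (HR : 0 <= R0) by (generalize (Cmod_ge_0 (z - a)); lra).
  assert (Dh : forall u, Cmod (u - a) <= R0 -> ex_derive (fun u => f u - g u)%C u).
  { intros u Hu. destruct (Hfg u Hu). auto with cder. }
  destruct (continuous_bounded_disc (fun u => f u - g u)%C a R0 HR) as (M & HM).
  { intros u Hu. apply C_ex_derive_continuous, Dh, Hu. }
  apply Ceq_minus.
  apply (identity_disc (fun u => f u - g u)%C a z d R0 M); auto.
  - intros u Hu. rewrite E by auto. ring.
  - intros u Hu. apply HM; lra.
Qed.

(** The map u -> u / (2 A - u) fixes 0 and sends the half-plane Re u <= A into the closed unit disc.
    Schwarz's lemma bounds the image of f - f a by r / R0, and solving for f - f a gives the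
    estimate. *)
Lemma borel_caratheodory (f : C -> C) (a z : C) (R0 r A : R) :
  0 < R0 -> 0 < A -> r < R0 ->
  (forall u, Cmod (u - a) <= R0 -> ex_derive f u) ->
  (forall u, Cmod (u - a) <= R0 -> Re (f u) <= Re (f a) + A) ->
  Cmod (z - a) <= r ->
  Cmod (f z - f a) * (R0 - r) <= 2 * A * r.
Proof.
  intros HR HA Hr Hd HRe Hz.
  assert (Nz : forall u, Cmod (u - a) <= R0 -> (2 * A - (f u - f a))%C <> 0%C).
  { intros u Hu E. assert (E' : Re (2 * A - (f u - f a)) = 0) by (rewrite E; reflexivity).
    rewrite !Re_minus in E'. rewrite <- RtoC_mult, re_RtoC in E'.
    specialize (HRe u Hu). lra. }
  set (k := fun u => ((f u - f a) / (2 * A - (f u - f a)))%C).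
  assert (Dk : forall u, Cmod (u - a) <= R0 -> ex_derive k u).
  { intros u Hu. specialize (Hd u Hu). apply C_ex_derive_div; auto 10 with cder. }
  assert (Ka : k a = 0%C) by (unfold k; replace (f a - f a)%C with (RtoC 0) by ring; unfold Cdiv; ring).
  assert (Bk : Cmod (k z - k a) <= 1 / R0 * Cmod (z - a)).
  { apply schwarz_bound; auto; [|lra]. intros u Hu.
    rewrite Ka. replace (k u - 0)%C with (k u) by ring. unfold k.
    assert (N := Nz u ltac:(lra)). rewrite Cmod_div by auto.
    assert (P := proj1 (Cmod_gt_0 _) N).
    apply Rmult_le_reg_r with (Cmod (2 * A - (f u - f a))); auto.
    unfold Rdiv. rewrite Rmult_assoc, Rinv_l by lra. rewrite Rmult_1_r, Rmult_1_l.
    specialize (HRe u ltac:(lra)).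
    (* After squaring, |u| <= |2 A - u| reads A Re u <= A^2. *)
    apply Rsqr_incr_0_var; [|lra].
    rewrite !Rsqr_pow2, !Cmod_sqr. rewrite !Re_minus, !Im_minus, <- RtoC_mult, re_RtoC, im_RtoC.
    nra. }
  rewrite Ka in Bk. replace (k z - 0)%C with (k z) in Bk by ring.
  assert (N := Nz z ltac:(lra)).
  assert (E : (f z - f a = k z * (2 * A - (f z - f a)))%C) by (unfold k; field; auto).
  set (g := Cmod (f z - f a)).
  assert (G : g <= Cmod (k z) * (2 * A + g)).
  { unfold g at 1. rewrite E, Cmod_mult. apply Rmult_le_compat_l. apply Cmod_ge_0.
    eapply Rle_trans; [apply Cmod_triangle_minus|]. fold g.
    rewrite <- RtoC_mult, Cmod_R, Rabs_pos_eq by lra. lra. }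
  assert (Hg : 0 <= g) by apply Cmod_ge_0.
  assert (K1 : Cmod (k z) * R0 <= r).
  { apply Rmult_le_compat_r with (r := R0) in Bk; [|lra].
    replace (1 / R0 * Cmod (z - a) * R0) with (Cmod (z - a)) in Bk by (field; lra). lra. }
  assert (g * R0 <= r * (2 * A + g)).
  { apply Rle_trans with (Cmod (k z) * (2 * A + g) * R0). apply Rmult_le_compat_r; lra.
    replace (Cmod (k z) * (2 * A + g) * R0) with (Cmod (k z) * R0 * (2 * A + g)) by ring.
    apply Rmult_le_compat_r; lra. }
  lra.
Qed.

(** * Logarithms on rectangles *)

(** The integrand is within e of the constant g0 between the endpoints. Both orders of x and x'
    occur, because the primitive is differentiated from both sides. *)
Lemma hor_int_increment (g : C -> C) (g0 : C) (y a x x' e : R) :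
  a <= x -> a <= x' ->
  (forall u, a <= u -> u <= Rmax x x' -> continuous g (u, y)) ->
  (forall u, Rmin x x' <= u <= Rmax x x' -> Cmod (g (u, y) - g0) <= e) ->
  Cmod (hor_int g y a x' - hor_int g y a x - RtoC (x' - x) * g0) <= e * Rabs (x' - x).
Proof.
  assert (W : forall x x', a <= x <= x' ->
    (forall u, a <= u -> u <= x' -> continuous g (u, y)) ->
    (forall u, x <= u <= x' -> Cmod (g (u, y) - g0) <= e) ->
    Cmod (hor_int g y a x' - hor_int g y a x - RtoC (x' - x) * g0) <= e * (x' - x)).
  { clear x x'. intros x x' Hx Hc Hb.
    assert (E1 : (hor_int g y a x + hor_int g y x x' = hor_int g y a x')%C).
    { apply (RInt_Chasles (V := CR)); apply ex_hor_int; try lra; intros; apply Hc; lra. }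
    assert (Kc : forall u, continuous (fun _ : C => g0) u)
      by (intros; apply C_ex_derive_continuous; auto with cder).
    assert (E2 : hor_int (fun _ => g0) y x x' = (RtoC (x' - x) * g0)%C).
    { rewrite (hor_int_primitive (fun z => z * g0)%C (fun _ => g0)); [|lra|].
      - replace ((x', y) * g0 - (x, y) * g0)%C with (((x', y) - (x, y)) * g0)%C by ring.
        f_equal. unfold Cminus, Cplus, Copp, RtoC; simpl. f_equal; ring.
      - intros u Hu. split; auto.
        apply C_is_derive_mul_const. }
    rewrite <- E1, <- E2.
    replace (hor_int g y a x + hor_int g y x x' - hor_int g y a x - hor_int (fun _ => g0) y x x')%C
      with (hor_int g y x x' - hor_int (fun _ => g0) y x x')%C by ring.
    rewrite <- (hor_int_minus g (fun _ => g0) y x x');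
      [|lra|intros u Hu; split; [apply Hc; lra|apply Kc]].
    rewrite Rmult_comm. apply Cmod_hor_int_le; [lra|]. intros u Hu. split.
    - apply (continuous_minus (V := C_R_NormedModule)); auto. apply Hc; lra.
    - apply Hb; lra. }
  intros Hx Hx' Hc Hb. destruct (Rle_dec x x') as [H|H].
  - rewrite Rmax_right, Rmin_left in * by lra. rewrite Rabs_pos_eq by lra. apply W; auto.
  - rewrite Rmax_left, Rmin_right in * by lra. rewrite Rabs_left1 by lra.
    replace (hor_int g y a x' - hor_int g y a x - RtoC (x' - x) * g0)%C
      with (- (hor_int g y a x - hor_int g y a x' - RtoC (x - x') * g0))%C
      by (rewrite !RtoC_minus; ring).
    rewrite Cmod_opp. replace (- (x' - x)) with (x - x') by ring. apply W; auto. lra.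
Qed.

Lemma ver_int_increment (g : C -> C) (g0 : C) (x c y y' e : R) :
  c <= y -> c <= y' ->
  (forall u, c <= u -> u <= Rmax y y' -> continuous g (x, u)) ->
  (forall u, Rmin y y' <= u <= Rmax y y' -> Cmod (g (x, u) - g0) <= e) ->
  Cmod (ver_int g x c y' - ver_int g x c y - RtoC (y' - y) * g0) <= e * Rabs (y' - y).
Proof.
  intros Hy Hy' Hc Hb.
  (* Exchanging the coordinates reduces the claim to the horizontal case. *)
  set (g1 := fun z => g (Im z, Re z)).
  assert (E : forall d, ver_int g x c d = hor_int g1 x c d) by reflexivity.
  rewrite !E. apply hor_int_increment; auto.
  intros u H1 H2. apply Ccontinuous_eps. intros eps He.
  destruct (proj1 (Ccontinuous_eps g (x, u)) (Hc u H1 H2) eps He) as (d & Hd & H).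
  exists d; split; auto. intros w Hw. unfold g1. apply H.
  eapply Rle_lt_trans; [|apply Hw]. right.
  unfold Cmod, Cminus, Cplus, Copp, Re, Im; simpl. f_equal. ring.
Qed.

(** F integrates along the bottom side and then upwards; by Goursat it equals the integral up the
    left side and then across. The first form gives increments in y, the second increments in x. *)
Lemma primitive_rect (g : C -> C) (a b c d : R) :
  a <= b -> c <= d ->
  (forall x y, a <= x <= b -> c <= y <= d -> ex_derive g ((x, y) : C)) ->
  exists F : C -> C, forall z, a < Re z < b -> c < Im z < d -> is_derive F z (g z).
Proof.
  intros Hab Hcd Hg.
  assert (Hc : forall x y, a <= x <= b -> c <= y <= d -> continuous g (x, y))
    by (intros; apply C_ex_derive_continuous, Hg; auto).
  set (F := fun z => (hor_int g c a (Re z) + Ci * ver_int g (Re z) c (Im z))%C).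
  assert (E : forall x y, a <= x <= b -> c <= y <= d ->
     F (x, y) = (hor_int g y a x + Ci * ver_int g a c y)%C).
  { intros x y Hx Hy.
    assert (G := goursat_rect g a x c y ltac:(lra) ltac:(lra) ltac:(intros; apply Hg; lra)).
    unfold rect_int in G. unfold F; simpl. apply Ceq_minus. rewrite <- G. ring. }
  exists F. intros [x y] Hx Hy. simpl in Hx, Hy.
  apply C_is_derive_eps. intros eps He.
  destruct (proj1 (Ccontinuous_eps g (x, y)) (Hc x y ltac:(lra) ltac:(lra)) (eps / 2) ltac:(lra))
    as (dl & Hdl & Hcl).
  destruct (exists_pos_le_four (x - a) (b - x) (y - c) (d - y)) as (m & Hm & M1 & M2 & M3 & M4);
    try lra.
  exists (Rmin (dl / 2) m). split. apply Rmin_pos; lra.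
  intros [x' y'] Hw.
  assert (W1 := Rlt_le_trans _ _ _ Hw (Rmin_l _ _)).
  assert (W2 := Rlt_le_trans _ _ _ Hw (Rmin_r _ _)).
  assert (X0 := re_le_Cmod ((x', y') - (x, y))). assert (Y0 := Im_le_Cmod ((x', y') - (x, y))).
  rewrite Re_minus in X0. rewrite Im_minus in Y0.
  destruct (Re_Im_near _ _ _ (Rle_refl (Cmod ((x', y') - (x, y))))) as [X Y].
  simpl in X, Y, X0, Y0.
  set (h := Cmod ((x', y') - (x, y))) in *.
  assert (Hclose : forall u v, Rabs (u - x) < dl / 2 -> Rabs (v - y) < dl / 2 ->
     Cmod (g (u, v) - g (x, y)) <= eps / 2).
  { intros u v Hu Hv. left. apply Hcl. eapply Rle_lt_trans; [apply Cmod_le_Re_Im|].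
    rewrite Re_minus, Im_minus; simpl. lra. }
  assert (I1 := hor_int_increment g (g (x, y)) y a x x' (eps / 2) ltac:(lra) ltac:(lra)).
  assert (I2 := ver_int_increment g (g (x, y)) x' c y y' (eps / 2) ltac:(lra) ltac:(lra)).
  assert (BX : forall u, Rmin x x' <= u <= Rmax x x' -> Rabs (u - x) < dl / 2).
  { intros u. unfold Rmin, Rmax. destruct (Rle_dec x x'); intros; apply Rabs_lt_between; lra. }
  assert (BY : forall u, Rmin y y' <= u <= Rmax y y' -> Rabs (u - y) < dl / 2).
  { intros u. unfold Rmin, Rmax. destruct (Rle_dec y y'); intros; apply Rabs_lt_between; lra. }
  assert (Z : Rabs (y - y) < dl / 2) by (replace (y - y) with 0 by ring; rewrite Rabs_R0; lra).
  specialize (I1 ltac:(intros u U1 U2; apply Hc;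
     revert U2; unfold Rmax; destruct (Rle_dec x x'); lra)
    ltac:(intros u Hu; apply Hclose; [apply BX, Hu|apply Z])).
  specialize (I2 ltac:(intros u U1 U2; apply Hc;
     revert U2; unfold Rmax; destruct (Rle_dec y y'); lra)
    ltac:(intros u Hu; apply Hclose; [apply Rabs_lt_between; lra|apply BY, Hu])).
  replace (F (x', y') - F (x, y) - ((x', y') - (x, y)) * g (x, y))%C
    with ((hor_int g y a x' - hor_int g y a x - RtoC (x' - x) * g (x, y))
          + Ci * (ver_int g x' c y' - ver_int g x' c y - RtoC (y' - y) * g (x, y)))%C.
  2: { replace (F (x', y') - F (x, y))%C with ((F (x', y') - F (x', y)) + (F (x', y) - F (x, y)))%C by ring.
       rewrite (E x' y), (E x y) by lra. unfold F at 1.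
       assert (E' := E x' y ltac:(lra) ltac:(lra)). unfold F in E'. simpl in *.
       replace ((x', y') - (x, y))%C with (RtoC (x' - x) + Ci * RtoC (y' - y))%C
         by (unfold Cminus, Cplus, Copp, Cmult, Ci, RtoC; simpl; f_equal; ring).
       rewrite <- E'. ring_simplify.
       assert (E2 : (hor_int g c a x' + Ci * ver_int g x' c y = hor_int g y a x' + Ci * ver_int g a c y)%C) by exact E'.
       apply Ceq_minus. ring_simplify.
       replace (hor_int g y a x') with (hor_int g c a x' + Ci * ver_int g x' c y - Ci * ver_int g a c y)%C
         by (rewrite E2; ring). ring. }
  eapply Rle_trans; [apply Cmod_triangle|]. rewrite Cmod_mult, Cmod_Ci. nra.
Qed.

Lemma zero_derive_constant (f : C -> C) (z w : C) :
  (forall t, 0 <= t <= 1 -> is_derive f (z + t * (w - z))%C (RtoC 0)) -> f z = f w.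
Proof.
  intros H. symmetry. apply Ceq_minus, Cmod_eq_0, Rle_antisym; [|apply Cmod_ge_0].
  rewrite <- (Rmult_0_l (Cmod (w - z))).
  apply (Cmod_le_of_derive_bound f (fun _ => RtoC 0)).
  intros t Ht. split; auto. rewrite Cmod_0. lra.
Qed.

Lemma segment_convex (a b u v t : R) : a < u < b -> a < v < b -> 0 <= t <= 1 -> a < u + t * (v - u) < b.
Proof. intros. destruct (Rle_dec u v); nra. Qed.

Lemma Re_segment (z w : C) (t : R) : Re (z + t * (w - z)) = Re z + t * (Re w - Re z).
Proof. rewrite re_plus, re_scal_l, Re_minus. reflexivity. Qed.

Lemma Im_segment (z w : C) (t : R) : Im (z + t * (w - z)) = Im z + t * (Im w - Im z).
Proof. rewrite im_plus, im_scal_l, Im_minus. reflexivity. Qed.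

(** For a primitive F of L'/L the product L exp (- F) has derivative 0, so F plus a constant is a
    logarithm; the constant is fixed at p. *)
Lemma holomorphic_log_rect (L : C -> C) (p l0 : C) (a b c d : R) :
  (forall z, ex_derive L z) ->
  (forall z, a <= Re z <= b -> c <= Im z <= d -> L z <> 0%C) ->
  a < Re p < b -> c < Im p < d -> Cexp l0 = L p ->
  exists f : C -> C, f p = l0 /\
    forall z, a < Re z < b -> c < Im z < d ->
      is_derive f z (C_derive L z / L z)%C /\ Cexp (f z) = L z.
Proof.
  intros HL Hnz Hpx Hpy Hp.
  assert (HL' : forall z, ex_derive (C_derive L) z).
  { intros z. apply C_derive_ex_derive, Clocally_eps. exists 1. split; [lra|auto]. }
  assert (HD : forall z, is_derive L z (C_derive L z)) by (intros; apply C_derive_correct; auto).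
  destruct (primitive_rect (fun z => C_derive L z / L z)%C a b c d) as (F & HF); try lra.
  { intros x y Hx Hy. apply C_ex_derive_div; auto. }
  assert (DE : forall z, a < Re z < b -> c < Im z < d ->
     is_derive (fun z => L z * Cexp (- F z))%C z (RtoC 0)).
  { intros z Hx Hy.
    replace (RtoC 0) with (C_derive L z * Cexp (- F z)
       + L z * (- (C_derive L z / L z) * Cexp (- F z)))%C
      by (field; apply Hnz; lra).
    apply (C_is_derive_mult L (fun z => Cexp (- F z))%C); auto.
    apply (C_is_derive_comp Cexp (fun z => - F z)%C). apply C_is_derive_Cexp.
    apply C_is_derive_opp. auto. }
  exists (fun z => F z + (l0 - F p))%C. split; [ring|].
  intros z Hx Hy. split.
  - replace (C_derive L z / L z)%C with (C_derive L z / L z + 0)%C by ring.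
    apply (C_is_derive_plus F (fun _ => l0 - F p)%C); auto. apply C_is_derive_const.
  - assert (E : (L z * Cexp (- F z) = L p * Cexp (- F p))%C).
    { apply (zero_derive_constant (fun z => L z * Cexp (- F z))%C). intros t Ht.
      apply DE; rewrite ?Re_segment, ?Im_segment; apply segment_convex; auto. }
    replace (F z + (l0 - F p))%C with (F z + (l0 + (- F p)))%C by ring.
    rewrite !Cexp_plus, Hp, <- E, Cexp_opp. field. apply Cexp_neq_0.
Qed.

(** * Dirichlet characters and the growth of L *)

Lemma exp_monotone (x y : R) : x <= y -> exp x <= exp y.
Proof. intros [H| ->]; [left; apply exp_increasing, H|right; reflexivity]. Qed.

Lemma rcpow_Cexp (x : R) (s : C) : rcpow x s = Cexp (s * RtoC (ln x)).
Proof.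
  unfold rcpow, Cexp, Rpower. rewrite re_scal_r, im_scal_r.
  unfold Cmult, RtoC; simpl. f_equal; ring.
Qed.

Lemma Cmod_rcpow (x : R) (s : C) : Cmod (rcpow x s) = Rpower x (Re s).
Proof. rewrite rcpow_Cexp, Cmod_Cexp, re_scal_r. reflexivity. Qed.

Lemma rcpow_plus (x : R) (s w : C) : rcpow x (s + w) = (rcpow x s * rcpow x w)%C.
Proof. rewrite !rcpow_Cexp, <- Cexp_plus. f_equal. ring. Qed.

Lemma rcpow_opp (x : R) (s : C) : rcpow x (- s) = (/ rcpow x s)%C.
Proof. rewrite !rcpow_Cexp, <- Cexp_opp. f_equal. ring. Qed.

Lemma rcpow_neq_0 (x : R) (s : C) : rcpow x s <> 0%C.
Proof. rewrite rcpow_Cexp. apply Cexp_neq_0. Qed.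

Lemma rcpow_mult (x y : R) (s : C) :
  0 < x -> 0 < y -> rcpow (x * y) s = (rcpow x s * rcpow y s)%C.
Proof.
  intros Hx Hy. rewrite !rcpow_Cexp, <- Cexp_plus, ln_mult, RtoC_plus by auto. f_equal. ring.
Qed.

Lemma rcpow_1 (s : C) : rcpow 1 s = 1%C.
Proof. rewrite rcpow_Cexp, ln_1, <- Cexp_0. f_equal. ring. Qed.

Lemma rcpow_scal_nat (x : R) (k : nat) (s : C) : rcpow x (INR k * s) = (rcpow x s ^ k)%C.
Proof.
  induction k.
  - simpl. rewrite rcpow_Cexp, <- Cexp_0. f_equal. ring.
  - rewrite S_INR, RtoC_plus, Cpow_S, <- IHk, <- rcpow_plus. f_equal. ring.
Qed.

Lemma ex_derive_rcpow (x : R) (f : C -> C) (z : C) :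
  ex_derive f z -> ex_derive (fun w => rcpow x (f w)) z.
Proof.
  intros H. apply C_ex_derive_ext with (fun w => Cexp (f w * RtoC (ln x)))%C.
  - intros w. rewrite rcpow_Cexp. reflexivity.
  - auto with cder.
Qed.

Lemma ex_derive_rcpow_opp (x : R) (z : C) : ex_derive (fun s => rcpow x (- s)) z.
Proof. apply ex_derive_rcpow. exists (- (1))%C. apply C_is_derive_opp, C_is_derive_id. Qed.

Lemma INR_S_pos (n : nat) : 0 < INR (S n).
Proof. apply lt_0_INR; lia. Qed.

Lemma ln_succ_bounds (x : R) : 0 < x -> / (x + 1) <= ln (x + 1) - ln x <= / x.
Proof.
  intros Hx. rewrite <- ln_div by lra.
  assert (P : 0 < (x + 1) / x) by (apply Rdiv_lt_0_compat; lra).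
  split.
  - assert (E := exp_ineq1_le (- ln ((x + 1) / x))).
    rewrite exp_Ropp, exp_ln in E by auto.
    replace (/ ((x + 1) / x)) with (1 - / (x + 1)) in E by (field; lra). lra.
  - assert (E := exp_ineq1_le (ln ((x + 1) / x))). rewrite exp_ln in E by auto.
    replace ((x + 1) / x) with (1 + / x) in E at 2 by (field; lra). lra.
Qed.

(** Mean value inequality for u -> exp (- s u) between ln x and ln (x + 1), which are at most 1 / x
    apart. *)
Lemma rcpow_succ_diff (x : R) (s : C) :
  0 < x -> 0 <= Re s ->
  Cmod (rcpow x (- s) - rcpow (x + 1) (- s)) <= Cmod s * Rpower x (- (1 + Re s)).
Proof.
  intros Hx Hs. rewrite Cmod_minus_sym, !rcpow_Cexp.
  assert (L := ln_succ_bounds x Hx).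
  assert (L0 : 0 < / (x + 1)) by (apply Rinv_0_lt_compat; lra).
  eapply Rle_trans.
  apply (Cmod_le_of_derive_bound (fun u => Cexp (- s * u)%C) (fun u => - s * Cexp (- s * u))%C
    (RtoC (ln x)) (RtoC (ln (x + 1))) (Cmod s * Rpower x (- Re s))).
  - intros t Ht. set (u := (RtoC (ln x) + t * (RtoC (ln (x + 1)) - RtoC (ln x)))%C).
    assert (Eu : u = RtoC (ln x + t * (ln (x + 1) - ln x))).
    { unfold u. rewrite RtoC_plus, RtoC_mult, RtoC_minus. reflexivity. }
    split.
    + apply (C_is_derive_comp Cexp (fun u => - s * u)%C). apply C_is_derive_Cexp.
      apply C_is_derive_const_mul.
    + rewrite Cmod_mult, Cmod_opp. apply Rmult_le_compat_l. apply Cmod_ge_0.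
      rewrite Cmod_Cexp, Eu, re_scal_r, re_opp. unfold Rpower.
      apply exp_monotone.
      assert (0 <= Re s * (t * (ln (x + 1) - ln x))).
      { apply Rmult_le_pos; [lra|]. apply Rmult_le_pos; lra. }
      lra.
  - rewrite <- RtoC_minus, Cmod_R, Rabs_pos_eq by lra.
    rewrite Rmult_assoc. apply Rmult_le_compat_l. apply Cmod_ge_0.
    replace (- (1 + Re s)) with (- Re s + - (1)) by ring.
    rewrite Rpower_plus, Rpower_Ropp, (Rpower_Ropp x 1), Rpower_1 by auto.
    rewrite <- Rpower_Ropp. apply Rmult_le_compat_l; [|lra].
    left. apply exp_pos.
Qed.

Lemma pos_series_bounded (b : nat -> R) (M : R) :
  (forall n, 0 <= b n) -> (forall n, sum_n b n <= M) -> exists l, is_series b l /\ l <= M.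
Proof.
  intros Hb HM.
  destruct (ex_finite_lim_seq_incr (sum_n b) M) as (S & HS); auto.
  - intros n. rewrite sum_Sn. change (sum_n b n <= sum_n b n + b (S n)). specialize (Hb (S n)). lra.
  - exists S. split. exact HS.
    apply (is_lim_seq_le (sum_n b) (fun _ => M) S M HM HS (is_lim_seq_const M)).
Qed.

(** Integral test in telescoping form: the right side is the integral of u^(-1-d) over
    [x, x + 1]. *)
Lemma Rpower_telescope (x d : R) :
  0 < x -> 0 < d -> Rpower (x + 1) (- (1 + d)) <= (Rpower x (- d) - Rpower (x + 1) (- d)) / d.
Proof.
  intros Hx Hd. assert (L := proj1 (ln_succ_bounds x Hx)).
  assert (E : Rpower x (- d) = Rpower (x + 1) (- d) * exp (d * (ln (x + 1) - ln x))).
  { unfold Rpower. rewrite <- exp_plus. f_equal. ring. }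
  replace (- (1 + d)) with (- d + - (1)) by ring.
  rewrite Rpower_plus, (Rpower_Ropp _ 1), Rpower_1, E by lra.
  set (p := Rpower (x + 1) (- d)). assert (Hp : 0 < p) by apply exp_pos.
  assert (E2 := exp_ineq1_le (d * (ln (x + 1) - ln x))).
  replace ((p * exp (d * (ln (x + 1) - ln x)) - p) / d)
    with (p * ((exp (d * (ln (x + 1) - ln x)) - 1) / d)) by (field; lra).
  apply Rmult_le_compat_l; [lra|].
  apply Rmult_le_reg_r with d; auto. unfold Rdiv. rewrite Rmult_assoc, Rinv_l, Rmult_1_r by lra.
  nra.
Qed.

Lemma pseries_tail (N : nat) (d : R) :
  (1 <= N)%nat -> 0 < d ->
  exists l, is_series (fun k => Rpower (INR (S (N + k))) (- (1 + d))) l /\ l <= Rpower (INR N) (- d) / d.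
Proof.
  intros HN Hd. apply pos_series_bounded.
  - intros k. left. apply exp_pos.
  - assert (H : forall n, sum_n (fun k => Rpower (INR (S (N + k))) (- (1 + d))) n
        <= (Rpower (INR N) (- d) - Rpower (INR (S (N + n))) (- d)) / d).
    { assert (T : forall k, Rpower (INR (S (N + k))) (- (1 + d))
         <= (Rpower (INR (N + k)) (- d) - Rpower (INR (S (N + k))) (- d)) / d).
      { intros k. rewrite S_INR. apply Rpower_telescope; auto. apply lt_0_INR; lia. }
      induction n.
      - rewrite sum_O. specialize (T O). rewrite Nat.add_0_r in *. exact T.
      - rewrite sum_Sn. eapply Rle_trans; [apply Rplus_le_compat; [apply IHn|apply T]|].
        rewrite Nat.add_succ_r. right. field. lra. }
    intros n. eapply Rle_trans; [apply H|].
    apply Rmult_le_compat_r. left; apply Rinv_0_lt_compat, Hd.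
    assert (0 < Rpower (INR (S (N + n))) (- d)) by apply exp_pos. lra.
Qed.

Lemma sum_inv_sqrt (N : nat) : sum_n (fun n => Rpower (INR (S n)) (- / 2)) N <= 2 * sqrt (INR (S N)).
Proof.
  assert (E : forall n, Rpower (INR (S n)) (- / 2) = / sqrt (INR (S n))).
  { intros n. rewrite Rpower_Ropp, Rpower_sqrt; auto. apply INR_S_pos. }
  induction N.
  - rewrite sum_O, E. simpl. rewrite sqrt_1. lra.
  - rewrite sum_Sn. change (plus ?a ?b) with (a + b). rewrite E.
    set (a := sqrt (INR (S N))) in *. set (b := sqrt (INR (S (S N)))).
    assert (Ha : 0 < a) by apply sqrt_lt_R0, INR_S_pos.
    assert (Hb : 0 < b) by apply sqrt_lt_R0, INR_S_pos.
    assert (Ea : a * a = INR (S N)) by (apply sqrt_sqrt; left; apply INR_S_pos).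
    assert (Eb : b * b = INR (S N) + 1) by (rewrite <- S_INR; apply sqrt_sqrt; left; apply INR_S_pos).
    (* As b^2 - a^2 = 1, the difference b - a equals 1 / (a + b), which is at least 1 / (2 b). *)
    assert (/ b <= 2 * (b - a)).
    { apply Rmult_le_reg_l with b; auto. rewrite Rinv_r by lra.
      assert (a < b) by nra. nra. }
    lra.
Qed.

Definition Clist_sum (l : list C) : C := fold_right Cplus (RtoC 0) l.

Lemma Clist_sum_app (l l' : list C) : Clist_sum (l ++ l') = (Clist_sum l + Clist_sum l')%C.
Proof. induction l; unfold Clist_sum in *; simpl. ring. rewrite IHl. ring. Qed.

Lemma Clist_sum_perm (l l' : list C) : Permutation l l' -> Clist_sum l = Clist_sum l'.
Proof. induction 1; simpl; try congruence. ring. Qed.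

Lemma sum_n_list (f : nat -> C) (n : nat) : sum_n f n = Clist_sum (map f (seq 0 (S n))).
Proof.
  induction n.
  - rewrite sum_O. simpl. ring.
  - rewrite sum_Sn, IHn, (seq_S (S n)), map_app, Clist_sum_app.
    change (plus ?a ?b) with (a + b)%C. f_equal. unfold Clist_sum. simpl. ring.
Qed.

(** * Values and sums of Dirichlet characters *)

Section Character.
Variables (q : Z) (chi : Z -> C).
Hypotheses (Hq : (2 <= q)%Z) (Hchi : is_dirichlet_character q chi).

Lemma chi_mult (m n : Z) : chi (m * n) = (chi m * chi n)%C.
Proof. apply Hchi. Qed.

Lemma chi_periodic (n k : Z) : chi (n + k * q) = chi n.
Proof.
  assert (P : forall k : nat, forall n, chi (n + Z.of_nat k * q) = chi n).
  { clear n k. intros k; induction k; intros n.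
    - f_equal. lia.
    - rewrite <- (IHk n), <- (proj1 Hchi (n + Z.of_nat k * q)%Z). f_equal. lia. }
  destruct (Z_le_dec 0 k).
  - rewrite <- (P (Z.to_nat k) n). f_equal. lia.
  - rewrite <- (P (Z.to_nat (- k)) (n + k * q)%Z). f_equal. lia.
Qed.

Lemma chi_mod (n : Z) : chi (n mod q) = chi n.
Proof.
  rewrite <- (chi_periodic (n mod q) (n / q)). f_equal.
  rewrite (Z.div_mod n q) at 3 by lia. lia.
Qed.

Lemma chi_1 : chi 1 = 1%C.
Proof.
  assert (H : chi 1 <> 0%C) by (apply Hchi, rel_prime_1).
  assert (E := chi_mult 1 1). simpl in E.
  rewrite <- (Cmult_1_r (chi 1)) in E at 1.
  apply Ceq_minus. apply NNPP. intros N.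
  assert (chi 1 * (1 - chi 1) = 0)%C.
  { replace (chi 1 * (1 - chi 1))%C with (chi 1 * 1 - chi 1 * chi 1)%C by ring. rewrite <- E. ring. }
  apply (Cmult_neq_0 (chi 1) (1 - chi 1)); auto.
  intros E1. apply N. replace (chi 1 - 1)%C with (- (1 - chi 1))%C by ring. rewrite E1. ring.
Qed.

Lemma chi_bounded : exists B, forall n, Cmod (chi n) <= B.
Proof.
  assert (F : forall N : nat, exists B, 0 <= B /\ forall n, (0 <= n < Z.of_nat N)%Z -> Cmod (chi n) <= B).
  { induction N.
    - exists 0. split; [lra|]. intros; lia.
    - destruct IHN as (B & HB & H). exists (B + Cmod (chi (Z.of_nat N))).
      generalize (Cmod_ge_0 (chi (Z.of_nat N))). intros. split; [lra|].
      intros n Hn. destruct (Z.eq_dec n (Z.of_nat N)) as [->|]; [lra|].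
      specialize (H n ltac:(lia)). lra. }
  destruct (F (Z.to_nat q)) as (B & _ & H). exists B. intros n.
  rewrite <- chi_mod. apply H. rewrite Z2Nat.id by lia. apply Z.mod_pos_bound; lia.
Qed.

Lemma chi_pow (n : Z) (k : nat) : chi (n ^ Z.of_nat k) = (chi n ^ k)%C.
Proof.
  induction k. simpl. apply chi_1.
  rewrite Nat2Z.inj_succ, Z.pow_succ_r, chi_mult, IHk by lia. reflexivity.
Qed.

(* The powers of chi n are values of chi, hence bounded. *)
Lemma Cmod_chi_le_1 (n : Z) : Cmod (chi n) <= 1.
Proof.
  destruct chi_bounded as (B & HB). apply Rnot_lt_le. intros H.
  set (x := Cmod (chi n) - 1). assert (Hx : 0 < x) by (unfold x; lra).
  destruct (INR_archimed x B Hx) as (k & Hk).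
  assert (P := poly k x Hx). replace (1 + x) with (Cmod (chi n)) in P by (unfold x; ring).
  rewrite <- Cmod_pow, <- chi_pow in P. specialize (HB (n ^ Z.of_nat k)%Z). lra.
Qed.

Definition residues : list Z := map Z.of_nat (seq 0 (Z.to_nat q)).

Lemma In_residues (z : Z) : In z residues <-> (0 <= z < q)%Z.
Proof.
  unfold residues. rewrite in_map_iff. split.
  - intros (k & <- & Hk). apply in_seq in Hk. lia.
  - intros Hz. exists (Z.to_nat z). rewrite in_seq. lia.
Qed.

Lemma residues_mult_perm (a : Z) :
  rel_prime a q -> Permutation (map (fun z => (a * z) mod q)%Z residues) residues.
Proof.
  intros Ha. apply Permutation_map_same_l.
  - apply FinFun.Injective_map_NoDup_in.
    + intros x y Hx Hy E. apply In_residues in Hx, Hy.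
      assert (D : (q | a * (x - y))%Z).
      { apply Z.mod_divide; [lia|]. rewrite Z.mul_sub_distr_l, Zminus_mod, E, Z.sub_diag.
        apply Z.mod_0_l; lia. }
      apply Gauss in D; [|apply rel_prime_sym, Ha].
      destruct D as (k & Hk). assert (k = 0%Z) by nia. lia.
    + apply FinFun.Injective_map_NoDup. intros x y. lia. apply seq_NoDup.
  - intros z Hz. apply in_map_iff in Hz. destruct Hz as (x & <- & _).
    apply In_residues, Z.mod_pos_bound. lia.
Qed.

(** Multiplication by a permutes the residues, so the sum S satisfies S = chi(a) S. *)
Lemma chi_sum_residues : (exists a, rel_prime a q /\ chi a <> 1%C) -> Clist_sum (map chi residues) = 0%C.
Proof.
  intros (a & Ha & Hca). set (S := Clist_sum (map chi residues)).
  assert (E : S = (chi a * S)%C).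
  { unfold S at 1. rewrite <- (Clist_sum_perm _ _ (Permutation_map chi (residues_mult_perm a Ha))).
    rewrite map_map. unfold S. generalize residues. intros l. induction l; simpl. ring.
    rewrite IHl, chi_mod, chi_mult. ring. }
  apply NNPP. intros N. apply (Cmult_neq_0 (chi a - 1) S); auto.
  - intros E1. apply Hca, Ceq_minus, E1.
  - replace ((chi a - 1) * S)%C with (chi a * S - S)%C by ring. rewrite <- E. ring.
Qed.

Lemma chi_block_sum (m : Z) :
  (exists a, rel_prime a q /\ chi a <> 1%C) ->
  Clist_sum (map (fun j => chi (m + Z.of_nat j)) (seq 0 (Z.to_nat q))) = 0%C.
Proof.
  intros Ha.
  assert (Shift : forall m, Clist_sum (map (fun j => chi (m + Z.of_nat j)) (seq 0 (Z.to_nat q)))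
    = Clist_sum (map (fun j => chi (m + 1 + Z.of_nat j)) (seq 0 (Z.to_nat q)))).
  { clear m. intros m. assert (Eq : Z.to_nat q = S (Z.to_nat (q - 1))) by lia. rewrite Eq.
    change (seq 0 (S (Z.to_nat (q - 1)))) with (0 :: seq 1 (Z.to_nat (q - 1)))%nat at 1.
    rewrite seq_S, map_app, Clist_sum_app. unfold Clist_sum at 1 3. simpl.
    fold (Clist_sum (map (fun j => chi (m + Z.of_nat j)) (seq 1 (Z.to_nat (q - 1))))).
    replace (m + 1 + Z.of_nat (Z.to_nat (q - 1)))%Z with (m + 0 + q)%Z by lia.
    rewrite (proj1 Hchi).
    replace (map (fun j => chi (m + Z.of_nat j)) (seq 1 (Z.to_nat (q - 1))))
      with (map (fun j => chi (m + 1 + Z.of_nat j)) (seq 0 (Z.to_nat (q - 1)))). ring.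
    rewrite <- seq_shift, map_map. apply map_ext. intros j. f_equal. lia. }
  assert (P : forall k : nat, forall m, Clist_sum (map (fun j => chi (m + Z.of_nat j)) (seq 0 (Z.to_nat q)))
    = Clist_sum (map (fun j => chi (m + Z.of_nat k + Z.of_nat j)) (seq 0 (Z.to_nat q)))).
  { clear m. intros k; induction k; intros m.
    - f_equal. apply map_ext. intros j. f_equal. lia.
    - rewrite IHk, Shift. f_equal. apply map_ext. intros j. f_equal. lia. }
  assert (Z0 : Clist_sum (map (fun j => chi (0 + Z.of_nat j)) (seq 0 (Z.to_nat q))) = 0%C).
  { rewrite <- (chi_sum_residues Ha). unfold residues. rewrite map_map. reflexivity. }
  destruct (Z_le_dec 0 m).
  - rewrite <- Z0, (P (Z.to_nat m) 0%Z). f_equal. apply map_ext. intros j. f_equal. lia.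
  - rewrite (P (Z.to_nat (- m)) m). rewrite <- Z0. f_equal. apply map_ext. intros j. f_equal. lia.
Qed.

(** Blocks of q consecutive values sum to 0 and are removed until at most q terms, each of modulus
    at most 1, remain. *)
Lemma Cmod_chi_interval_sum (n : nat) (m : Z) :
  (exists a, rel_prime a q /\ chi a <> 1%C) ->
  Cmod (Clist_sum (map (fun j => chi (m + Z.of_nat j)) (seq 0 n))) <= IZR q.
Proof.
  intros Ha. revert m. induction n as [n IH] using (well_founded_induction lt_wf). intros m.
  destruct (le_lt_dec n (Z.to_nat q)) as [Hn|Hn].
  - apply Rle_trans with (INR n).
    + clear IH Hn. induction n.
      * simpl. rewrite Cmod_0. lra.
      * rewrite seq_S, map_app, Clist_sum_app, S_INR.
        eapply Rle_trans; [apply Cmod_triangle|]. apply Rplus_le_compat; auto.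
        simpl. replace (chi (m + Z.of_nat n) + 0)%C with (chi (m + Z.of_nat n)) by ring.
        apply Cmod_chi_le_1.
    + rewrite INR_IZR_INZ. apply IZR_le. lia.
  - replace n with (Z.to_nat q + (n - Z.to_nat q))%nat by lia.
    rewrite seq_app, map_app, Clist_sum_app, chi_block_sum by auto.
    rewrite Cplus_0_l, Nat.add_0_l.
    replace (map (fun j => chi (m + Z.of_nat j)) (seq (Z.to_nat q) (n - Z.to_nat q)))
      with (map (fun j => chi (m + q + Z.of_nat j)) (seq 0 (n - Z.to_nat q))).
    + apply IH. lia.
    + assert (Sh : forall k i, map (fun j => chi (m + q + Z.of_nat j)) (seq i k)
        = map (fun j => chi (m + Z.of_nat j)) (seq (i + Z.to_nat q) k)).
      { intros k; induction k; intros i; simpl; auto.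
        f_equal. f_equal. lia. apply (IHk (S i)). }
      apply Sh.
Qed.
End Character.

(** A character equal to 1 at every integer coprime to q would be induced from the modulus 1. *)
Lemma primitive_nontrivial (q : Z) (chi : Z -> C) :
  (2 <= q)%Z -> is_primitive_character q chi -> exists a, rel_prime a q /\ chi a <> 1%C.
Proof.
  intros Hq [Hc Hp]. apply NNPP. intros N.
  apply (Hp 1%Z); [lia|apply Z.divide_1_l|].
  exists (fun _ => RtoC 1). split.
  - split; [auto|split].
    + intros; ring.
    + intros n; split.
      * intros _. apply rel_prime_sym, rel_prime_1.
      * intros _ E. apply RtoC_inj in E. lra.
  - intros n Hn. apply NNPP. intros E. apply N. eauto.
Qed.

(* Goals about sum_n are equalities in the carrier of a canonical structure,
   which ring does not recognise as C. *)
Local Ltac Cring := match goal with |- @eq _ ?a ?b => change (@eq C a b) end; ring.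

(** Choice makes the sum a total function; its value is arbitrary when the series diverges. *)
Definition Cseries (a : nat -> C) : C :=
  epsilon (inhabits (RtoC 0)) (fun l => is_series a l).

Lemma Cseries_correct (a : nat -> C) : (exists l : C, is_series a l) -> is_series a (Cseries a).
Proof. exact (epsilon_spec (inhabits (RtoC 0)) (fun l => is_series a l)). Qed.

Lemma Cseries_unique (a : nat -> C) (l : C) : is_series a l -> Cseries a = l.
Proof. intros H. apply (C_is_series_unique a); auto. apply Cseries_correct. eauto. Qed.

Lemma C_ex_derive_sum_n (f : nat -> C -> C) (n : nat) (z : C) :
  (forall k, ex_derive (f k) z) -> ex_derive (fun w => sum_n (fun k => f k w) n) z.
Proof.
  intros H. induction n.
  - apply C_ex_derive_ext with (f O); auto.
    intros w. rewrite sum_O. reflexivity.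
  - apply C_ex_derive_ext with (fun w => sum_n (fun k => f k w) n + f (S n) w)%C; auto with cder.
    intros w. rewrite sum_Sn. reflexivity.
Qed.

(** * Partial summation and the size of L *)

Section LBound.
Variables (q : Z) (chi : Z -> C) (L : C -> C).
Hypotheses (Hq : (2 <= q)%Z) (Hchi : is_primitive_character q chi) (HL : is_dirichlet_L chi L).

Lemma L_ex_derive (z : C) : ex_derive L z.
Proof.
  assert (H := proj1 HL z I). apply Clocally_eps in H. destruct H as (d & Hd & H).
  apply H. rewrite Cmod_self. auto.
Qed.

Definition Lterm (s : C) (n : nat) : C := (chi (Z.of_nat (S n)) * rcpow (INR (S n)) (- s))%C.

(** Starts at the integer M + 2, because [sum_n (Lterm s) M] ends with M + 1. *)
Definition tail_sum (M k : nat) : C := sum_n (fun j => chi (Z.of_nat (S (S M + j)))) k.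

Definition abel_term (M : nat) (s : C) (k : nat) : C :=
  (tail_sum M k * (rcpow (INR (S (S M + k))) (- s) - rcpow (INR (S (S M + k)) + 1) (- s)))%C.

Lemma Cmod_partial_char_sum (M k : nat) :
  Cmod (tail_sum M k) <= IZR q.
Proof.
  unfold tail_sum. rewrite sum_n_list.
  replace (map (fun j => chi (Z.of_nat (S (S M + j)))) (seq 0 (S k)))
    with (map (fun j => chi (Z.of_nat (S (S M)) + Z.of_nat j)) (seq 0 (S k))).
  - apply Cmod_chi_interval_sum; auto. apply Hchi. apply (primitive_nontrivial q); auto.
  - apply map_ext. intros j. f_equal. lia.
Qed.

Lemma Cmod_abel_term (M : nat) (s : C) (k : nat) (d : R) :
  0 <= d <= Re s ->
  Cmod (abel_term M s k) <= IZR q * Cmod s * Rpower (INR (S (S M + k))) (- (1 + d)).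
Proof.
  intros Hs. unfold abel_term. rewrite Cmod_mult, Rmult_assoc.
  apply Rmult_le_compat; try apply Cmod_ge_0. apply Cmod_partial_char_sum.
  eapply Rle_trans; [apply rcpow_succ_diff; [apply INR_S_pos|lra]|].
  apply Rmult_le_compat_l. apply Cmod_ge_0.
  apply Rle_Rpower; [|lra]. change 1 with (INR 1). apply le_INR. lia.
Qed.

(** Summation by parts; the last term is the boundary contribution, which tends to 0 as K grows when
    Re s > 1. *)
Lemma abel_partial_sum (M : nat) (s : C) (K : nat) :
  (sum_n (abel_term M s) K = sum_n (Lterm s) (S M + K) - sum_n (Lterm s) M
    - tail_sum M K * rcpow (INR (S (S M + K)) + 1) (- s))%C.
Proof.
  induction K.
  - rewrite Nat.add_0_r, !sum_O, sum_Sn. unfold abel_term, tail_sum, Lterm.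
    change (plus ?a ?b) with (a + b)%C. rewrite !sum_O, !Nat.add_0_r. Cring.
  - rewrite Nat.add_succ_r, (sum_Sn (abel_term M s)), IHK, (sum_Sn (Lterm s) (S M + K)).
    unfold abel_term, tail_sum. rewrite (sum_Sn (fun j => chi (Z.of_nat (S (S M + j)))) K).
    assert (E : Lterm s (S (S M + K))
      = (chi (Z.of_nat (S (S (S M + K)))) * rcpow (INR (S (S M + K)) + 1) (- s))%C)
      by (unfold Lterm; rewrite (S_INR (S (S M + K))); reflexivity).
    rewrite Nat.add_succ_r, E, (S_INR (S (S M + K))).
    repeat match goal with |- context [@plus ?G ?a ?b] => change (@plus G a b) with (Cplus a b) end.
    Cring.
Qed.

Lemma abel_series_right (M : nat) (s : C) :
  1 < Re s -> is_series (abel_term M s) (L s - sum_n (Lterm s) M)%C.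
Proof.
  intros Hs. assert (HS := proj2 HL s Hs). fold (Lterm s) in HS.
  apply C_is_series_eps. intros eps He.
  destruct (proj1 (C_is_series_eps _ _) HS (eps / 2) ltac:(lra)) as (N1 & HN1).
  assert (Hq0 : 0 < IZR q) by (apply IZR_lt; lia).
  destruct (INR_archimed (eps / 2) (IZR q) ltac:(lra)) as (N2 & HN2).
  exists (Nat.max N1 N2). intros n Hn.
  rewrite abel_partial_sum.
  set (A := tail_sum M n).
  replace (sum_n (Lterm s) (S M + n) - sum_n (Lterm s) M
      - A * rcpow (INR (S (S M + n)) + 1) (- s) - (L s - sum_n (Lterm s) M))%C
    with ((sum_n (Lterm s) (S M + n) - L s) - A * rcpow (INR (S (S M + n)) + 1) (- s))%C by ring.
  eapply Rle_lt_trans; [apply Cmod_triangle_minus|].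
  assert (H1 : Cmod (sum_n (Lterm s) (S M + n) - L s) < eps / 2) by (apply HN1; lia).
  assert (H2 : Cmod (A * rcpow (INR (S (S M + n)) + 1) (- s)) <= eps / 2).
  { rewrite Cmod_mult, Cmod_rcpow, re_opp, <- S_INR.
    set (x := INR (S (S (S M + n)))).
    assert (Hx : 1 <= x) by (change 1 with (INR 1); apply le_INR; lia).
    apply Rle_trans with (IZR q * / x).
    - apply Rmult_le_compat. apply Cmod_ge_0. left; apply exp_pos.
      apply Cmod_partial_char_sum.
      rewrite <- (Rpower_1 x) at 2 by lra. rewrite <- Rpower_Ropp. apply Rle_Rpower; lra.
    - apply Rmult_le_reg_r with x; [lra|]. rewrite Rmult_assoc, Rinv_l, Rmult_1_r by lra.
      assert (INR N2 <= x) by (apply le_INR; lia). nra. }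
  lra.
Qed.

(** With d = Re s / 2 the terms near s are at most q (|s| + d) n^(-1-d), a summable bound
    independent of the point. *)
Lemma abel_series_ex_derive (M : nat) (s : C) :
  0 < Re s -> ex_derive (fun s => Cseries (abel_term M s)) s.
Proof.
  intros Hs. set (d := Re s / 2).
  assert (Hd : 0 < d) by (unfold d; lra).
  destruct (pseries_tail (S M) d ltac:(lia) Hd) as (l & Hl & _).
  assert (Near : forall u, Cmod (u - s) < d -> d <= Re u /\ Cmod u <= Cmod s + d).
  { intros u Hu. destruct (Re_Im_near u s d ltac:(lra)).
    assert (T := Cmod_triangle_inv u s). unfold d in *. lra. }
  assert (Hq0 : 0 < IZR q) by (apply IZR_lt; lia).
  assert (Bd : forall u k, Cmod (u - s) < d ->
    Cmod (abel_term M u k) <= IZR q * (Cmod s + d) * Rpower (INR (S (S M + k))) (- (1 + d))).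
  { intros u k Hu. destruct (Near u Hu).
    eapply Rle_trans; [apply (Cmod_abel_term M u k d); lra|].
    apply Rmult_le_compat_r. left; apply exp_pos. apply Rmult_le_compat_l; lra. }
  assert (Maj : ex_series (fun k => IZR q * (Cmod s + d) * Rpower (INR (S (S M + k))) (- (1 + d)))).
  { exists (IZR q * (Cmod s + d) * l).
    exact (is_series_scal (IZR q * (Cmod s + d)) (fun k => Rpower (INR (S (S M + k))) (- (1 + d))) l Hl). }
  assert (Dt : forall k u, ex_derive (fun u => abel_term M u k) u).
  { intros k u. unfold abel_term. apply C_ex_derive_mult; [apply C_ex_derive_const|].
    apply C_ex_derive_minus; apply ex_derive_rcpow_opp. }
  destruct (weierstrass_series (fun k u => abel_term M u k) (fun s => Cseries (abel_term M s))
    (fun k => C_derive (fun u => abel_term M u k) s)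
    (fun k => IZR q * (Cmod s + d) * Rpower (INR (S (S M + k))) (- (1 + d))) s d) as (l' & _ & H).
  - auto.
  - intros k u Hu. split; auto.
  - auto.
  - intros u Hu. apply Cseries_correct.
    apply (C_ex_series_le _ (fun k => IZR q * (Cmod s + d) * Rpower (INR (S (S M + k))) (- (1 + d)))); auto.
  - intros k. apply C_derive_correct; auto.
  - exists l'. auto.
Qed.

Lemma L_abel (M : nat) (s : C) :
  0 < Re s -> L s = (sum_n (Lterm s) M + Cseries (abel_term M s))%C.
Proof.
  intros Hs.
  (* The disc about s + 2 contains s and stays in Re u >= Re s / 2; within distance 1 of its centre
     Re u > 1, where the two sides are known to agree. *)
  apply (identity_theorem_disc L (fun s => sum_n (Lterm s) M + Cseries (abel_term M s))%C
    (s + 2)%C s 1 (2 + Re s / 2)); try lra.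
  - intros u Hu. split. apply L_ex_derive.
    destruct (Re_Im_near _ _ _ Hu) as [R1 _]. rewrite re_plus, re_RtoC in R1.
    apply C_ex_derive_plus.
    + apply (C_ex_derive_sum_n (fun n s => Lterm s n)). intros n. unfold Lterm.
      apply C_ex_derive_mult; [apply C_ex_derive_const|].
      apply ex_derive_rcpow_opp.
    + apply abel_series_ex_derive. lra.
  - intros u Hu. destruct (Re_Im_near _ _ _ (Rlt_le _ _ Hu)) as [R1 _].
    rewrite re_plus, re_RtoC in R1.
    rewrite (Cseries_unique _ _ (abel_series_right M u ltac:(lra))). ring.
  - replace (s - (s + 2))%C with (- (RtoC 2))%C by ring.
    rewrite Cmod_opp, Cmod_R, Rabs_pos_eq by lra. lra.
Qed.

(** The integers up to M + 1 are estimated by the sum of n^(-1/2), the rest by the Abel series with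
    exponent 3/2. *)
Lemma Cmod_L_split (M : nat) (s : C) :
  / 2 <= Re s -> Cmod (L s) <= 2 * sqrt (INR (S M)) + 2 * IZR q * Cmod s / sqrt (INR (S M)).
Proof.
  intros Hs. rewrite (L_abel M s) by lra.
  eapply Rle_trans; [apply Cmod_triangle|]. apply Rplus_le_compat.
  - eapply Rle_trans; [|apply sum_inv_sqrt]. apply Cmod_sum_n_le. intros k _.
    unfold Lterm. rewrite Cmod_mult, Cmod_rcpow, re_opp.
    rewrite <- (Rmult_1_l (Rpower _ (- / 2))).
    apply Rmult_le_compat. apply Cmod_ge_0. left; apply exp_pos.
    apply (Cmod_chi_le_1 q); auto. apply Hchi.
    apply Rle_Rpower; [|lra]. change 1 with (INR 1). apply le_INR. lia.
  - destruct (pseries_tail (S M) (/ 2) ltac:(lia) ltac:(lra)) as (l & Hl & Bl).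
    assert (Hq0 : 0 < IZR q) by (apply IZR_lt; lia).
    assert (Hl' := is_series_scal (IZR q * Cmod s) _ _ Hl).
    apply Rle_trans with (IZR q * Cmod s * l).
    + apply (Cmod_series_le (abel_term M s)
        (fun k => IZR q * Cmod s * Rpower (INR (S (S M + k))) (- (1 + / 2)))); auto.
      * intros k. apply Cmod_abel_term. lra.
      * apply Cseries_correct.
        apply (C_ex_series_le _ (fun k => IZR q * Cmod s * Rpower (INR (S (S M + k))) (- (1 + / 2)))).
        intros k. apply Cmod_abel_term. lra. eexists; exact Hl'.
    + rewrite Rpower_Ropp, Rpower_sqrt in Bl by apply INR_S_pos.
      replace (2 * IZR q * Cmod s / sqrt (INR (S M)))
        with (IZR q * Cmod s * (/ sqrt (INR (S M)) / / 2)).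
      * apply Rmult_le_compat_l; auto. apply Rmult_le_pos; [lra|apply Cmod_ge_0].
      * field. apply Rgt_not_eq, sqrt_lt_R0, INR_S_pos.
Qed.

Lemma nat_ceil (x : R) : 0 <= x -> exists M : nat, x <= INR (S M) <= x + 1.
Proof.
  intros Hx. destruct (archimed x) as [H1 H2].
  assert (0 < up x)%Z by (apply lt_IZR; lra).
  exists (Z.to_nat (up x - 1)). rewrite INR_IZR_INZ.
  replace (Z.of_nat (S (Z.to_nat (up x - 1)))) with (up x) by lia. lra.
Qed.

(** The two terms of the split balance when M + 1 is about q |s|. *)
Lemma Cmod_L_le (s : C) : / 2 <= Re s -> Cmod (L s) <= 4 * sqrt (IZR q * Cmod s + 1).
Proof.
  intros Hs.
  assert (Hq0 : 0 < IZR q) by (apply IZR_lt; lia).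
  assert (H0 : 0 <= IZR q * Cmod s) by (apply Rmult_le_pos; [lra|apply Cmod_ge_0]).
  destruct (nat_ceil _ H0) as (M & H1 & H2).
  eapply Rle_trans; [apply (Cmod_L_split M s Hs)|].
  assert (P := sqrt_lt_R0 _ (INR_S_pos M)).
  assert (E := sqrt_sqrt (INR (S M)) ltac:(left; apply INR_S_pos)).
  assert (2 * IZR q * Cmod s / sqrt (INR (S M)) <= 2 * sqrt (INR (S M))).
  { apply Rmult_le_reg_r with (sqrt (INR (S M))); auto.
    unfold Rdiv. rewrite Rmult_assoc, Rinv_l by lra. nra. }
  assert (sqrt (INR (S M)) <= sqrt (IZR q * Cmod s + 1)) by (apply sqrt_le_1; lra).
  lra.
Qed.
End LBound.

(** * The Euler product *)

Definition Lam_term (z : C) (k : nat) : C := (z ^ S k / RtoC (INR (S k)))%C.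
(** The branch of - log (1 - z) on the unit disc that vanishes at 0; the series index is shifted to
    start at the first power. *)
Definition Lam (z : C) : C := Cseries (Lam_term z).

Lemma INR_S_neq_0 (k : nat) : RtoC (INR (S k)) <> 0%C.
Proof. intros E. apply RtoC_inj in E. generalize (INR_S_pos k). lra. Qed.

Lemma Cmod_Lam_term (z : C) (k : nat) : Cmod (Lam_term z k) = Cmod z ^ S k / INR (S k).
Proof.
  unfold Lam_term. rewrite Cmod_div, Cmod_pow, Cmod_R, Rabs_pos_eq; auto using INR_S_neq_0.
  left; apply INR_S_pos.
Qed.

Lemma div_INR_S_le (x : R) (k : nat) : 0 <= x -> x / INR (S k) <= x.
Proof.
  intros Hx. rewrite <- (Rmult_1_r x) at 2. apply Rmult_le_compat_l; auto.
  rewrite <- Rinv_1. apply Rinv_le_contravar; [lra|].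
  change 1 with (INR 1). apply le_INR. lia.
Qed.

Lemma geom_series_S (x : R) : 0 <= x < 1 -> is_series (fun k => x ^ S k) (x / (1 - x)).
Proof.
  intros Hx. apply (is_series_scal x (fun k => x ^ k) (/ (1 - x))).
  apply is_series_geom. rewrite Rabs_pos_eq; lra.
Qed.

Lemma Cmod_Lam_term_le (z : C) (k : nat) : Cmod (Lam_term z k) <= Cmod z ^ S k.
Proof. rewrite Cmod_Lam_term. apply div_INR_S_le, pow_le, Cmod_ge_0. Qed.

Lemma Lam_series (z : C) : Cmod z < 1 -> is_series (Lam_term z) (Lam z).
Proof.
  intros Hz. apply Cseries_correct, (C_ex_series_le _ (fun k => Cmod z ^ S k)).
  - intros k. apply Cmod_Lam_term_le.
  - eexists. apply geom_series_S. split; auto using Cmod_ge_0.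
Qed.

Lemma Cmod_Lam_le (z : C) : Cmod z <= / 2 -> Cmod (Lam z) <= 2 * Cmod z.
Proof.
  intros Hz. assert (Z0 := Cmod_ge_0 z).
  apply Rle_trans with (Cmod z / (1 - Cmod z)).
  - apply (Cmod_series_le (Lam_term z) (fun k => Cmod z ^ S k)).
    apply Cmod_Lam_term_le. apply Lam_series; lra. apply geom_series_S; lra.
  - apply Rmult_le_reg_r with (1 - Cmod z); [lra|].
    unfold Rdiv. rewrite Rmult_assoc, Rinv_l by lra. nra.
Qed.

Lemma C_geom_series (z : C) : Cmod z < 1 -> is_series (fun k => z ^ k)%C (/ (1 - z))%C.
Proof.
  intros Hz.
  assert (N : (1 - z)%C <> 0%C).
  { intros E. assert (z = 1%C) by (symmetry; apply Ceq_minus, E). subst. rewrite Cmod_1 in Hz. lra. }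
  assert (S : forall n, (sum_n (fun k => z ^ k)%C n = (1 - z ^ S n) / (1 - z))%C).
  { induction n.
    - rewrite sum_O. simpl. match goal with |- @eq _ ?a ?b => change (@eq C a b) end. field; auto.
    - rewrite sum_Sn, IHn. change (plus ?a ?b) with (a + b)%C.
      match goal with |- @eq _ ?a ?b => change (@eq C a b) end. simpl. field; auto. }
  assert (P := proj1 (Cmod_gt_0 _) N).
  apply C_is_series_eps. intros eps He.
  destruct (geom_eventually_lt 1 (Cmod z) (eps * Cmod (1 - z)) ltac:(lra)
    (conj (Cmod_ge_0 z) Hz) ltac:(apply Rmult_lt_0_compat; auto)) as (N0 & HN).
  exists N0. intros n Hn. rewrite S.
  replace ((1 - z ^ Datatypes.S n) / (1 - z) - / (1 - z))%C with (- (z ^ Datatypes.S n / (1 - z)))%C by (field; auto).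
  rewrite Cmod_opp, Cmod_div, Cmod_pow by auto.
  specialize (HN (Datatypes.S n) ltac:(lia)).
  apply Rmult_lt_reg_r with (Cmod (1 - z)); auto.
  unfold Rdiv. rewrite Rmult_assoc, Rinv_l by lra. lra.
Qed.

Lemma is_derive_Cpow (z : C) (k : nat) :
  is_derive (fun w => w ^ S k)%C z (RtoC (INR (S k)) * z ^ k)%C.
Proof.
  induction k.
  - apply C_is_derive_ext with (fun w : C => w).
    + intros w. simpl. ring.
    + simpl. replace (1 * 1)%C with (RtoC 1) by ring. apply C_is_derive_id.
  - replace (RtoC (INR (S (S k))) * z ^ S k)%C
      with (1 * z ^ S k + z * (RtoC (INR (S k)) * z ^ k))%C
      by (rewrite (S_INR (S k)), RtoC_plus; simpl Cpow; ring).
    apply (C_is_derive_mult (fun w => w) (fun w => w ^ S k)%C); auto. apply C_is_derive_id.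
Qed.

Lemma is_derive_Lam (z : C) : Cmod z < 1 -> is_derive Lam z (/ (1 - z))%C.
Proof.
  intros Hz. set (r := (1 - Cmod z) / 2).
  assert (Hr : 0 < r) by (unfold r; lra). assert (Z0 := Cmod_ge_0 z).
  assert (Near : forall u, Cmod (u - z) < r -> Cmod u <= 1 - r).
  { intros u Hu. assert (T := Cmod_triangle_inv u z). unfold r in *. lra. }
  assert (D : forall k u, is_derive (fun u => Lam_term u k) u (u ^ k)%C).
  { intros k u. unfold Lam_term, Cdiv.
    replace (u ^ k)%C with (/ RtoC (INR (S k)) * (RtoC (INR (S k)) * u ^ k))%C
      by (field; apply INR_S_neq_0).
    apply C_is_derive_ext with (fun w => / RtoC (INR (S k)) * (w ^ S k))%C.
    - intros w. ring.
    - apply C_is_derive_scal, is_derive_Cpow. }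
  destruct (weierstrass_series (fun k u => Lam_term u k) Lam (fun k => z ^ k)%C
    (fun k => (1 - r) ^ S k) z r) as (l & Hl & H); auto.
  - intros k u Hu. split. eexists; apply D.
    eapply Rle_trans; [apply Cmod_Lam_term_le|]. apply pow_incr. split; [apply Cmod_ge_0|auto].
  - eexists. apply geom_series_S. unfold r in *; lra.
  - intros u Hu. apply Lam_series. specialize (Near u Hu). lra.
  - replace (/ (1 - z))%C with l; auto. apply (C_is_series_unique _ _ _ Hl), C_geom_series, Hz.
Qed.

Lemma Lam_0 : Lam 0 = 0%C.
Proof.
  apply Cseries_unique, C_is_series_eps. intros eps He. exists O. intros n _.
  assert (E : sum_n (Lam_term 0) n = RtoC 0).
  { assert (T : forall k, Lam_term 0 k = RtoC 0) by (intros; unfold Lam_term, Cdiv; simpl; ring).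
    induction n. rewrite sum_O; auto. rewrite sum_Sn, IHn, T.
    change (RtoC 0 + RtoC 0 = RtoC 0)%C. ring. }
  rewrite E. rewrite Cmod_self. auto.
Qed.

(** The product has derivative 0 along the segment from 0 to z, and it is 1 at 0. *)
Lemma Cexp_Lam (z : C) : Cmod z < 1 -> (Cexp (Lam z) * (1 - z) = 1)%C.
Proof.
  intros Hz.
  assert (E : (Cexp (Lam 0) * (1 - 0) = Cexp (Lam z) * (1 - z))%C).
  { apply (zero_derive_constant (fun w => Cexp (Lam w) * (1 - w))%C). intros t Ht.
    set (w := (0 + t * (z - 0))%C).
    assert (Hw : Cmod w < 1).
    { unfold w. replace (0 + t * (z - 0))%C with (t * z)%C by ring.
      rewrite Cmod_mult, Cmod_R, Rabs_pos_eq by lra. generalize (Cmod_ge_0 z). nra. }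
    assert (N : (1 - w)%C <> 0%C).
    { intros E. assert (E' : w = 1%C) by (symmetry; apply Ceq_minus, E).
      rewrite E', Cmod_1 in Hw. lra. }
    replace (RtoC 0) with (/ (1 - w) * Cexp (Lam w) * (1 - w) + Cexp (Lam w) * (0 - 1))%C
      by (field; auto).
    apply (C_is_derive_mult (fun w => Cexp (Lam w)) (fun w => 1 - w)%C).
    - apply (C_is_derive_comp Cexp Lam). apply C_is_derive_Cexp. apply is_derive_Lam, Hw.
    - apply C_is_derive_minus. apply C_is_derive_const. apply C_is_derive_id. }
  rewrite <- E, Lam_0, Cexp_0. ring.
Qed.

Lemma sum_n_RtoC (a : nat -> R) (n : nat) : sum_n (fun k => RtoC (a k)) n = RtoC (sum_n a n).
Proof.
  induction n. rewrite !sum_O; auto.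
  rewrite !sum_Sn, IHn. change (plus ?a ?b) with (a + b)%C at 1. rewrite <- RtoC_plus. reflexivity.
Qed.

Lemma C_is_series_RtoC (a : nat -> R) (l : R) :
  is_series a l -> is_series (fun k => RtoC (a k)) (RtoC l).
Proof.
  intros H. apply C_is_series_eps. intros eps He.
  destruct (proj1 (filterlim_locally (sum_n a) l) H (mkposreal eps He)) as (N & HN).
  exists N. intros n Hn. rewrite sum_n_RtoC, <- RtoC_minus, Cmod_R. exact (HN n Hn).
Qed.

(** The real sum y is the value of [Lam] at x, so exp y (1 - x) = 1 identifies it with the real
    logarithm. *)
Lemma log_series (x : R) : 0 <= x < 1 -> is_series (fun k => x ^ S k / INR (S k)) (- ln (1 - x)).
Proof.
  intros Hx.
  assert (Px : forall k, 0 <= x ^ S k) by (intros; apply pow_le; lra).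
  destruct (pos_series_bounded (fun k => x ^ S k / INR (S k)) (x / (1 - x))) as (y & Hy & _).
  - intros k. apply Rmult_le_pos; auto. left; apply Rinv_0_lt_compat, INR_S_pos.
  - intros n. apply Rle_trans with (sum_n (fun k => x ^ S k) n).
    + apply sum_n_m_le. intros k. apply div_INR_S_le; auto.
    + apply sum_n_le_series; auto. apply geom_series_S; auto.
  - replace (- ln (1 - x)) with y; auto.
    assert (Mx : Cmod (RtoC x) < 1) by (rewrite Cmod_R, Rabs_pos_eq; lra).
    assert (E : Lam (RtoC x) = RtoC y).
    { apply (C_is_series_unique (Lam_term (RtoC x))). apply Lam_series, Mx.
      apply is_series_ext with (fun k => RtoC (x ^ S k / INR (S k))).
      - intros k. unfold Lam_term. rewrite RtoC_div, RtoC_pow; auto.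
        generalize (INR_S_pos k); lra.
      - apply C_is_series_RtoC, Hy. }
    assert (H := Cexp_Lam (RtoC x) Mx).
    rewrite E, Cexp_RtoC, <- RtoC_minus, <- RtoC_mult in H. apply RtoC_inj in H.
    rewrite <- (ln_exp y). rewrite <- ln_Rinv by lra. f_equal.
    apply Rmult_eq_reg_r with (1 - x); [|lra]. rewrite H. field. lra.
Qed.

Lemma Cmod_Lam_le_ln (z : C) : Cmod z < 1 -> Cmod (Lam z) <= - ln (1 - Cmod z).
Proof.
  intros Hz. apply (Cmod_series_le (Lam_term z) (fun k => Cmod z ^ S k / INR (S k))).
  - intros k. rewrite Cmod_Lam_term. lra.
  - apply Lam_series, Hz.
  - apply log_series. split; auto using Cmod_ge_0.
Qed.

(** * Sieving by primes *)

Definition divides_b (p n : nat) : bool := Nat.eqb (n mod p) 0.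

(** P-rough integers in the usual sense: no prime up to P divides n. *)
Fixpoint rough (P n : nat) : bool :=
  match P with
  | O => true
  | S P' => if prime_dec (Z.of_nat P) then andb (rough P' n) (negb (divides_b P n)) else rough P' n
  end.

Lemma prime_ge_2_nat (p : nat) : prime (Z.of_nat p) -> (2 <= p)%nat.
Proof. intros H. apply prime_ge_2 in H. lia. Qed.

Lemma divides_b_true (p n : nat) : divides_b p n = true <-> Nat.divide p n.
Proof. unfold divides_b. rewrite Nat.eqb_eq. apply Nat.Lcm0.mod_divide. Qed.

Lemma divide_of_nat (a b : nat) : (Z.of_nat a | Z.of_nat b)%Z <-> Nat.divide a b.
Proof.
  split.
  - intros (k & Hk). destruct (Z_le_dec 0 k).
    + exists (Z.to_nat k). apply Nat2Z.inj. rewrite Nat2Z.inj_mul, Z2Nat.id; auto.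
    + exists O. nia.
  - intros (k & ->). exists (Z.of_nat k). apply Nat2Z.inj_mul.
Qed.

Lemma divides_b_prime_mult (r p m : nat) :
  prime (Z.of_nat r) -> prime (Z.of_nat p) -> r <> p -> divides_b r (p * m) = divides_b r m.
Proof.
  intros Hr Hp N. apply Bool.eq_iff_eq_true. rewrite !divides_b_true. split.
  - intros H. apply divide_of_nat in H. rewrite Nat2Z.inj_mul in H.
    apply prime_mult in H; auto. destruct H as [H|H].
    + apply prime_divisors in H; auto.
      apply prime_ge_2_nat in Hr. apply prime_ge_2_nat in Hp. lia.
    + apply divide_of_nat, H.
  - intros H. apply Nat.divide_mul_r, H.
Qed.

Lemma rough_prime_mult (P p m : nat) :
  prime (Z.of_nat p) -> (P < p)%nat -> rough P (p * m) = rough P m.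
Proof.
  intros Hp. induction P; intros HP; auto.
  cbn [rough]. destruct (prime_dec _) as [Hr|]; [|apply IHP; lia].
  rewrite IHP by lia. f_equal. f_equal. apply divides_b_prime_mult; auto. lia.
Qed.

Lemma rough_false (P r n : nat) :
  prime (Z.of_nat r) -> (r <= P)%nat -> Nat.divide r n -> rough P n = false.
Proof.
  intros Hr HP Hd. induction P.
  - apply prime_ge_2_nat in Hr. lia.
  - cbn [rough]. destruct (Nat.eq_dec r (S P)) as [E|N].
    + subst r. destruct (prime_dec _); [|contradiction].
      apply divides_b_true in Hd. rewrite Hd. apply Bool.andb_false_r.
    + rewrite IHP by lia. destruct (prime_dec _); auto.
Qed.

Lemma prime_divisor_exists (n : nat) :
  (2 <= n)%nat -> exists r, prime (Z.of_nat r) /\ Nat.divide r n.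
Proof.
  induction n as [n IH] using (well_founded_induction lt_wf). intros Hn.
  destruct (prime_dec (Z.of_nat n)) as [Hp|Hp].
  - exists n. split; auto. apply Nat.divide_refl.
  - destruct (not_prime_divide (Z.of_nat n) ltac:(lia) Hp) as (d & Hd & Hdn).
    destruct (IH (Z.to_nat d)) as (r & Hr & Hrd); try lia.
    exists r. split; auto. apply Nat.divide_trans with (Z.to_nat d); auto.
    apply divide_of_nat. rewrite Z2Nat.id by lia. auto.
Qed.

Lemma rough_gt (P n : nat) : (2 <= n)%nat -> rough P n = true -> (P < n)%nat.
Proof.
  intros Hn HR. apply Nat.nle_gt. intros H.
  destruct (prime_divisor_exists n Hn) as (r & Hr & Hd).
  assert (r <= n)%nat by (apply Nat.divide_pos_le; auto; lia).
  rewrite (rough_false P r n Hr ltac:(lia) Hd) in HR. discriminate.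
Qed.

Lemma rough_1 (P : nat) : rough P 1 = true.
Proof.
  induction P; auto. cbn [rough]. destruct (prime_dec _) as [Hp|]; auto.
  rewrite IHP. simpl. apply prime_ge_2_nat in Hp.
  destruct (divides_b (S P) 1) eqn:E; auto.
  apply divides_b_true, Nat.divide_1_r in E. lia.
Qed.

(** Spreads g over the multiples of p, as happens to a completely multiplicative series multiplied
    by its term at p. The partial sum up to N is that of g up to N / p. *)
Lemma series_reindex_mult (g : nat -> C) (p : nat) (l : C) :
  (1 <= p)%nat -> is_series g l ->
  is_series (fun n => if divides_b p n then g (n / p)%nat else RtoC 0) l.
Proof.
  intros Hp Hg.
  assert (E : forall N, sum_n (fun n => if divides_b p n then g (n / p)%nat else RtoC 0) N
    = sum_n g (N / p)).
  { induction N.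
    - rewrite sum_O, Nat.Div0.div_0_l, sum_O. unfold divides_b.
      rewrite Nat.Div0.mod_0_l. reflexivity.
    - rewrite sum_Sn, IHN. destruct (divides_b p (S N)) eqn:D.
      + apply divides_b_true in D. destruct D as (k & Hk).
        destruct k as [|k]; [lia|].
        assert (D1 : (S N / p = S k)%nat) by (rewrite Hk; apply Nat.div_mul; lia).
        assert (D2 : (N / p = k)%nat).
        { symmetry. apply Nat.div_unique with (p - 1)%nat; [lia|]. nia. }
        rewrite D1, D2, sum_Sn. reflexivity.
      + assert (D1 : (S N / p = N / p)%nat).
        { unfold divides_b in D. apply Nat.eqb_neq in D.
          assert (E1 := Nat.div_mod_eq (S N) p). assert (E2 := Nat.mod_upper_bound (S N) p ltac:(lia)).
          apply Nat.div_unique with (S N mod p - 1)%nat; [lia|lia]. }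
        rewrite D1. apply Cplus_0_r. }
  apply C_is_series_eps. intros eps He.
  destruct (proj1 (C_is_series_eps _ _) Hg eps He) as (N & HN).
  exists (N * p)%nat. intros n Hn. rewrite E. apply HN.
  apply Nat.div_le_lower_bound; lia.
Qed.

Fixpoint euler_prod (t : nat -> C) (P : nat) : C :=
  match P with
  | O => RtoC 1
  | S P' => if prime_dec (Z.of_nat P) then (euler_prod t P' * (1 - t P))%C else euler_prod t P'
  end.

Definition prime_log_term (t : nat -> C) (p : nat) : C :=
  if prime_dec (Z.of_nat p) then Lam (t p) else RtoC 0.

(** Multiplying by 1 - t p subtracts the terms at multiples of p; being rough for smaller primes is
    the same for k and p k, so exactly those terms disappear. *)
Lemma sieve_series (t : nat -> C) (l : C) (P : nat) :
  t O = 0%C -> (forall m n, (1 <= m)%nat -> (1 <= n)%nat -> t (m * n)%nat = (t m * t n)%C) ->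
  is_series t l ->
  is_series (fun n => if rough P n then t n else RtoC 0) (euler_prod t P * l)%C.
Proof.
  intros H0 Hm Hl. induction P.
  - cbn [rough euler_prod]. rewrite Cmult_1_l. auto.
  - cbn [euler_prod]. 
    apply is_series_ext with (fun n => if prime_dec (Z.of_nat (S P))
      then (if andb (rough P n) (negb (divides_b (S P) n)) then t n else RtoC 0)
      else (if rough P n then t n else RtoC 0)).
    { intros n. cbn [rough]. destruct (prime_dec _); auto. }
    destruct (prime_dec (Z.of_nat (S P))) as [Hp|]; auto.
    set (g := fun n => if rough P n then t n else RtoC 0) in *.
    replace (euler_prod t P * (1 - t (S P)) * l)%C
      with (euler_prod t P * l - t (S P) * (euler_prod t P * l))%C by ring.
    assert (IH2 := series_reindex_mult _ (S P) _ ltac:(lia) (C_is_series_scal (t (S P)) g _ IHP)).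
    eapply is_series_ext; [|exact (C_is_series_minus _ _ _ _ IHP IH2)].
    intros n. cbv beta. unfold g. destruct (divides_b (S P) n) eqn:D.
    + rewrite Bool.andb_false_r. apply divides_b_true in D. destruct D as (k & Hk).
      rewrite Nat.mul_comm in Hk. rewrite Hk, (rough_prime_mult P (S P) k) by (auto; lia).
      replace (S P * k / S P)%nat with k by (symmetry; rewrite Nat.mul_comm; apply Nat.div_mul; lia).
      destruct (rough P k); [|Cring].
      (* The index 0 is a multiple of every prime; t 0 = 0 settles it. *)
      destruct k. rewrite Nat.mul_0_r, H0. Cring.
      rewrite Hm by lia. Cring.
    + cbn [negb]. rewrite Bool.andb_true_r. destruct (rough P n); Cring.
Qed.

(** * Logarithm of the Euler product of a completely multiplicative t with a majorant b of the same
    kind *)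

Section EulerProduct.
Variables (t : nat -> C) (b : nat -> R) (l : C) (B : R).
Hypotheses (Ht0 : t O = 0%C) (Ht1 : t 1%nat = 1%C)
  (Htm : forall m n, (1 <= m)%nat -> (1 <= n)%nat -> t (m * n)%nat = (t m * t n)%C)
  (Hb0 : b O = 0) (Hb1 : b 1%nat = 1)
  (Hbm : forall m n, (1 <= m)%nat -> (1 <= n)%nat -> b (m * n)%nat = b m * b n)
  (Htb : forall n, Cmod (t n) <= b n)
  (Hb2 : forall n, (2 <= n)%nat -> b n <= / 2)
  (Hl : is_series t l) (HB : is_series b B).

Lemma majorant_nonneg (n : nat) : 0 <= b n.
Proof. eapply Rle_trans; [apply Cmod_ge_0|apply Htb]. Qed.

(* The sieved series consists of the term at 1 and of terms at n > P. *)
Lemma sieve_limit (P : nat) : (1 <= P)%nat -> Cmod (euler_prod t P * l - 1) <= B - sum_n b P.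
Proof.
  intros HP.
  set (delta := fun n : nat => if Nat.eqb n 1 then RtoC 1 else RtoC 0).
  assert (Hdelta : is_series delta (RtoC 1)).
  { apply C_is_series_eps. intros eps He. exists 1%nat. intros n Hn.
    assert (E : sum_n delta n = RtoC 1).
    { induction n; [lia|]. destruct n.
      - rewrite sum_Sn, sum_O. unfold delta; simpl. apply Cplus_0_l.
      - rewrite sum_Sn, IHn by lia. unfold delta; simpl. apply Cplus_0_r. }
    rewrite E, Cmod_self. auto. }
  assert (Htail : is_series (fun n => if Nat.leb n P then 0 else b n) (B - sum_n b P)).
  { assert (Fin : is_series (fun n => if Nat.leb n P then b n else 0) (sum_n b P)).
    { assert (E : forall n, (P <= n)%nat -> sum_n (fun n => if Nat.leb n P then b n else 0) n = sum_n b P).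
      { intros n Hn. induction Hn.
        - apply sum_n_ext_loc. intros k Hk. apply Nat.leb_le in Hk. rewrite Hk. auto.
        - rewrite sum_Sn, IHHn. assert (Nat.leb (S m) P = false) by (apply Nat.leb_gt; lia).
          rewrite H. apply Rplus_0_r. }
      apply (filterlim_ext_loc (fun _ => sum_n b P)).
      - exists P. intros n Hn. symmetry. apply E, Hn.
      - apply filterlim_const. }
    eapply is_series_ext; [|exact (is_series_minus _ _ _ _ HB Fin)].
    intros n. simpl. destruct (Nat.leb n P).
    - apply Rplus_opp_r.
    - change (b n - 0 = b n). ring. }
  apply (Cmod_series_le (fun n => (if rough P n then t n else RtoC 0) - delta n)%C
    (fun n => if Nat.leb n P then 0 else b n)); auto.
  - intros n. unfold delta. destruct (Nat.leb n P) eqn:E.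
    + apply Nat.leb_le in E. destruct n as [|[|n]].
      * simpl Nat.eqb. cbv iota. rewrite Ht0. destruct (rough P 0); rewrite Cmod_self; lra.
      * simpl Nat.eqb. cbv iota. rewrite rough_1, Ht1, Cmod_self. lra.
      * simpl Nat.eqb. cbv iota. destruct (rough P (S (S n))) eqn:R.
        apply rough_gt in R; lia. rewrite Cmod_self. lra.
    + apply Nat.leb_gt in E. assert (N : Nat.eqb n 1 = false) by (apply Nat.eqb_neq; lia). rewrite N.
      destruct (rough P n).
      * replace (t n - 0)%C with (t n) by ring. auto.
      * rewrite Cmod_self. apply majorant_nonneg.
  - apply C_is_series_minus; auto. apply sieve_series; auto.
Qed.

Fixpoint real_euler_prod (P : nat) : R :=
  match P with
  | O => 1
  | S P' => if prime_dec (Z.of_nat P) then real_euler_prod P' * (1 - b P) else real_euler_prod P'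
  end.

Lemma real_euler_prod_pos (P : nat) : 0 < real_euler_prod P.
Proof.
  induction P; cbn [real_euler_prod]; [lra|]. destruct (prime_dec _) as [Hp|]; auto.
  apply prime_ge_2_nat in Hp. apply Rmult_lt_0_compat; auto. specialize (Hb2 (S P) Hp). lra.
Qed.

(** Sieving b itself leaves nonnegative terms, among them the term 1 at n = 1. *)
Lemma real_euler_prod_ge (P : nat) : 1 <= real_euler_prod P * B.
Proof.
  assert (E : euler_prod (fun n => RtoC (b n)) P = RtoC (real_euler_prod P)).
  { induction P; cbn [euler_prod real_euler_prod]; auto. destruct (prime_dec _); auto.
    rewrite IHP, RtoC_mult, RtoC_minus. reflexivity. }
  assert (S := sieve_series (fun n => RtoC (b n)) (RtoC B) P ltac:(cbv beta; rewrite Hb0; auto)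
    ltac:(intros; cbv beta; rewrite Hbm, RtoC_mult; auto) (C_is_series_RtoC b B HB)).
  cbv beta in S. rewrite E, <- RtoC_mult in S.
  apply le_epsilon. intros eps He.
  destruct (proj1 (C_is_series_eps _ _) S eps He) as (N & HN).
  specialize (HN (Datatypes.S N) ltac:(lia)).
  assert (E2 : sum_n (fun n => if rough P n then RtoC (b n) else RtoC 0) (Datatypes.S N)
    = RtoC (sum_n (fun n => if rough P n then b n else 0) (Datatypes.S N))).
  { rewrite <- sum_n_RtoC. apply sum_n_ext. intros n. destruct (rough P n); auto. }
  assert (HN2 : Cmod (RtoC (sum_n (fun n => if rough P n then b n else 0) (Datatypes.S N))
    - RtoC (real_euler_prod P * B)) < eps) by (rewrite <- E2; exact HN).
  clear HN; rename HN2 into HN. rewrite <- RtoC_minus, Cmod_R in HN.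
  assert (G : forall n, 1 <= sum_n (fun n => if rough P n then b n else 0) (Datatypes.S n)).
  { assert (T0 : forall n, 0 <= (if rough P n then b n else 0))
      by (intros n; destruct (rough P n); [apply majorant_nonneg|lra]).
    induction n.
    - rewrite sum_Sn, sum_O, rough_1, Hb1.
      change (1 <= (if rough P 0 then b 0%nat else 0) + 1). specialize (T0 O). lra.
    - rewrite sum_Sn. specialize (T0 (Datatypes.S (Datatypes.S n))).
      change (1 <= sum_n (fun n => if rough P n then b n else 0) (Datatypes.S n)
        + (if rough P (Datatypes.S (Datatypes.S n)) then b (Datatypes.S (Datatypes.S n)) else 0)). lra. }
  specialize (G N). apply Rabs_lt_between in HN. lra.
Qed.

Lemma prime_t_small (p : nat) : prime (Z.of_nat p) -> Cmod (t p) <= b p <= / 2.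
Proof. intros Hp. apply prime_ge_2_nat in Hp. auto. Qed.

Lemma Cexp_prime_sum (P : nat) : (Cexp (sum_n (prime_log_term t) P) * euler_prod t P = 1)%C.
Proof.
  induction P.
  - rewrite sum_O. unfold prime_log_term. destruct (prime_dec _) as [Hp|].
    apply prime_ge_2_nat in Hp; lia. simpl. rewrite Cexp_0. ring.
  - rewrite sum_Sn. change (plus ?a ?b) with (a + b)%C. rewrite Cexp_plus.
    cbn [euler_prod]. unfold prime_log_term at 2. destruct (prime_dec _) as [Hp|].
    + assert (H := prime_t_small _ Hp).
      transitivity ((Cexp (sum_n (prime_log_term t) P) * euler_prod t P)
        * (Cexp (Lam (t (S P))) * (1 - t (S P))))%C; [ring|].
      rewrite IHP, Cexp_Lam by lra. ring.
    + rewrite Cexp_0. etransitivity; [|exact IHP]. ring.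
Qed.

(** Each |Lam (t p)| is at most - ln (1 - b p), and these add up to minus the logarithm of the real
    product, which is at least 1 / B. *)
Lemma Cmod_prime_sum_le (P : nat) : Cmod (sum_n (prime_log_term t) P) <= ln B.
Proof.
  assert (H : Cmod (sum_n (prime_log_term t) P) <= - ln (real_euler_prod P)).
  { induction P.
    - rewrite sum_O. unfold prime_log_term. destruct (prime_dec _) as [Hp|].
      apply prime_ge_2_nat in Hp; lia. simpl. rewrite Cmod_0, ln_1. lra.
    - rewrite sum_Sn. eapply Rle_trans; [apply Cmod_triangle|].
      cbn [real_euler_prod]. unfold prime_log_term at 2. destruct (prime_dec _) as [Hp|].
      + assert (H := prime_t_small _ Hp).
        rewrite ln_mult by (try apply real_euler_prod_pos; lra).
        assert (Cmod (Lam (t (S P))) <= - ln (1 - b (S P))).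
        { eapply Rle_trans; [apply Cmod_Lam_le_ln; lra|].
          apply Ropp_le_contravar, ln_le; lra. }
        lra.
      + rewrite Cmod_0. lra. }
  eapply Rle_trans; [apply H|].
  assert (P0 := real_euler_prod_pos P). assert (G := real_euler_prod_ge P).
  rewrite <- ln_Rinv by auto. apply ln_le. apply Rinv_0_lt_compat; auto.
  apply Rmult_le_reg_l with (real_euler_prod P); auto. rewrite Rinv_r; lra.
Qed.

Lemma prime_sum_series : is_series (prime_log_term t) (Cseries (prime_log_term t)).
Proof.
  apply Cseries_correct, (C_ex_series_le _ (fun n => 2 * b n)).
  - intros p. unfold prime_log_term. destruct (prime_dec _) as [Hp|].
    + assert (H := prime_t_small _ Hp). eapply Rle_trans; [apply Cmod_Lam_le|]; lra.
    + rewrite Cmod_0. generalize (majorant_nonneg p). lra.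
  - eexists. exact (is_series_scal 2 b B HB).
Qed.

Lemma Cmod_prime_series_le : Cmod (Cseries (prime_log_term t)) <= ln B.
Proof.
  apply le_epsilon. intros e He.
  destruct (proj1 (C_is_series_eps _ _) prime_sum_series e He) as (N & HN).
  specialize (HN N (le_n N)). assert (T := Cmod_prime_sum_le N).
  set (S := Cseries (prime_log_term t)) in *.
  replace S with (sum_n (prime_log_term t) N - (sum_n (prime_log_term t) N - S))%C by ring.
  eapply Rle_trans; [apply Cmod_triangle_minus|]. lra.
Qed.

(** The exponential of a partial prime sum inverts the finite Euler product, and that product times
    l tends to 1. *)
Lemma Cexp_prime_series : Cexp (Cseries (prime_log_term t)) = l.
Proof.
  set (S := Cseries (prime_log_term t)).
  assert (B1 : 1 <= B) by (generalize (real_euler_prod_ge 0); simpl; lra).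
  symmetry. apply Ceq_minus, Cmod_eq_0, Rle_antisym; [|apply Cmod_ge_0].
  apply le_epsilon. intros e He. rewrite Rplus_0_l.
  assert (Cc : continuous Cexp S) by (apply C_ex_derive_continuous; eexists; apply C_is_derive_Cexp).
  destruct (proj1 (Ccontinuous_eps _ _) Cc (e / 2) ltac:(lra)) as (d & Hd & Hcd).
  destruct (proj1 (C_is_series_eps _ _) prime_sum_series d Hd) as (N1 & HN1).
  (* The error of the sieve gets multiplied by an exponential of modulus at most B. *)
  assert (He2 : 0 < e / (2 * B)) by (apply Rdiv_lt_0_compat; lra).
  destruct (proj1 (filterlim_locally (sum_n b) B) HB (mkposreal _ He2)) as (N2 & HN2).
  set (P := Nat.max 1 (Nat.max N1 N2)).
  specialize (HN1 P ltac:(lia)). specialize (HN2 P ltac:(lia)).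
  change (Rabs (sum_n b P - B) < e / (2 * B)) in HN2. apply Rabs_lt_between in HN2.
  assert (SL := sieve_limit P ltac:(lia)).
  assert (EX := Cexp_prime_sum P). fold S in HN1. specialize (Hcd _ HN1).
  set (SP := sum_n (prime_log_term t) P) in *.
  replace (l - Cexp S)%C
    with (Cexp SP * (euler_prod t P * l - 1) + (Cexp SP - Cexp S))%C.
  2: { replace (Cexp SP * (euler_prod t P * l - 1) + (Cexp SP - Cexp S))%C
         with (Cexp SP * euler_prod t P * l - Cexp S)%C by ring. rewrite EX. ring. }
  eapply Rle_trans; [apply Cmod_triangle|]. rewrite Cmod_mult.
  assert (M1 : Cmod (Cexp SP) <= B).
  { rewrite Cmod_Cexp. rewrite <- (exp_ln B) by lra. apply exp_monotone.
    eapply Rle_trans; [apply Re_le_Cmod|]. apply Cmod_prime_sum_le. }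
  assert (M2 : Cmod (Cexp SP) * Cmod (euler_prod t P * l - 1) <= B * (e / (2 * B))).
  { apply Rmult_le_compat; auto using Cmod_ge_0. lra. }
  replace (B * (e / (2 * B))) with (e / 2) in M2 by (field; lra). lra.
Qed.
End EulerProduct.

(** The value 0 at index 0 lets the index be the integer itself, as multiplicativity requires. *)
Definition zeta_term (sigma : R) (n : nat) : R :=
  match n with O => 0 | S _ => Rpower (INR n) (- sigma) end.

Lemma zeta_term_mult (sigma : R) (m n : nat) :
  (1 <= m)%nat -> (1 <= n)%nat ->
  zeta_term sigma (m * n) = zeta_term sigma m * zeta_term sigma n.
Proof.
  intros Hm Hn. destruct m as [|m]; [lia|]. destruct n as [|n]; [lia|].
  unfold zeta_term. rewrite Rpower_mult_distr, <- mult_INR by apply INR_S_pos. reflexivity.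
Qed.

Lemma zeta_term_half (sigma : R) (n : nat) : 1 <= sigma -> (2 <= n)%nat -> zeta_term sigma n <= / 2.
Proof.
  intros Hs Hn. destruct n as [|n]; [lia|]. unfold zeta_term.
  assert (2 <= INR (S n)) by (change 2 with (INR 2); apply le_INR; auto).
  apply Rle_trans with (/ INR (S n)).
  - rewrite <- (Rpower_1 (INR (S n))) at 2 by lra. rewrite <- Rpower_Ropp. apply Rle_Rpower; lra.
  - apply Rinv_le_contravar; lra.
Qed.

Lemma zeta_term_1 (sigma : R) : zeta_term sigma 1 = 1.
Proof. unfold zeta_term, Rpower. simpl. rewrite ln_1, Rmult_0_r, exp_0. auto. Qed.

Lemma zeta_series (sigma : R) :
  1 < sigma -> exists B, is_series (zeta_term sigma) B /\ B <= 1 + / (sigma - 1).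
Proof.
  intros Hs. destruct (pseries_tail 1 (sigma - 1) (le_n 1) ltac:(lra)) as (l & Hl & Bl).
  replace (1 + (sigma - 1)) with sigma in Hl by ring.
  assert (E1 : forall p, Rpower (INR 1) p = 1) by (intros; unfold Rpower; simpl; rewrite ln_1, Rmult_0_r, exp_0; auto).
  exists (1 + l). split.
  - apply (is_series_decr_1 (K := R_AbsRing) (V := R_NormedModule)).
    (* The terms at 0 and 1 are split off; the tail starts at 2 and is at most 1 / (sigma - 1). *)
    apply (is_series_decr_1 (K := R_AbsRing) (V := R_NormedModule)).
    unfold zeta_term at 2 3. rewrite E1.
    match goal with |- is_series _ ?v => replace v with l end.
    + exact Hl.
    + assert (E : forall x : R, x = 1 + x + - 0 + - (1)) by (intros; ring). exact (E l).
  - rewrite E1 in Bl. lra.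
Qed.

(** * The prime sum of chi to the right of 1 *)

Section PrimeSum.
Variables (q : Z) (chi : Z -> C) (L : C -> C).
Hypotheses (Hq : (2 <= q)%Z) (Hchi : is_primitive_character q chi) (HL : is_dirichlet_L chi L).

Definition chi_term (s : C) (n : nat) : C := (chi (Z.of_nat n) * rcpow (INR n) (- s))%C.

Lemma chi_0 : chi 0%Z = 0%C.
Proof.
  apply NNPP. intros N. apply Hchi in N. destruct N as [_ _ N].
  assert (D : (q | 1)%Z) by (apply N; [apply Z.divide_0_r|apply Z.divide_refl]).
  apply Z.divide_1_r_nonneg in D; lia.
Qed.

Lemma chi_term_0 (s : C) : chi_term s 0 = 0%C.
Proof. unfold chi_term. simpl Z.of_nat. rewrite chi_0. ring. Qed.

Lemma chi_term_1 (s : C) : chi_term s 1 = 1%C.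
Proof.
  unfold chi_term. simpl INR. simpl Z.of_nat.
  rewrite (chi_1 q), rcpow_1 by apply Hchi. ring.
Qed.

Lemma chi_term_mult (s : C) (m n : nat) :
  (1 <= m)%nat -> (1 <= n)%nat -> chi_term s (m * n) = (chi_term s m * chi_term s n)%C.
Proof.
  intros Hm Hn. unfold chi_term.
  rewrite Nat2Z.inj_mul, mult_INR, (chi_mult q), rcpow_mult by (apply Hchi || (apply lt_0_INR; lia)).
  ring.
Qed.

Lemma Cmod_chi_term_le (s : C) (sigma : R) (n : nat) :
  sigma <= Re s -> Cmod (chi_term s n) <= zeta_term sigma n.
Proof.
  intros Hs. destruct n as [|n].
  - rewrite chi_term_0, Cmod_0. simpl. lra.
  - unfold chi_term, zeta_term. rewrite Cmod_mult, Cmod_rcpow, re_opp.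
    rewrite <- (Rmult_1_l (Rpower _ (- sigma))).
    apply Rmult_le_compat. apply Cmod_ge_0. left; apply exp_pos.
    apply (Cmod_chi_le_1 q); auto. apply Hchi.
    apply Rle_Rpower; [|lra]. change 1 with (INR 1). apply le_INR. lia.
Qed.

Lemma chi_term_series (s : C) : 1 < Re s -> is_series (chi_term s) (L s).
Proof.
  intros Hs. apply (is_series_decr_1 (K := C_AbsRing) (V := C_NormedModule)).
  rewrite chi_term_0. match goal with |- is_series _ ?v => replace v with (L s) end.
  - apply HL, Hs.
  - change (L s = L s + - 0)%C. ring.
Qed.

Definition prime_sum (s : C) : C := Cseries (prime_log_term (chi_term s)).

Lemma prime_sum_is_series (s : C) :
  1 < Re s -> is_series (prime_log_term (chi_term s)) (prime_sum s).
Proof.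
  intros Hs. destruct (zeta_series (Re s) Hs) as (B & HB & _).
  apply (prime_sum_series (chi_term s) (zeta_term (Re s)) B); auto.
  - intros n. apply Cmod_chi_term_le. lra.
  - intros n. apply zeta_term_half. lra.
Qed.

Lemma Cexp_prime_sum_eq (s : C) : 1 < Re s -> Cexp (prime_sum s) = L s.
Proof.
  intros Hs. destruct (zeta_series (Re s) Hs) as (B & HB & _).
  apply (Cexp_prime_series (chi_term s) (zeta_term (Re s)) (L s) B); auto.
  - apply chi_term_0.
  - apply chi_term_1.
  - apply chi_term_mult.
  - apply zeta_term_1.
  - apply zeta_term_mult.
  - intros n. apply Cmod_chi_term_le. lra.
  - intros n. apply zeta_term_half. lra.
  - apply chi_term_series, Hs.
Qed.

(** The majorant is the zeta series at Re s, whose sum is at most 1 + 1 / (Re s - 1). *)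
Lemma Cmod_prime_sum_bound (s : C) :
  1 < Re s -> Cmod (prime_sum s) <= ln (1 + / (Re s - 1)).
Proof.
  intros Hs. destruct (zeta_series (Re s) Hs) as (B & HB & BB).
  assert (B1 : 1 <= B).
  { apply Rle_trans with (sum_n (zeta_term (Re s)) 1).
    - rewrite sum_Sn, sum_O, zeta_term_1. change (1 <= 0 + 1). lra.
    - apply sum_n_le_series; auto. intros n. eapply Rle_trans; [apply Cmod_ge_0|].
      apply (Cmod_chi_term_le s). lra. }
  apply Rle_trans with (ln B); [|apply ln_le; lra].
  apply (Cmod_prime_series_le (chi_term s) (zeta_term (Re s)) B); auto.
  - apply zeta_term_1.
  - apply zeta_term_mult.
  - intros n. apply Cmod_chi_term_le. lra.
  - intros n. apply zeta_term_half. lra.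
Qed.

(** Ties the prescribed branch to [prime_sum]: the inner sum over k is the series of [Lam] at chi(p)
    p^(-s). *)
Lemma prime_power_sum_eq (s l : C) :
  1 < Re s -> is_prime_power_sum chi s l -> l = prime_sum s.
Proof.
  intros Hs (f & Hf1 & Hf2 & Hl). symmetry. apply Cseries_unique.
  eapply is_series_ext; [|exact Hl]. intros p. unfold prime_log_term.
  destruct (prime_dec (Z.of_nat p)) as [Hp|Hp]; [|auto].
  symmetry. apply Cseries_unique. eapply is_series_ext; [|exact (Hf1 p Hp)].
  intros k. unfold Lam_term, chi_term. rewrite rcpow_scal_nat, Cpow_mult_l, rcpow_opp.
  rewrite Cpow_inv by apply rcpow_neq_0.
  assert (N1 := INR_S_neq_0 k). assert (N2 := Cpow_nz _ (S k) (rcpow_neq_0 (INR p) s)).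
  match goal with |- @eq _ ?a ?b => change (@eq C a b) end.
  field. auto.
Qed.

Lemma prime_sum_ex_derive (s : C) : 1 < Re s -> ex_derive prime_sum s.
Proof.
  intros Hs. set (d := (Re s - 1) / 2).
  assert (Hd : 0 < d) by (unfold d; lra).
  assert (Near : forall u, Cmod (u - s) < d -> 1 + d <= Re u).
  { intros u Hu. destruct (Re_Im_near u s d ltac:(lra)). unfold d in *. lra. }
  destruct (zeta_series (1 + d) ltac:(lra)) as (B & HB & _).
  assert (Small : forall u p, Cmod (u - s) < d -> prime (Z.of_nat p) ->
     Cmod (chi_term u p) <= zeta_term (1 + d) p /\ zeta_term (1 + d) p <= / 2).
  { intros u p Hu Hp. split. apply Cmod_chi_term_le, Near, Hu.
    apply zeta_term_half. lra. apply prime_ge_2_nat, Hp. }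
  assert (Dt : forall p u, Cmod (u - s) < d -> ex_derive (fun u => prime_log_term (chi_term u) p) u).
  { intros p u Hu. unfold prime_log_term. destruct (prime_dec (Z.of_nat p)) as [Hp|Hp].
    - destruct (Small u p Hu Hp).
      apply (C_ex_derive_comp Lam (fun u => chi_term u p)).
      + eexists. apply is_derive_Lam. lra.
      + unfold chi_term. apply C_ex_derive_mult; [apply C_ex_derive_const|].
        apply ex_derive_rcpow_opp.
    - apply C_ex_derive_const. }
  destruct (weierstrass_series (fun p u => prime_log_term (chi_term u) p) prime_sum
    (fun p => C_derive (fun u => prime_log_term (chi_term u) p) s)
    (fun p => 2 * zeta_term (1 + d) p) s d) as (l' & _ & H); auto.
  - intros p u Hu. split; auto. unfold prime_log_term.
    destruct (prime_dec (Z.of_nat p)) as [Hp|Hp].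
    + destruct (Small u p Hu Hp). eapply Rle_trans; [apply Cmod_Lam_le|]; lra.
    + rewrite Cmod_0. apply Rmult_le_pos; [lra|].
      eapply Rle_trans; [apply Cmod_ge_0|]. apply (Cmod_chi_term_le u), Near, Hu.
  - eexists. exact (is_series_scal 2 (zeta_term (1 + d)) B HB).
  - intros u Hu. apply prime_sum_is_series. specialize (Near u Hu). lra.
  - intros p. apply C_derive_correct; auto. apply Dt. rewrite Cmod_self. auto.
  - exists l'. auto.
Qed.
End PrimeSum.

(** * The bounds for log L *)

Lemma exp_mult_nat (n : nat) (y : R) : exp (INR n * y) = exp y ^ n.
Proof.
  induction n. rewrite Rmult_0_l, exp_0. auto.
  rewrite S_INR, Rmult_plus_distr_r, Rmult_1_l, exp_plus, IHn. simpl. ring.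
Qed.

Lemma exp_ge_pow (n : nat) (x : R) : 0 <= x -> (1 + x) ^ n <= exp (INR n * x).
Proof. intros Hx. rewrite exp_mult_nat. apply pow_incr. split; [lra|apply exp_ineq1_le]. Qed.

(** The bound exp (1 / 64) <= 64 / 63 is raised to the power 64 by three fourth powers, the first
    two results being rounded up. *)
Lemma exp_1_le : exp 1 <= 2.75.
Proof.
  assert (E : exp (/ 64) <= 64 / 63).
  { assert (H := exp_ineq1_le (- / 64)). rewrite exp_Ropp in H.
    assert (P := exp_pos (/ 64)).
    apply Rmult_le_compat_l with (r := exp (/ 64)) in H; [|lra].
    rewrite Rinv_r in H by lra. lra. }
  replace 1 with (INR 4 * (INR 4 * (INR 4 * / 64))) by (simpl; lra).
  rewrite !exp_mult_nat.
  assert (P : 0 <= exp (/ 64)) by (left; apply exp_pos).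
  assert (E1 : 0 <= exp (/ 64) ^ 4 <= 1.0651).
  { split. apply pow_le; auto. apply Rle_trans with ((64 / 63) ^ 4). apply pow_incr; auto. simpl; lra. }
  assert (E2 : 0 <= (exp (/ 64) ^ 4) ^ 4 <= 1.2871).
  { split. apply pow_le, E1. apply Rle_trans with (1.0651 ^ 4). apply pow_incr; auto. simpl; lra. }
  apply Rle_trans with (1.2871 ^ 4). apply pow_incr; auto. simpl; lra.
Qed.

Lemma exp_hundredth_le : exp 0.01 <= 1.0102.
Proof.
  assert (H := exp_ineq1_le (Ropp 0.01)). rewrite exp_Ropp in H. assert (P := exp_pos 0.01).
  apply Rmult_le_compat_l with (r := exp 0.01) in H; [|lra].
  rewrite Rinv_r in H by lra. lra.
Qed.

Lemma inv_le_half (x : R) : 2 <= x -> 0 < / x <= / 2.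
Proof. intros H. split. apply Rinv_0_lt_compat; lra. apply Rinv_le_contravar; lra. Qed.

(** The tangent to ln at a, with ln a replaced by an upper bound c. *)
Lemma ln_le_tangent (x a c : R) : 0 < x -> 0 < a -> a <= exp c -> ln x <= x / a - 1 + c.
Proof.
  intros Hx Ha Hc.
  replace x with (x / a * a) at 1 by (field; lra).
  assert (P : 0 < x / a) by (apply Rdiv_lt_0_compat; auto).
  rewrite ln_mult by auto.
  assert (H := exp_ineq1_le (ln (x / a))). rewrite exp_ln in H by auto.
  assert (ln a <= c) by (rewrite <- (ln_exp c); apply ln_le; auto). lra.
Qed.

Lemma max_modulus_rect (f : C -> C) (a b c d M : R) :
  (forall z, a <= Re z <= b -> c <= Im z <= d -> ex_derive f z) ->
  (forall z, a <= Re z <= b -> c <= Im z <= d ->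
     Re z = a \/ Re z = b \/ Im z = c \/ Im z = d -> Cmod (f z) <= M) ->
  forall z, a <= Re z <= b -> c <= Im z <= d -> Cmod (f z) <= M.
Proof.
  intros Hd HM z0 Hz1 Hz2.
  apply (max_modulus (fun z => (a <= Re z <= b) /\ (c <= Im z <= d)) f
    (Rabs a + Rabs b + Rabs c + Rabs d) M); auto.
  - intros z N.
    assert (Hcl : exists e, 0 < e /\ forall u, Rabs (Re u - Re z) < e -> Rabs (Im u - Im z) < e ->
      ~ ((a <= Re u <= b) /\ (c <= Im u <= d))).
    { destruct (Rlt_le_dec (Re z) a); [|destruct (Rlt_le_dec b (Re z));
        [|destruct (Rlt_le_dec (Im z) c); [|destruct (Rlt_le_dec d (Im z))]]].
      - exists (a - Re z). split; [lra|]. intros u H1 H2 H3. apply Rabs_lt_between in H1. lra.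
      - exists (Re z - b). split; [lra|]. intros u H1 H2 H3. apply Rabs_lt_between in H1. lra.
      - exists (c - Im z). split; [lra|]. intros u H1 H2 H3. apply Rabs_lt_between in H2. lra.
      - exists (Im z - d). split; [lra|]. intros u H1 H2 H3. apply Rabs_lt_between in H2. lra.
      - exfalso. apply N. lra. }
    destruct Hcl as (e & He & H). exists e; split; auto. intros u Hu. apply H.
    + rewrite <- Re_minus. eapply Rle_lt_trans; [apply re_le_Cmod|auto].
    + rewrite <- Im_minus. eapply Rle_lt_trans; [apply Im_le_Cmod|auto].
  - intros z [H1 H2]. eapply Rle_trans; [apply Cmod_le_Re_Im|].
    assert (Rabs (Re z) <= Rabs a + Rabs b).
    { apply Rabs_le. generalize (Rle_abs a) (Rle_abs b) (Rle_abs (- a)) (Rabs_pos a) (Rabs_pos b).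
      rewrite Rabs_Ropp. lra. }
    assert (Rabs (Im z) <= Rabs c + Rabs d).
    { apply Rabs_le. generalize (Rle_abs c) (Rle_abs d) (Rle_abs (- c)) (Rabs_pos c) (Rabs_pos d).
      rewrite Rabs_Ropp. lra. }
    lra.
  - intros z [H1 H2]. apply C_ex_derive_continuous, Hd; auto.
  - intros z [H1 H2].
    destruct (classic (Re z = a \/ Re z = b \/ Im z = c \/ Im z = d)) as [HB|HI]; [left; auto|right].
    destruct (exists_pos_le_four (Re z - a) (b - Re z) (Im z - c) (d - Im z))
      as (m & Hm & M1 & M2 & M3 & M4); try (apply Rnot_le_lt; intros E; apply HI; lra).
    assert (HI' : forall u, Cmod (u - z) <= m -> a <= Re u <= b /\ c <= Im u <= d).
    { intros u Hu.
      destruct (Re_Im_near _ _ _ Hu). lra. }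
    exists m. repeat split; auto; try (apply HI'; auto).
    intros u Hu. apply Hd; apply HI'; lra.
Qed.

(** Ensures that ln (b1 T) = ln b1 + l stays positive, since l >= 2. *)
Lemma ln_b1_ge (b : R) : 0.95 < b -> - 0.1 <= ln b.
Proof.
  intros Hb. assert (H := exp_ineq1_le (- ln b)). rewrite exp_Ropp, exp_ln in H by lra.
  assert (/ b <= / 0.95) by (apply Rinv_le_contravar; lra). lra.
Qed.

(** * Both bounds for an abstract logarithm in the strip *)

Section Core.
Variables (q : Z) (chi : Z -> C) (L : C -> C) (t l T : R).
Hypotheses (Hq : (2 <= q)%Z) (Hchi : is_primitive_character q chi) (HL : is_dirichlet_L chi L)
  (HT : T = ln (IZR q * Rabs t)) (HlT : T = exp l)
  (HT0 : 9.5 <= T) (Hl0 : 2 <= l) (Hl1 : l <= T / 10 + 1.35)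
  (Ht0 : 100 <= Rabs t) (Ht1 : 5 * l + 4 <= 0.1 * Rabs t).

Variable f : C -> C.
(* The left side stays 0.001 / l away from Re z = 1/2 so that a logarithm can be
   constructed on a closed rectangle inside the zero-free region. *)
Definition log_strip (z : C) : Prop :=
  1 / 2 + 0.001 / l < Re z < 3 /\ Rabs (Im z - t) < 5 * l + 3.
Hypotheses (Hf : forall z, log_strip z -> ex_derive f z)
  (Hfp : forall z, log_strip z -> 1 < Re z -> f z = prime_sum chi z).

(** Since 1.1 - 0.6 = 1/2, the margins 0.001, 0.0015 and 0.002 over l nest the Borel-Caratheodory
    disc in that of the identity theorem and the latter in the strip. *)
Lemma log_strip_disc (y : R) (u : C) :
  Rabs (y - t) <= 5 * l + 1 -> Cmod (u - (1.1, y)) <= 0.6 - 0.0015 / l -> log_strip u.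
Proof.
  intros Hy Hu. assert (I := inv_le_half l Hl0). unfold Rdiv in *.
  destruct (Re_Im_near _ _ _ Hu) as [R1 R2]. simpl in R1, R2. apply Rabs_le_between in Hy.
  split; [lra|]. apply Rabs_lt_between. lra.
Qed.

(** Holds where f is the prime sum, in particular within 0.05 of the centre, and spreads over the
    disc by the identity theorem. *)
Lemma Cexp_f_disc (y : R) (u : C) :
  Rabs (y - t) <= 5 * l + 1 -> Cmod (u - (1.1, y)) < 0.6 - 0.0015 / l -> Cexp (f u) = L u.
Proof.
  intros Hy Hu. assert (I := inv_le_half l Hl0).
  apply (identity_theorem_disc (fun u => Cexp (f u)) L (1.1, y) u 0.05 (0.6 - 0.0015 / l)); try lra; auto.
  - intros v Hv. split.
    + apply C_ex_derive_Cexp, Hf. eapply log_strip_disc; eauto.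
    + apply (L_ex_derive chi), HL.
  - intros v Hv.
    destruct (Re_Im_near _ _ _ (Rlt_le _ _ Hv)) as [R1 _]. simpl in R1.
    assert (LS : log_strip v) by (apply (log_strip_disc y); auto; unfold Rdiv; lra).
    rewrite Hfp by (auto; lra). apply (Cexp_prime_sum_eq q); auto. lra.
Qed.

Lemma Re_f_le (y : R) (u : C) :
  Rabs (y - t) <= 5 * l + 1 -> Cmod (u - (1.1, y)) <= 0.6 - 0.002 / l -> Re (f u) <= T / 2 + 1.6.
Proof.
  intros Hy Hu. assert (I := inv_le_half l Hl0).
  assert (LS : log_strip u) by (apply (log_strip_disc y); auto; unfold Rdiv in *; lra).
  assert (E : Cexp (f u) = L u) by (apply (Cexp_f_disc y); auto; unfold Rdiv in *; lra).
  assert (M : exp (Re (f u)) = Cmod (L u)) by (rewrite <- Cmod_Cexp, E; auto).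
  destruct LS as [S1 S2].
  assert (B := Cmod_L_le q chi L Hq Hchi HL u ltac:(unfold Rdiv in *; lra)).
  assert (Q2 : 2 <= IZR q) by (apply IZR_le; auto).
  set (tau := IZR q * Rabs t) in *.
  assert (Htau : 200 <= tau) by (unfold tau; nra).
  (* Height at most |t| + 5 l + 3 and abscissa at most 3; [Ht1] and |t| >= 100 absorb everything
     beyond |t| into 0.2 |t|. *)
  assert (Cu : Cmod u <= 1.2 * Rabs t).
  { eapply Rle_trans; [apply Cmod_le_Re_Im|].
    assert (Rabs (Re u) <= 3) by (apply Rabs_le; unfold Rdiv in *; lra).
    assert (Rabs (Im u) <= Rabs (Im u - t) + Rabs t).
    { replace (Im u) with (Im u - t + t) at 1 by ring. apply Rabs_triang. }
    lra. }
  assert (B1 : IZR q * Cmod u + 1 <= 1.21 * tau).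
  { assert (IZR q * Cmod u <= IZR q * (1.2 * Rabs t)) by (apply Rmult_le_compat_l; lra).
    unfold tau in *. lra. }
  assert (Es : sqrt (1.21 * tau) = 1.1 * exp (T / 2)).
  { replace (1.21 * tau) with ((1.1 * exp (T / 2)) * (1.1 * exp (T / 2))).
    - apply sqrt_square. generalize (exp_pos (T / 2)). lra.
    - replace (1.1 * exp (T / 2) * (1.1 * exp (T / 2))) with (1.21 * (exp (T / 2) * exp (T / 2))) by lra.
      rewrite <- exp_plus. replace (T / 2 + T / 2) with T by field.
      rewrite HT, exp_ln by lra. reflexivity. }
  assert (B2 : sqrt (IZR q * Cmod u + 1) <= 1.1 * exp (T / 2)).
  { rewrite <- Es. apply sqrt_le_1; try lra.
    generalize (Cmod_ge_0 u). nra. }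
  (* 4.4 = 4 * 1.1: the constant of the bound for L times the root of 1.21. *)
  assert (E16 : 4.4 <= exp 1.6).
  { apply Rle_trans with ((1 + 0.1) ^ 16); [simpl; lra|].
    replace 1.6 with (INR 16 * 0.1) by (simpl; lra). apply exp_ge_pow. lra. }
  apply Rnot_lt_le. intros HN. apply exp_increasing in HN.
  rewrite exp_plus, M in HN. assert (P := exp_pos (T / 2)). nra.
Qed.

Lemma ln_one_plus_2l : ln (1 + 2 * l) <= 1.2 * l.
Proof.
  (* The tangent at 4 gives l / 2 + 0.75, below 1.2 l for l >= 2. *)
  assert (H := ln_le_tangent (1 + 2 * l) 4 1.5 ltac:(lra) ltac:(lra)).
  assert (4 <= exp 1.5).
  { apply Rle_trans with ((1 + 0.125) ^ 12); [simpl; lra|].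
    replace 1.5 with (INR 12 * 0.125) by (simpl; lra). apply exp_ge_pow. lra. }
  specialize (H H0). lra.
Qed.

Lemma Cmod_f_right (z : C) : log_strip z -> 1 + 0.5 / l <= Re z -> Cmod (f z) <= 1.2 * l.
Proof.
  intros LS Hz. assert (I := inv_le_half l Hl0). unfold Rdiv in Hz.
  rewrite Hfp by (auto; lra).
  eapply Rle_trans; [apply (Cmod_prime_sum_bound q chi); auto; lra|].
  eapply Rle_trans; [|apply ln_one_plus_2l].
  apply ln_le.
  - assert (0 < / (Re z - 1)) by (apply Rinv_0_lt_compat; lra). lra.
  - apply Rplus_le_compat_l. replace (2 * l) with (/ (0.5 * / l)) by (replace 0.5 with (/ 2) by lra; field; lra).
    apply Rinv_le_contravar; lra.
Qed.

(** Borel-Caratheodory on a disc centred at the same height as z; the gap 0.498 / l between the two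
    radii produces the factor l. *)
Lemma Cmod_f_left (z : C) :
  1 / 2 + 0.5 / l <= Re z <= 1 + 0.5 / l -> Rabs (Im z - t) <= 5 * l + 1 ->
  Cmod (f z) <= 1.8 * T * l.
Proof.
  intros Hx Hy. assert (I := inv_le_half l Hl0).
  set (y := Im z) in *. set (a := ((1.1, y) : C)).
  set (r := 0.6 - 0.5 / l).
  assert (La : log_strip a).
  { apply (log_strip_disc y); auto. unfold a. rewrite Cmod_self. unfold Rdiv; lra. }
  (* At abscissa 1.1 the Euler product gives ln 11. *)
  assert (Fa : Cmod (f a) <= 2.5).
  { rewrite Hfp by (auto; simpl; lra).
    eapply Rle_trans; [apply (Cmod_prime_sum_bound q chi); auto; simpl; lra|].
    simpl Re. replace (1 + / (1.1 - 1)) with 11 by (replace (1.1 - 1) with (/ 10) by lra; rewrite Rinv_inv; lra).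
    rewrite <- (ln_exp 2.5). apply ln_le; [lra|].
    apply Rle_trans with ((1 + 0.05) ^ 50); [simpl; lra|].
    replace 2.5 with (INR 50 * 0.05) by (simpl; lra). apply exp_ge_pow. lra. }
  (* 4.1 = 1.6 + 2.5, the second summand allowing for a negative Re (f a). *)
  assert (BC : Cmod (f z - f a) * (0.6 - 0.002 / l - r) <= 2 * (T / 2 + 4.1) * r).
  { apply borel_caratheodory.
    - unfold Rdiv; lra.
    - lra.
    - unfold r, Rdiv; lra.
    - intros u Hu. apply Hf, (log_strip_disc y); auto. unfold a, Rdiv in *. lra.
    - intros u Hu. assert (H := Re_f_le y u Hy Hu).
      assert (R := re_le_Cmod (f a)). apply Rabs_le_between in R. lra.
    - replace (z - a)%C with (RtoC (Re z - 1.1)).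
      rewrite Cmod_R. apply Rabs_le. unfold r, Rdiv in *. lra.
      unfold a, y. destruct z as [x w]. unfold Cminus, Cplus, Copp, RtoC; simpl. f_equal; ring. }
  replace (0.6 - 0.002 / l - r) with (0.498 / l) in BC by (unfold r, Rdiv; lra).
  assert (Tri : Cmod (f z) <= Cmod (f z - f a) + 2.5).
  { replace (f z) with ((f z - f a) + f a)%C at 1 by ring.
    eapply Rle_trans; [apply Cmod_triangle|]. lra. }
  set (g := Cmod (f z - f a)) in *.
  assert (G : g * 0.498 <= (T / 2 + 4.1) * (1.2 * l - 1)).
  { replace (g * 0.498) with (g * (0.498 / l) * l) by (generalize 0.498; intros; field; lra).
    replace ((T / 2 + 4.1) * (1.2 * l - 1)) with (2 * (T / 2 + 4.1) * r * l)
      by (unfold r; replace 0.5 with (/ 2) by lra; replace 0.6 with (1.2 / 2) by lra;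
          generalize 1.2 4.1; intros; field; lra).
    apply Rmult_le_compat_r; lra. }
  (* The leading term is (0.6 / 0.498) T l; the room up to 1.8 T l absorbs the rest because T >= 9.5
     and l <= T / 10 + 1.35. *)
  nra.
Qed.

Lemma ln_b1T (b : R) : 0 < b -> ln (b * T) = ln b + l.
Proof. intros Hb. rewrite ln_mult, HlT, ln_exp; lra. Qed.

Lemma log_bound_main (b1 : R) (w : C) :
  0.95 < b1 < 1 ->
  1 / 2 + 0.5 / l <= Re w <= 1 + 0.5 / l -> Rabs (Im w - t) <= 1 ->
  Cmod (f w) <= 5.44 * Rpower (b1 * T) (2 * (1 - Re w)) * l.
Proof.
  intros Hb Hx Hy. assert (I := inv_le_half l Hl0).
  set (lam := ln (b1 * T)).
  assert (Elam : lam = ln b1 + l) by (apply ln_b1T; lra).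
  assert (Lb : ln b1 < 0) by (rewrite <- ln_1; apply ln_increasing; lra).
  assert (Lb2 := ln_b1_ge b1 ltac:(lra)).
  assert (Hll : lam * / l <= 1).
  { apply Rmult_le_reg_r with l; [lra|]. rewrite Rmult_assoc, Rinv_l by lra. lra. }
  assert (E1 := exp_1_le).
  assert (E01 := exp_hundredth_le).
  (* Three lines: exp (2 lam (s - 1)) levels the bounds on the vertical sides and
     exp (0.04 (s - w)^2) makes the horizontal sides harmless. *)
  set (Phi := fun s => (f s * Cexp (RtoC (2 * lam) * (s - 1) + RtoC 0.04 * ((s - w) * (s - w))))%C).
  assert (MPhi : forall s, Cmod (Phi s) = Cmod (f s)
    * exp (2 * lam * (Re s - 1) + 0.04 * ((Re s - Re w) ^ 2 - (Im s - Im w) ^ 2))).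
  { intros s. unfold Phi. rewrite Cmod_mult, Cmod_Cexp. f_equal. f_equal.
    rewrite re_plus, !re_scal_l, re_mult, !Re_minus, Im_minus, re_RtoC. ring. }
  apply Rabs_le_between in Hy.
  assert (LS : forall s, 1 / 2 + 0.5 / l <= Re s <= 1 + 0.5 / l ->
    Im w - 5 * l <= Im s <= Im w + 5 * l -> log_strip s /\ Rabs (Im s - t) <= 5 * l + 1).
  { intros s H1 H2. unfold Rdiv in *. split; [split; [lra|apply Rabs_lt_between; lra]|].
    apply Rabs_le_between. lra. }
  assert (B : Cmod (Phi w) <= 5.44 * l).
  { apply (max_modulus_rect Phi (1 / 2 + 0.5 / l) (1 + 0.5 / l) (Im w - 5 * l) (Im w + 5 * l));
      [| |auto|lra].
    - intros z H1 H2. destruct (LS z H1 H2) as [S _]. unfold Phi.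
      apply C_ex_derive_mult; auto. apply C_ex_derive_Cexp. auto 12 with cder.
    - intros z H1 H2 Hbd. destruct (LS z H1 H2) as [S1 S2]. rewrite MPhi.
      (* The rectangle has width 1/2, so the damping factor increases the modulus by at most exp
         0.01. *)
      assert (Sq : (Re z - Re w) ^ 2 <= 1 / 4).
      { assert (Habs : Rabs (Re z - Re w) <= 1 / 2) by (apply Rabs_le; unfold Rdiv in *; lra).
        rewrite <- pow2_abs. generalize (Rabs_pos (Re z - Re w)). nra. }
      assert (Sq2 := pow2_ge_0 (Im z - Im w)).
      assert (FL := Cmod_f_left z H1 S2). assert (F0 := Cmod_ge_0 (f z)).
      assert (Elr : 2 * lam * (Re z - 1) <= 1).
      { apply Rle_trans with (2 * lam * (0.5 * / l)); [|lra].
        apply Rmult_le_compat_l; [lra|unfold Rdiv in *; lra]. }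
      destruct Hbd as [E|[E|E]].
      (* Left side: 2.93 bounds exp 1.01 / 0.95, and 1.8 * 2.93 < 5.44. *)
      + assert (X : exp (2 * lam * (Re z - 1) + 0.04 * ((Re z - Re w) ^ 2 - (Im z - Im w) ^ 2))
          <= 2.93 * / T).
        { apply Rle_trans with (exp (1 + 0.01 + - ln b1 + - l)).
          - apply exp_monotone. rewrite E in *.
            replace (2 * lam * (1 / 2 + 0.5 / l - 1)) with (- lam + lam * / l) by (replace 0.5 with (/ 2) by lra; field; lra). lra.
          - rewrite !exp_plus, (exp_Ropp l), <- HlT, exp_Ropp, exp_ln by lra.
            apply Rmult_le_compat_r. left; apply Rinv_0_lt_compat; lra.
            apply Rle_trans with (2.75 * 1.0102 * / 0.95).
            apply Rmult_le_compat; [apply Rmult_le_pos; left; apply exp_pos|left; apply Rinv_0_lt_compat; lra| |].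
            apply Rmult_le_compat; try lra; left; apply exp_pos.
            apply Rinv_le_contravar; lra. lra. }
        apply Rle_trans with (1.8 * T * l * (2.93 * / T)).
        * apply Rmult_le_compat; auto. left; apply exp_pos.
        * replace (1.8 * T * l * (2.93 * / T)) with (1.8 * 2.93 * l) by (generalize 1.8 2.93; intros; field; lra). lra.
      (* Right side: 2.8 bounds exp 1.01, and 1.2 * 2.8 < 5.44. *)
      + assert (X : exp (2 * lam * (Re z - 1) + 0.04 * ((Re z - Re w) ^ 2 - (Im z - Im w) ^ 2))
          <= 2.8).
        { apply Rle_trans with (exp (1 + 0.01)). apply exp_monotone; lra.
          rewrite exp_plus. assert (exp 1 * exp 0.01 <= 2.75 * 1.0102); [|lra].
          apply Rmult_le_compat; try lra; left; apply exp_pos. }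
        assert (FR := Cmod_f_right z S1 ltac:(lra)).
        apply Rle_trans with (1.2 * l * 2.8); [|lra].
        apply Rmult_le_compat; auto. left; apply exp_pos.
      + assert (Sq3 : (Im z - Im w) ^ 2 = 25 * (l * l)).
        { destruct E as [E|E]; rewrite E; ring. }
        assert (X : exp (2 * lam * (Re z - 1) + 0.04 * ((Re z - Re w) ^ 2 - (Im z - Im w) ^ 2))
          <= / T).
        { rewrite HlT, <- exp_Ropp. apply exp_monotone. rewrite Sq3. nra. }
        apply Rle_trans with (1.8 * T * l * / T).
        * apply Rmult_le_compat; auto. left; apply exp_pos.
        * replace (1.8 * T * l * / T) with (1.8 * l) by (generalize 1.8; intros; field; lra). lra. }
  rewrite MPhi in B. unfold Rpower. fold lam.
  replace (2 * lam * (Re w - 1) + 0.04 * ((Re w - Re w) ^ 2 - (Im w - Im w) ^ 2))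
    with (- (2 * (1 - Re w) * lam)) in B by ring.
  rewrite exp_Ropp in B. set (X := exp (2 * (1 - Re w) * lam)) in *.
  assert (HX : 0 < X) by apply exp_pos.
  apply Rmult_le_compat_r with (r := X) in B; [|lra].
  rewrite Rmult_assoc, Rinv_l, Rmult_1_r in B by lra. lra.
Qed.

(* With radius k / l the Cauchy estimate loses a factor exp (2 k) / k, which is
   smallest at k = 1/2. *)
Lemma log_bound_circle (b1 : R) (s u : C) :
  0.95 < b1 < 1 ->
  1 / 2 + 1.0051 / l <= Re s <= 1 + 0.3349 / l -> Im s = t -> Cmod (u - s) = 0.5 / l ->
  log_strip u /\ Cmod (f u) <= 5.44 * 2.75 * Rpower (b1 * T) (2 * (1 - Re s)) * l.
Proof.
  intros Hb Hs Hst Hu. assert (I := inv_le_half l Hl0).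
  assert (R1 := re_le_Cmod (u - s)). assert (R2 := Im_le_Cmod (u - s)).
  rewrite Re_minus, Hu in R1. rewrite Im_minus, Hst, Hu in R2.
  assert (R1' := R1). apply Rabs_le_between in R1'. unfold Rdiv in *.
  assert (LS : log_strip u).
  { split; [unfold Rdiv; lra|]. lra. }
  split; auto.
  set (lam := ln (b1 * T)).
  assert (Elam : lam = ln b1 + l) by (apply ln_b1T; lra).
  assert (Lb : ln b1 < 0) by (rewrite <- ln_1; apply ln_increasing; lra).
  assert (Lb2 := ln_b1_ge b1 ltac:(lra)).
  assert (Hll : 0 < lam * / l <= 1).
  { split. apply Rmult_lt_0_compat; lra.
    apply Rmult_le_reg_r with l; [lra|]. rewrite Rmult_assoc, Rinv_l by lra. lra. }
  assert (E1 := exp_1_le).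
  unfold Rpower. fold lam.
  (* The offset 1.0051 keeps the circle to the right of 1/2 + 0.5 / l, but it may cross 1 + 0.5 / l;
     beyond that line the Euler product takes over, and the power at s is at least 1 / e. *)
  destruct (Rle_lt_dec (Re u) (1 + 0.5 * / l)) as [H|H].
  - assert (B := log_bound_main b1 u Hb ltac:(unfold Rdiv; lra) ltac:(lra)).
    unfold Rpower in B. fold lam in B.
    eapply Rle_trans; [apply B|]. apply Rmult_le_compat_r; [lra|].
    rewrite (Rmult_assoc 5.44 2.75). apply Rmult_le_compat_l; [lra|].
    apply Rle_trans with (exp (1 + 2 * (1 - Re s) * lam)).
    + apply exp_monotone.
      assert (2 * (1 - Re u) * lam <= 2 * (1 - Re s + 0.5 * / l) * lam).
      { apply Rmult_le_compat_r; lra. }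
      lra.
    + rewrite exp_plus. apply Rmult_le_compat_r; [left; apply exp_pos|lra].
  - assert (B := Cmod_f_right u LS ltac:(unfold Rdiv; lra)).
    assert (X : / 2.75 <= exp (2 * (1 - Re s) * lam)).
    { apply Rle_trans with (exp (- (1))).
      - rewrite exp_Ropp. apply Rinv_le_contravar; auto. apply exp_pos.
      - apply exp_monotone.
        assert (2 * (Re s - 1) * lam <= 2 * (0.3349 * / l) * lam).
        { apply Rmult_le_compat_r; lra. }
        lra. }
    eapply Rle_trans; [apply B|]. apply Rmult_le_compat_r; [lra|]. lra.
Qed.

(** 29.92 = 5.44 * 2.75 / 0.5, from the bound on the circle and its radius 0.5 / l. *)
Lemma derivative_bound (b1 : R) (s l' : C) :
  0.95 < b1 < 1 ->
  1 / 2 + 1.0051 / l <= Re s <= 1 + 0.3349 / l -> Im s = t -> is_derive f s l' ->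
  Cmod l' <= 29.92 * Rpower (b1 * T) (2 * (1 - Re s)) * l ^ 2.
Proof.
  intros Hb Hs Hst Hd. assert (I := inv_le_half l Hl0).
  replace (29.92 * Rpower (b1 * T) (2 * (1 - Re s)) * l ^ 2)
    with (5.44 * 2.75 * Rpower (b1 * T) (2 * (1 - Re s)) * l / (0.5 / l))
    by (replace 29.92 with (2 * (5.44 * 2.75)) by lra; replace 0.5 with (/ 2) by lra;
        generalize 5.44 2.75; intros; field; lra).
  apply (cauchy_estimate f s l' (0.5 / l)); auto.
  - apply Rdiv_lt_0_compat; lra.
  - intros z Hz. apply Hf.
    destruct (Re_Im_near _ _ _ Hz) as [R1 R2]. rewrite Hst in R2. unfold Rdiv in *.
    split; [unfold Rdiv; lra|]. apply Rabs_lt_between. lra.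
  - intros z Hz. apply (log_bound_circle b1 s z); auto.
Qed.
End Core.

(** * The height condition, the construction of the logarithm and the conclusion *)

Lemma height_bounds (q : Z) (t : R) :
  (2 <= q)%Z -> 10450 + 10 ^ 3 * ln (ln (IZR q)) <= Rabs t ->
  let T := ln (IZR q * Rabs t) in
  let l := ln T in
  9.5 <= T /\ T = exp l /\ 2 <= l /\ l <= T / 10 + 1.35 /\
  100 <= Rabs t /\ 5 * l + 4 <= 0.1 * Rabs t.
Proof.
  intros Hq Ht T l.
  assert (Q2 : 2 <= IZR q) by (apply IZR_le; auto).
  assert (E1 := exp_1_le).
  assert (E2 : exp 0.5 <= 1.66).
  { apply Rnot_lt_le. intros H.
    assert (exp 1 = exp 0.5 * exp 0.5) by (rewrite <- exp_plus; f_equal; lra). nra. }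
  assert (E0 : 1 <= exp 0.5) by (generalize (exp_ineq1_le 0.5); lra).
  assert (X : 0.5 <= ln (IZR q)).
  { rewrite <- (ln_exp 0.5). apply ln_le. apply exp_pos. lra. }
  assert (E3 : 2.25 <= exp 1).
  { replace 1 with (INR 2 * 0.5) by (simpl; lra).
    eapply Rle_trans; [|apply exp_ge_pow; lra]. simpl; lra. }
  (* The iterated logarithm is negative for q = 2; this lower bound still leaves |t| >= 9450. *)
  assert (LLQ : - 1 <= ln (ln (IZR q))).
  { apply Rle_trans with (ln (exp (- (1)))). rewrite ln_exp; lra.
    apply ln_le. apply exp_pos. rewrite exp_Ropp.
    apply Rle_trans with (/ 2.25); [|lra]. apply Rinv_le_contravar; lra. }
  assert (Ht9 : 9450 <= Rabs t) by lra.
  assert (E95 : exp 9.5 <= 18900).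
  { replace 9.5 with (INR 19 * 0.5) by (simpl; lra). rewrite exp_mult_nat.
    apply Rle_trans with (1.66 ^ 19). apply pow_incr; lra. simpl; lra. }
  assert (HT : 9.5 <= T).
  { unfold T. rewrite <- (ln_exp 9.5). apply ln_le. apply exp_pos. nra. }
  assert (Hl : T = exp l) by (unfold l; rewrite exp_ln; lra).
  assert (Hl2 : 2 <= l).
  { unfold l. rewrite <- (ln_exp 2). apply ln_le. apply exp_pos.
    replace 2 with (1 + 1) by ring. rewrite exp_plus.
    assert (P1 := exp_pos 1). assert (exp 1 * exp 1 <= 2.75 * 2.75) by (apply Rmult_le_compat; lra). lra. }
  split; [auto|split; [auto|split; [auto|split; [|split; [lra|]]]]].
  (* Tangent to ln at 10, whence 1.35 = 2.35 - 1. *)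
  - assert (E10 : 10 <= exp 2.35).
    { replace 2.35 with (INR 94 * 0.025) by (simpl; lra).
      eapply Rle_trans; [|apply exp_ge_pow; lra].
      replace ((1 + 0.025) ^ 94) with ((((1 + 0.025) ^ 10) ^ 9) * (1 + 0.025) ^ 4)
        by (rewrite <- pow_mult, <- pow_add; f_equal).
      apply Rle_trans with (1.28 ^ 9 * 1.1); [simpl; lra|].
      apply Rmult_le_compat; [apply pow_le; lra|lra| |simpl; lra].
      apply pow_incr. simpl; lra. }
    assert (H := ln_le_tangent T 10 2.35 ltac:(lra) ltac:(lra) E10). fold l in H. lra.
  - set (x := ln (IZR q)) in *. set (y := ln (Rabs t)).
    assert (HTxy : T = x + y) by (apply ln_mult; lra).
    assert (Hy : 1 <= y).
    { unfold y. rewrite <- (ln_exp 1). apply ln_le. apply exp_pos. lra. }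
    (* Separates q from t: the term ln x is the iterated logarithm of q, which the height condition
       bounds by (|t| - 10450) / 1000. *)
    assert (L1 : l <= 2 + ln x + ln y).
    { apply Rle_trans with (ln (exp 2 * x * y)).
      - unfold l. apply ln_le; [lra|]. rewrite HTxy.
        assert (3 <= exp 2) by (generalize (exp_ineq1_le 2); lra).
        assert (0 < x * y) by (apply Rmult_lt_0_compat; lra).
        assert (x + y <= 3 * (x * y)) by nra. nra.
      - rewrite !ln_mult, ln_exp; try lra; try apply exp_pos.
        apply Rmult_lt_0_compat; [apply exp_pos|lra]. }
    assert (L2 : ln y <= y - 1).
    { assert (H := exp_ineq1_le (ln y)). rewrite exp_ln in H; lra. }
    assert (L3 : y <= Rabs t / 10000 - 1 + 20).
    { apply ln_le_tangent; try lra.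
      replace 20 with (INR 20 * 1) by (simpl; lra).
      eapply Rle_trans; [|apply exp_ge_pow; lra]. simpl; lra. }
    lra.
Qed.

Lemma log_strip_region (q : Z) (t : R) (z : C) :
  (2 <= q)%Z -> 100 <= Rabs t -> 9.5 <= ln (IZR q * Rabs t) ->
  2 <= ln (ln (IZR q * Rabs t)) ->
  1 / 2 < Re z -> Rabs (Im z - t) <= 5 * ln (ln (IZR q * Rabs t)) + 3 ->
  regionR (10 ^ 3) (IZR q) t z.
Proof.
  intros Hq Ht HT Hl Hz H. split; auto.
  assert (Q2 : 2 <= IZR q) by (apply IZR_le; auto).
  assert (ln (ln (IZR q * Rabs t)) <= ln (ln (IZR q * (Rabs t + 1)))).
  { apply ln_le; [lra|]. apply ln_le; nra. }
  lra.
Qed.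

(** The logarithm starts from the prime sum at 2 + i t. To the right of 1 it has the same derivative
    L'/L as the prime sum, hence agrees with it. *)
Lemma log_L_exists (q : Z) (chi : Z -> C) (L : C -> C) (t l : R) :
  (2 <= q)%Z -> is_primitive_character q chi -> is_dirichlet_L chi L -> 2 <= l ->
  (forall z, 1 / 2 < Re z -> Rabs (Im z - t) <= 5 * l + 3 -> L z <> 0%C) ->
  exists f : C -> C, forall z, log_strip t l z ->
    is_derive f z (C_derive L z / L z)%C /\ (1 < Re z -> f z = prime_sum chi z).
Proof.
  intros Hq Hchi HL Hl Hnz.
  assert (I := inv_le_half l Hl).
  assert (DL : forall z, ex_derive L z) by (intros; apply (L_ex_derive chi), HL).
  destruct (holomorphic_log_rect L (2, t) (prime_sum chi (2, t))
    (1 / 2 + 0.001 / l) 3 (t - (5 * l + 3)) (t + (5 * l + 3))) as (f & Hf2 & Hf); auto.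
  - intros z Hz1 Hz2. unfold Rdiv in *. apply Hnz. unfold Rdiv; lra. apply Rabs_le_between; lra.
  - simpl. unfold Rdiv; lra.
  - simpl. lra.
  - apply (Cexp_prime_sum_eq q); auto. simpl; lra.
  - exists f. intros z [Hz1 Hz2]. apply Rabs_lt_between in Hz2.
    destruct (Hf z Hz1 ltac:(lra)) as [Hd He]. split; auto. intros Hz.
    assert (E : (f z - prime_sum chi z = f (2, t) - prime_sum chi (2, t))%C).
    { apply (zero_derive_constant (fun z => f z - prime_sum chi z)%C). intros v Hv.
      set (u := (z + v * ((2, t) - z))%C).
      assert (U1 : 1 < Re u < 3).
      { unfold u. rewrite Re_segment. apply segment_convex; auto; simpl; lra. }
      assert (U2 : t - (5 * l + 3) < Im u < t + (5 * l + 3)).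
      { unfold u. rewrite Im_segment. apply segment_convex; auto; simpl; lra. }
      assert (D : exists d : C, is_derive (prime_sum chi) u d)
        by (apply (prime_sum_ex_derive q); auto; lra).
      destruct D as [d Hd'].
      assert (Nu : L u <> 0%C).
      { apply Hnz. lra. apply Rabs_le_between. lra. }
      (* Obtained by differentiating exp (prime sum) = L near u. *)
      assert (Ed : d = (C_derive L u / L u)%C).
      { assert (D1 : is_derive L u (d * L u)%C).
        { apply C_is_derive_ext_loc with (fun w => Cexp (prime_sum chi w)).
          - apply Clocally_eps. exists ((Re u - 1) / 2). split; [lra|]. intros w Hw.
            destruct (Re_Im_near _ _ _ (Rlt_le _ _ Hw)).
            apply (Cexp_prime_sum_eq q); auto. lra.
          - rewrite <- (Cexp_prime_sum_eq q chi L Hq Hchi HL u) by lra.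
            apply (C_is_derive_comp Cexp (prime_sum chi)); auto. apply C_is_derive_Cexp. }
        rewrite (is_C_derive_unique L u _ D1). field; auto. }
      replace (RtoC 0) with (C_derive L u / L u - d)%C by (rewrite Ed; ring).
      apply C_is_derive_minus; auto. apply Hf; [unfold Rdiv in *; lra|lra]. }
    rewrite Hf2 in E. apply Ceq_minus. rewrite E. ring.
Qed.

(** For sigma <= 1 the larger base only helps; for sigma > 1 the loss is exp (2 (sigma - 1) d) with
    d = ln (0.9705 / 0.9505) <= 0.022 and sigma - 1 <= 0.3349 / l. *)
Lemma Rpower_base_change (l T sigma : R) :
  T = exp l -> 2 <= l -> sigma <= 1 + 0.3349 / l ->
  Rpower (0.9505 * T) (2 * (1 - sigma)) <= 1.03 * Rpower (0.9705 * T) (2 * (1 - sigma)).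
Proof.
  intros HT Hl Hs.
  assert (I := inv_le_half l Hl).
  assert (PT : 0 < T) by (rewrite HT; apply exp_pos).
  set (d := ln 0.9705 - ln 0.9505).
  assert (Hd : 0 <= d <= 0.022).
  { unfold d. split.
    - assert (ln 0.9505 <= ln 0.9705) by (apply ln_le; lra). lra.
    - rewrite <- ln_div by lra.
      assert (H := exp_ineq1_le (ln (0.9705 / 0.9505))). rewrite exp_ln in H by lra. lra. }
  assert (E : Rpower (0.9505 * T) (2 * (1 - sigma))
    = exp (2 * (sigma - 1) * d) * Rpower (0.9705 * T) (2 * (1 - sigma))).
  { unfold Rpower. rewrite <- exp_plus, !ln_mult by lra. f_equal. unfold d. ring. }
  rewrite E. apply Rmult_le_compat_r. left; apply exp_pos.
  apply Rle_trans with (exp 0.01).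
  - apply exp_monotone. unfold Rdiv in Hs. nra.
  - generalize exp_hundredth_le. lra.
Qed.

Theorem corollary2 :
  forall (q : Z) (chi : Z -> C) (L : C -> C),
    (2 <= q)%Z ->
    is_primitive_character q chi ->
    is_dirichlet_L chi L ->
    exists b1 b2 : R,
      0.95 < b1 < 0.951 /\ 0.97 < b2 < 0.971 /\
      forall sigma t : R,
        1 / 2 < sigma ->
        10450 + 10 ^ 3 * ln (ln (IZR q)) <= Rabs t ->
        (forall z : C, regionR (10 ^ 3) (IZR q) t z -> L z <> 0%C) ->
        (intervalS 0.5 0.5 (IZR q) t sigma ->
         forall logL : C -> C,
           is_log_L chi (regionR (10 ^ 3) (IZR q) t) logL ->
           Cmod (logL (sigma, t)) <=
             5.44 * Rpower (b1 * ln (IZR q * Rabs t)) (2 * (1 - sigma))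
                  * ln (ln (IZR q * Rabs t)))
        /\
        (intervalS 1.0051 0.3349 (IZR q) t sigma ->
         Cmod (C_derive L (sigma, t) / L (sigma, t))%C <=
           33.281 * Rpower (b2 * ln (IZR q * Rabs t)) (2 * (1 - sigma))
                  * ln (ln (IZR q * Rabs t)) ^ 2).
Proof.
  intros q chi L Hq Hchi HL. exists 0.9505, 0.9705.
  split; [lra|split; [lra|]]. intros sigma t Hsigma Ht Hnz.
  destruct (height_bounds q t Hq Ht) as (HT & HTl & Hl & Hl1 & Ht0 & Ht1).
  set (T := ln (IZR q * Rabs t)) in *. set (l := ln T) in *.
  assert (I := inv_le_half l Hl).
  split; unfold intervalS; fold T l; intros HS.
  - intros logL [Hh Hp].
    assert (Reg : forall z, log_strip t l z -> regionR (10 ^ 3) (IZR q) t z).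
    { intros z [Hz1 Hz2]. apply log_strip_region; auto; fold T l; [unfold Rdiv in *; lra|lra]. }
    apply (log_bound_main q chi L t l T Hq Hchi HL eq_refl HTl HT Hl Hl1 Ht0 Ht1 logL)
      with (b1 := 0.9505) (w := (sigma, t)); auto.
    + intros z Hz. specialize (Hh z (Reg z Hz)). apply Clocally_eps in Hh.
      destruct Hh as (d & Hd & Hh). apply Hh. rewrite Cmod_self. auto.
    + intros z Hz Hz1. apply (prime_power_sum_eq chi); auto.
    + lra.
    + simpl. replace (t - t) with 0 by ring. rewrite Rabs_R0. lra.
  - destruct (log_L_exists q chi L t l Hq Hchi HL Hl) as (f & Hf).
    { intros z Hz1 Hz2. apply Hnz, log_strip_region; auto. }
    assert (LS : log_strip t l (sigma, t)).
    { split; simpl. unfold Rdiv in *; lra. replace (t - t) with 0 by ring. rewrite Rabs_R0. lra. }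
    assert (B := derivative_bound q chi L t l T Hq Hchi HL eq_refl HTl HT Hl Hl1 Ht0 Ht1 f
      (fun z Hz => ex_intro _ _ (proj1 (Hf z Hz))) (fun z Hz => proj2 (Hf z Hz))
      0.9505 (sigma, t) _ ltac:(lra) HS eq_refl (proj1 (Hf _ LS))).
    simpl Re in B. eapply Rle_trans; [apply B|].
    apply Rmult_le_compat_r; [apply pow2_ge_0|].
    assert (BC := Rpower_base_change l T sigma HTl Hl (proj2 HS)).
    assert (P : 0 < Rpower (0.9705 * T) (2 * (1 - sigma))) by apply exp_pos.
    (* 29.92 * 1.03 is below 33.281. *)
    lra.
Qed.
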